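(* The focal submanifold $M_+$ of OT-FKM type with $(g,m_1,m_2)=(4,8,7)$ in the definite case admits a transitive action by $Spin(9)$ and is diffeomorphic to $Spin(9)/G_2$. Moreover, $M_+$ does not admit any $Spin(9)$-invariant almost complex structure (with respect to this transitive action).
   Context: Let $\{P_0,\dots,P_8\}$ be a symmetric Clifford system on $\mathbb{R}^{32}$ (so $m=8$, $l=16$), i.e. symmetric $32\times 32$ real matrices with $P_iP_j+P_jP_i=2\delta_{ij}I_{32}$. The definite case means $P_0P_1\cdots P_8=\pm I_{32}$. The OT-FKM polynomial is $F(x)=|x|^4-2\sum_{i=0}^8\langle P_ix,x\rangle^2$, and with $f=F|_{S^{31}(1)}$, $$M_+=f^{-1}(1)=\{x\in S^{31}(1):\langle P_ix,x\rangle=0,\ i=0,\dots,8\};$$ the associated isoparametric hypersurfaces (regular level sets of $f$) have $g=4$ and $(m_1,m_2)=(m,l-m-1)=(8,7)$. For a homogeneous space $G/H$ with left translations $\tau_g:pH\mapsto gpH$, an almost complex structure $J$ ($J^2=-\mathrm{Id}$ on the tangent bundle) is $G$-invariant if $J\circ d\tau_g=d\tau_g\circ J$ for all $g\in G$. *)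

(* Defs.v *)
From mathcomp Require Import all_boot all_order all_algebra.
From mathcomp Require Import all_classical all_reals all_analysis.

Set Implicit Arguments.
Unset Strict Implicit.
Unset Printing Implicit Defensive.

Import Order.TTheory GRing.Theory Num.Theory.
Import numFieldNormedType.Exports.

Local Open Scope classical_set_scope.
Local Open Scope ring_scope.

(** * Smooth maps on subsets of Euclidean spaces

  Manifolds are subsets of finite-dimensional real vector spaces, and maps
  between them are total functions of the ambient spaces of which only the
  values on the subset matter.  A map is smooth when it extends, locally at
  each point of the subset, to a C^oo map of the ambient space (Milnor,
  "Topology from the differentiable viewpoint"). *)

Section Smooth.
Context {R : realType}.
Implicit Types V W : normedModType R.

Definition iter_derive V W (f : V -> W) (vs : seq V) : V -> W :=
  foldr (fun v g x => 'D_v g x) f vs.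

(* f is C^oo on some neighbourhood of x, the same for all orders. *)
Definition smooth_at V W (f : V -> W) (x : V) : Prop :=
  \forall y \near x, forall vs : seq V, differentiable (iter_derive f vs) y.

Definition smooth_extension V W (A : set V) (f : V -> W) (x : V) (F : V -> W)
    : Prop :=
  smooth_at F x /\ \forall y \near x, A y -> F y = f y.

Definition smooth_map V W (A : set V) (f : V -> W) : Prop :=
  forall x, A x -> exists F, smooth_extension A f x F.

(* v is the velocity at time 0 of a smooth curve in A passing through x. *)
Definition tangent V (A : set V) (x v : V) : Prop :=
  exists c : R -> V,
    [/\ smooth_at c 0, c 0 = x, \forall t \near (0 : R), A (c t)
      & 'D_1 c 0 = v].

Definition tangent_bundle V (A : set V) : set (V * V) :=
  [set p | A p.1 /\ tangent A p.1 p.2].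

(* The differential at x of f restricted to A; on tangent vectors of A it does
   not depend on the local extension, and it is 0 when there is none. *)
Definition tangent_map V W (A : set V) (f : V -> W) (x v : V) : W :=
  xget 0 [set w | exists F, smooth_extension A f x F /\ w = 'D_v F x].

(* Only the values J x v with x in A and v tangent to A at x matter. *)
Definition almost_complex_structure V (A : set V) (J : V -> V -> V) : Prop :=
  [/\ forall x v, A x -> tangent A x v -> tangent A x (J x v),
      forall x v w (k : R), A x -> tangent A x v -> tangent A x w ->
        J x (k *: v + w) = k *: J x v + J x w,
      forall x v, A x -> tangent A x v -> J x (J x v) = - v
    & smooth_map (tangent_bundle A) (fun p => J p.1 p.2)].

(** * Groups embedded in a vector space, their actions and quotients *)

Section Group.
Variables (V : normedModType R) (mul : V -> V -> V) (one : V) (G : set V).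

Definition closed_subgroup (H : set V) : Prop :=
  [/\ H `<=` G, closed H, H one,
      forall g h, H g -> H h -> H (mul g h)
    & forall h, H h -> exists2 k, H k & mul h k = one].

Definition smooth_action W (M : set W) (a : V -> W -> W) : Prop :=
  [/\ forall g x, G g -> M x -> M (a g x),
      forall x, M x -> a one x = x,
      forall g h x, G g -> G h -> M x -> a (mul g h) x = a g (a h x)
    & smooth_map (G `*` M) (fun p => a p.1 p.2)].

Definition transitive_action W (M : set W) (a : V -> W -> W) : Prop :=
  forall x y, M x -> M y -> exists2 g, G g & a g x = y.

Definition invariant_structure W (M : set W) (a : V -> W -> W)
    (J : W -> W -> W) : Prop :=
  forall g x v, G g -> M x -> tangent M x v ->
    J (a g x) (tangent_map M (a g) x v) = tangent_map M (a g) x (J x v).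

(* With C a coset k H this is also the left translation by g of that coset. *)
Definition lcoset (g : V) (C : set V) : set V := mul g @` C.

Definition quotient (H : set V) : set (set V) := [set lcoset g H | g in G].

(* For H closed, the manifold G/H is the quotient of G for which the projection
   g |-> g H is a smooth submersion.  Hence a map out of G/H is smooth when its
   composite with the projection is, and a map into G/H is smooth when it lifts
   locally to a smooth map into G. *)
Definition smooth_from_quotient W (H : set V) (f : set V -> W) : Prop :=
  smooth_map G (fun g => f (lcoset g H)).

Definition smooth_to_quotient W (M : set W) (H : set V) (f : W -> set V)
    : Prop :=
  forall x, M x -> exists2 s : W -> V, smooth_at s x &
    \forall y \near x, M y -> G (s y) /\ f y = lcoset (s y) H.

Definition equivariant_diffeomorphism W (H : set V) (M : set W)
    (a : V -> W -> W) (f : set V -> W) : Prop :=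
  [/\ forall C, quotient H C -> M (f C),
      smooth_from_quotient H f,
      exists f' : W -> set V,
        [/\ forall x, M x -> quotient H (f' x),
            forall C, quotient H C -> f' (f C) = C,
            forall x, M x -> f (f' x) = x
          & smooth_to_quotient M H f']
    & forall g C, G g -> quotient H C -> f (lcoset g C) = a g (f C)].

End Group.

Definition lie_isomorphic V W (mulV : V -> V -> V) (H : set V)
    (mulW : W -> W -> W) (K : set W) : Prop :=
  exists (f : V -> W) (f' : W -> V),
    [/\ (forall h, H h -> K (f h)) /\ (forall k, K k -> H (f' k)),
        (forall h, H h -> f' (f h) = h) /\ (forall k, K k -> f (f' k) = k),
        forall g h, H g -> H h -> f (mulV g h) = mulW (f g) (f h)
      & smooth_map H f /\ smooth_map K f'].

End Smooth.

(* The norm of 'cV[R]_k in the library is the sup norm: |x|^2 is dot x x. *)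
Definition dot (R : realType) k (x y : 'cV[R]_k) : R :=
  \sum_(i < k) x i 0 * y i 0.

(** * The group Spin(n)

  The Clifford algebra of R^n, with v * v = |v|^2, has the basis
  e_S = e_{i_1} ... e_{i_k} for S = {i_1 < ... < i_k}; the coordinate of
  a : Cl R n on e_S is a (enum_rank S) 0. *)

Section Spin.
Variables (R : realType) (n : nat).
Implicit Types S T U : {set 'I_n}.

Definition Cl := 'cV[R]_#|{: {set 'I_n}}|.

Definition cl_coef (a : Cl) S : R := a (enum_rank S) 0.

Definition cl_basis S : Cl := delta_mx (enum_rank S) 0.

Definition symdiff S T : {set 'I_n} := (S :\: T) :|: (T :\: S).

(* e_S e_T = cl_sign S T *: e_(symdiff S T) *)
Definition cl_sign S T : R :=
  (-1) ^+ #|[pred p : 'I_n * 'I_n | [&& p.1 \in S, p.2 \in T & (p.2 < p.1)%N]]|.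

Definition cl_mul (a b : Cl) : Cl :=
  \sum_S \sum_T
    (cl_coef a S * cl_coef b T * cl_sign S T) *: cl_basis (symdiff S T).

Definition cl_one : Cl := cl_basis finset.set0.

Definition cl_vec (v : 'cV[R]_n) : Cl := \sum_(i < n) v i 0 *: cl_basis [set i]%SET.

Definition Spin : set Cl :=
  [set a | exists s : seq 'cV[R]_n,
     [/\ ~~ odd (size s), {in s, forall v, dot v v = 1}
       & a = foldr (fun v b => cl_mul (cl_vec v) b) cl_one s]].

End Spin.

(** * The group G_2 = Aut(O)

  Octonions have the real coordinate 0 and the imaginary units
  e_j, j in Z/7, with e_j e_(j+1) = e_(j+3) and its cyclic permutations. *)

Section G2.
Variable R : realType.
Implicit Types x y : 'cV[R]_8.

Definition oct_im x (j : 'Z_7) : R := x (lift ord0 j) 0.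

Definition oct_cross x y (j : 'Z_7) : R :=
  let d k l := oct_im x (j + k) * oct_im y (j + l)
             - oct_im x (j + l) * oct_im y (j + k) in
  d 1 3 + d 2 6 + d 4 5.

Definition oct_mul x y : 'cV[R]_8 :=
  \col_(i < 8)
    if unlift ord0 i is Some j then
      x 0 0 * oct_im y j + y 0 0 * oct_im x j + oct_cross x y j
    else x 0 0 * y 0 0 - \sum_(j : 'Z_7) oct_im x j * oct_im y j.

Definition G2 : set 'M[R]_8 :=
  [set A | A \in unitmx /\
     forall x y, A *m oct_mul x y = oct_mul (A *m x) (A *m y)].

End G2.

(** * Clifford systems and the focal submanifold of OT-FKM type *)

Section FKM.
Variables (R : realType) (m N : nat) (P : 'I_m.+1 -> 'M[R]_N).

Definition symmetric_clifford_system : Prop :=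
  (forall i, (P i)^T = P i) /\
  (forall i j, P i *m P j + P j *m P i = (2 *+ (i == j))%:M).

Definition definite : Prop :=
  let Q := \big[mulmx/1%:M]_(i < m.+1) P i in Q = 1%:M \/ Q = - 1%:M.

Definition FKM_polynomial (x : 'cV[R]_N) : R :=
  dot x x ^+ 2 - 2 * \sum_(i < m.+1) dot (P i *m x) x ^+ 2.

Definition focal_plus : set 'cV[R]_N :=
  [set x | dot x x = 1 /\ FKM_polynomial x = 1].

End FKM.

(* Main.v *)
From HB Require Import structures.
Require Import Defs.
From mathcomp Require Import all_boot all_order all_algebra.
From mathcomp Require Import all_classical all_reals all_analysis.
From mathcomp Require Import ring lra.

Set Implicit Arguments.
Unset Strict Implicit.
Unset Printing Implicit Defensive.

Import Order.TTheory GRing.Theory Num.Theory.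
Import numFieldNormedType.Exports.

Local Open Scope classical_set_scope.
Local Open Scope ring_scope.

(** The space R^32 is analysed as a module over the Clifford algebra of R^9.
    The even part of that algebra has dimension 2^8 = 16^2 and acts
    faithfully and irreducibly on a 16-dimensional space, so it is the full
    matrix algebra of size 16 (cl_of_mxKV). In odd dimension the volume
    element is central, and when it acts as a sign every generator acts as an
    even element up to that sign. Definiteness says exactly this of P_0 ...
    P_8; hence, after a common change of sign of the P_i, which affects
    neither the polynomial F nor M_+, the module R^32 is the sum of two
    orthogonal copies of one irreducible module (intertwiners).

    An explicit model of that module is the space of pairs of octonions, on
    which a vector (r, w) of R + O acts by (x, y) -> (r x + conj(w) y, w x -
    r y). The quadratic map u -> (<p_i u, u>)_i becomes the octonionic Hopf
    map S^15 -> S^8, and a point of R^32, written as a pair (u, v) of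
    spinors, lies in M_+ exactly when |u|^2 = |v|^2 = 1/2 and u, v have
    opposite images (focal_join, focal_rescale).

    Transitivity is obtained from an explicit product of eight unit vectors
    that moves the pair ((1, 0), (0, 1)) to any prescribed pair of unit
    spinors over antipodal points (Spin_transitive). One vector moves the
    pole of S^8 to the prescribed point, and the other factors are found by
    the alternative law of the octonions. The product depends smoothly on the
    pair on an open set, and translating it gives smooth local sections of
    the orbit map everywhere (local_section); these make the bijection from
    the coset space to M_+ a diffeomorphism.

    An element of Spin(9) fixing the base point commutes with the pole, so it
    acts by a pair of maps (f, f') on O + O; since it normalises the vectors,
    there is a third map h with f'(w x) = h(w) f(x), and fixing 1 in both
    factors forces the three maps to coincide (Spin_stab). So f is an
    automorphism of the octonions. Conversely such an automorphism acts on O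
    + O compatibly with an isometry of R^9; by Cartan-Dieudonne and Schur's
    lemma it agrees up to sign with a product of unit vectors, and the volume
    element excludes an odd number of factors (Spin_of_isometry). The
    isotropy group is therefore G_2.

    The octonions fixed by G_2 are the reals, because already the sign
    changes off the lines of the Fano plane are automorphisms. Hence the
    tangent vectors of M_+ at the base point that are fixed by the isotropy
    group form a line (isotropy_fixed). An invariant almost complex structure
    would preserve this line, where its square cannot be -1. *)

(** * Linear maps given by formulas *)

(** Linearity is a hypothesis, not a structure: most linear maps below are
    given by formulas in the coordinates and occur in a single argument. *)
Section LinearFun.
Context {R : realType} {V W : lmodType R} {f : V -> W}.
Hypothesis linf : linear f.

Lemma linear_zero : f 0 = 0.
Proof. by have := linf (-1) 0 0; rewrite !scaleN1r !addNr. Qed.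

Lemma linear_scale k x : f (k *: x) = k *: f x.
Proof. by have := linf k x 0; rewrite linear_zero !addr0. Qed.

Lemma linear_opp x : f (- x) = - f x.
Proof. by rewrite -scaleN1r linear_scale scaleN1r. Qed.

Lemma linear_add x y : f (x + y) = f x + f y.
Proof. by have := linf 1 x y; rewrite !scale1r. Qed.

Lemma linear_sumE I (r : seq I) Q F :
  f (\sum_(i <- r | Q i) F i) = \sum_(i <- r | Q i) f (F i).
Proof.
elim/big_rec2: _ => [|i y x _ <-]; [exact: linear_zero|exact: linear_add].
Qed.

End LinearFun.

(** * Smooth maps between finite-dimensional spaces *)

Section SmoothOn.
Context {R : realType}.
Implicit Types V W : normedModType R.

(** Differentiability is a local property: both functions have the same
    expansion to first order. *)
Lemma near_differentiable V W (f g : V -> W) y :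
  (\forall z \near y, f z = g z) -> differentiable f y -> differentiable g y.
Proof.
move=> fg df.
have gE : g \o shift y = cst (g y) + 'd f y +o_ 0 id.
  apply/eqaddoP => e e0.
  have /eqaddoP/(_ e e0) := diff_locally df.
  have := fg; rewrite (near_shift 0).
  apply: filterS2 => z /=; rewrite subr0 => fgz.
  by rewrite !fctE /= fgz (nbhs_singleton fg).
have dg := diff_unique (diff_continuous df) gE.
by apply/diff_locallyP; rewrite dg; split => //; apply: diff_continuous.
Qed.

(** On an open set all points can be treated at once, so that the derivatives
    of order n are handled by induction on n through the product and chain
    rules. *)
Fixpoint Cn_on V W (U : set V) (n : nat) (f : V -> W) : Prop :=
  (forall y, U y -> differentiable f y) /\
  if n is n'.+1 then forall v, Cn_on U n' (fun x => 'D_v f x) else True.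

Definition smooth_on V W (U : set V) (f : V -> W) := forall n, Cn_on U n f.

Lemma Cn_differentiable V W (U : set V) n (f : V -> W) y :
  Cn_on U n f -> U y -> differentiable f y.
Proof. by case: n => [|n] [df _]; apply: df. Qed.

Lemma smooth_on_differentiable V W (U : set V) (f : V -> W) y :
  smooth_on U f -> U y -> differentiable f y.
Proof. by move=> /(_ 0%N) /Cn_differentiable; apply. Qed.

Lemma Cn_onW V W (U : set V) n (f : V -> W) : Cn_on U n.+1 f -> Cn_on U n f.
Proof.
elim: n f => [|n IHn] f [df Df]; split => // v.
by apply: IHn; apply: Df.
Qed.

Lemma smooth_onP V W (U : set V) (f : V -> W) :
  smooth_on U f <->
  forall vs y, U y -> differentiable (iter_derive f vs) y.
Proof.
split=> [fU vs|].
  elim/last_ind: vs f fU => [|vs v IH] f fU y Uy.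
    exact: (smooth_on_differentiable fU).
  rewrite /iter_derive foldr_rcons; apply: IH => // n.
  by have [_] := fU n.+1; apply.
move=> H n; elim: n f H => [|n IH] f H; split=> //.
- by move=> y; apply: (H [::]).
- by move=> y; apply: (H [::]).
move=> v; apply: IH => vs y Uy.
by have := H (rcons vs v) y Uy; rewrite /iter_derive foldr_rcons.
Qed.

Lemma smooth_on_at V W (U : set V) (f : V -> W) x :
  open U -> U x -> smooth_on U f -> smooth_at f x.
Proof.
move=> oU Ux /smooth_onP fU; rewrite /smooth_at.
near=> y => vs; apply: fU; near: y.
exact: open_nbhs_nbhs.
Unshelve. all: by end_near. Qed.

Lemma smooth_atP V W (f : V -> W) x : smooth_at f x ->
  exists U, [/\ open U, U x & smooth_on U f].
Proof.
rewrite /smooth_at -nbhs_nearE nbhsE => -[U [oU Ux] UH].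
exists U; split=> //; apply/smooth_onP => vs y Uy; exact: UH.
Qed.

Lemma smooth_at_differentiable V W (f : V -> W) x :
  smooth_at f x -> differentiable f x.
Proof. by case/smooth_atP=> U [_ Ux /smooth_on_differentiable]; apply. Qed.

Lemma eq_Cn_on V W (U : set V) n (f g : V -> W) : open U ->
  (forall y, U y -> f y = g y) -> Cn_on U n f -> Cn_on U n g.
Proof.
move=> oU.
have dE h k y : (forall z, U z -> h z = k z) -> U y ->
    \forall z \near y, h z = k z :> W.
  by move=> hk Uy; apply: filterS (open_nbhs_nbhs (conj oU Uy)) => z; apply: hk.
elim: n f g => [|n IHn] f g fg [df Df]; split=> //.
- by move=> y Uy; apply: near_differentiable (df y Uy); apply: dE.
- by move=> y Uy; apply: near_differentiable (df y Uy); apply: dE.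
by move=> v; apply: IHn (Df v) => y Uy; apply: near_eq_derive; apply: dE.
Qed.

Lemma Cn_cst V W (U : set V) n (w : W) : Cn_on U n (fun=> w).
Proof.
elim: n w => [|n IHn] w; split=> //.
by move=> v; under eq_fun do rewrite derive_cst; exact: IHn.
Qed.

Lemma CnD V W (U : set V) n (f g : V -> W) : open U ->
  Cn_on U n f -> Cn_on U n g -> Cn_on U n (fun x => f x + g x).
Proof.
move=> oU; elim: n f g => [|n IHn] f g [df Df] [dg Dg]; split=> //.
- by move=> y Uy; apply: differentiableD; [apply: df|apply: dg].
- by move=> y Uy; apply: differentiableD; [apply: df|apply: dg].
move=> v; apply: eq_Cn_on (IHn _ _ (Df v) (Dg v)) => // y Uy.
by rewrite -[RHS]/('D_v (f + g) y) deriveD //; apply: diff_derivable;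
  [apply: df|apply: dg].
Qed.

Lemma derive_lin V W W' (L : {linear W -> W'}) (f : V -> W) y v :
  continuous L -> differentiable f y ->
  differentiable (fun x => L (f x)) y /\ 'D_v (fun x => L (f x)) y =
    L ('D_v f y).
Proof.
move=> cL df; have dL : differentiable L (f y) by apply: linear_differentiable.
have dLf : differentiable (L \o f) y by apply: differentiable_comp.
by split=> //; rewrite deriveE // diff_comp // diff_lin //= deriveE.
Qed.

Lemma Cn_lin V W W' (U : set V) n (L : {linear W -> W'}) (f : V -> W) :
  open U -> continuous L -> Cn_on U n f -> Cn_on U n (fun x => L (f x)).
Proof.
move=> oU cL; elim: n f => [|n IHn] f [df Df]; split=> //.
- by move=> y Uy; apply: (derive_lin 0 cL (df y Uy)).1.
- by move=> y Uy; apply: (derive_lin 0 cL (df y Uy)).1.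
move=> v; apply: eq_Cn_on (IHn _ (Df v)) => // y Uy.
by rewrite (derive_lin v cL (df y Uy)).2.
Qed.

(** The product rule expresses the derivative by products of the factors and
    their derivatives, which are again of class C^n. *)
Lemma CnM V (U : set V) n (f g : V -> R) : open U ->
  Cn_on U n f -> Cn_on U n g -> Cn_on U n (fun x => f x * g x).
Proof.
move=> oU; elim: n f g => [|n IHn] f g fn gn.
  split=> // y Uy; apply: differentiableM.
    exact: Cn_differentiable fn _.
  exact: Cn_differentiable gn _.
have [df Df] := fn; have [dg Dg] := gn.
split; [move=> y Uy|move=> v]; first by apply: differentiableM;
  [apply: df|apply: dg].
have := CnD oU (IHn _ _ (Cn_onW fn) (Dg v)) (IHn _ _ (Cn_onW gn) (Df v)).
apply: eq_Cn_on => // y Uy.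
by rewrite -[RHS]/('D_v (f * g) y) deriveM //; apply: diff_derivable;
  [apply: df|apply: dg].
Qed.

(** The derivative of g = f^(-1/2) is a polynomial in g and f', which is what
    makes the induction in Cn_invsqrt possible. *)
Lemma derive_invsqrt V (f : V -> R) y v : 0 < f y -> differentiable f y ->
  differentiable (fun x => (Num.sqrt (f x))^-1) y /\
  'D_v (fun x => (Num.sqrt (f x))^-1) y =
    - 2^-1 * ((Num.sqrt (f y))^-1 ^+ 3 * 'D_v f y).
Proof.
move=> fy df.
have sy : Num.sqrt (f y) != 0 by rewrite gt_eqF // sqrtr_gt0.
have [ds Ds] := is_derive1_sqrt fy.
have {}ds : differentiable (@Num.sqrt R) (f y) by apply/derivable1_diffP.
have dsf : differentiable (@Num.sqrt R \o f) y by apply: differentiable_comp.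
split; first exact: (@differentiableV _ _ (@Num.sqrt R \o f)).
pose h x : R := Num.sqrt (f x).
rewrite -[LHS]/('D_v (fun x => (h x)^-1) y) (deriveV (f := h)) //; last first.
  exact: diff_derivable.
rewrite (deriveE (f := h) _ dsf) -[h]/(@Num.sqrt R \o f) diff_comp //=
  -(deriveE _ df).
have -> : 'd (@Num.sqrt R) (f y) ('D_v f y) =
    'D_v f y * (2 * Num.sqrt (f y))^-1.
  by rewrite -Ds -[X in 'd _ _ X]mulr1 -[_ * 1]/(_ *: (1 : R)) linearZ /=
    -deriveE.
rewrite /GRing.scale /=; field.
by rewrite sy.
Qed.

Lemma Cn_invsqrt V (U : set V) n (f : V -> R) : open U ->
  (forall y, U y -> 0 < f y) ->
  Cn_on U n f -> Cn_on U n (fun x => (Num.sqrt (f x))^-1).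
Proof.
move=> oU fpos; elim: n => [|n IHn] fn.
  split=> // y Uy; apply: (derive_invsqrt 0 (fpos y Uy) _).1.
  exact: Cn_differentiable fn _.
have [df Df] := fn.
split; [move=> y Uy|move=> v];
  first exact: (derive_invsqrt 0 (fpos y Uy) (df y Uy)).1.
have sn := IHn (Cn_onW fn).
have := CnM oU (@Cn_cst _ _ U n (- 2^-1 : R))
  (CnM oU (CnM oU sn (CnM oU sn sn)) (Df v)).
apply: eq_Cn_on => // y Uy.
by rewrite (derive_invsqrt v (fpos y Uy) (df y Uy)).2 exprS expr2.
Qed.

Lemma smooth_cst V W (U : set V) (w : W) : smooth_on U (fun=> w).
Proof. by move=> n; apply: Cn_cst. Qed.

Lemma smooth_lin V W W' (U : set V) (L : {linear W -> W'}) (f : V -> W) :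
  open U -> continuous L -> smooth_on U f -> smooth_on U (fun x => L (f x)).
Proof. by move=> oU cL fU n; apply: Cn_lin. Qed.

Lemma smooth_id V (U : set V) : open U -> smooth_on U (id : V -> V).
Proof.
move=> oU [|n]; split=> // v.
  by under eq_fun do rewrite derive_id; apply: Cn_cst.
Qed.

Lemma smoothD V W (U : set V) (f g : V -> W) : open U ->
  smooth_on U f -> smooth_on U g -> smooth_on U (fun x => f x + g x).
Proof. by move=> oU fU gU n; apply: CnD. Qed.

Lemma smoothM V (U : set V) (f g : V -> R) : open U ->
  smooth_on U f -> smooth_on U g -> smooth_on U (fun x => f x * g x).
Proof. by move=> oU fU gU n; apply: CnM. Qed.

Lemma smooth_invsqrt V (U : set V) (f : V -> R) : open U ->
  (forall y, U y -> 0 < f y) ->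
  smooth_on U f -> smooth_on U (fun x => (Num.sqrt (f x))^-1).
Proof. by move=> oU fpos fU n; apply: Cn_invsqrt. Qed.

Lemma smooth_sum V W (U : set V) I (r : seq I) (P : pred I) (F : I -> V -> W) :
  open U -> (forall i, P i -> smooth_on U (F i)) ->
  smooth_on U (fun x => \sum_(i <- r | P i) F i x).
Proof.
move=> oU FU; elim: r => [|i r IHr].
  by under eq_fun do rewrite big_nil; apply: smooth_cst.
have [Pi|nPi] := boolP (P i).
  by under eq_fun do rewrite big_cons Pi; apply: smoothD => //; apply: FU.
by under eq_fun do rewrite big_cons (negbTE nPi).
Qed.

Lemma smooth_onS V W (U U' : set V) (f : V -> W) :
  U' `<=` U -> smooth_on U f -> smooth_on U' f.
Proof.
by move=> UU /smooth_onP fU; apply/smooth_onP => vs y /UU; apply: fU.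
Qed.

Lemma smooth_scale V W (U : set V) (f : V -> R) (w : W) : open U ->
  smooth_on U f -> smooth_on U (fun x => f x *: w).
Proof.
move=> oU fU.
have linw : linear (fun k : R => k *: w).
  by move=> a b c; rewrite scalerDl -[a *: b]/(a * b) scalerA.
pose L := HB.pack_for {linear R -> W} (fun k : R => k *: w)
  (GRing.isLinear.Build _ _ _ _ _ linw).
by apply: (smooth_lin (L := L)) => //; apply: scalel_continuous.
Qed.

Lemma coord_continuous m n i j : continuous (fun M : 'M[R]_(m, n) => M i j).
Proof. by move=> M; apply/differentiable_continuous/differentiable_coord. Qed.

Lemma mx_linearE m n W (L : 'M[R]_(m, n) -> W) (M : 'M[R]_(m, n)) :
  linear L -> L M = \sum_i \sum_j M i j *: L (delta_mx i j).
Proof.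
move=> linL.
rewrite {1}(matrix_sum_delta M) (linear_sumE linL).
apply: eq_bigr => i _; rewrite (linear_sumE linL); apply: eq_bigr => j _.
exact: linear_scale.
Qed.

Lemma smooth_coord V m n (U : set V) (f : V -> 'M[R]_(m, n)) i j : open U ->
  smooth_on U f -> smooth_on U (fun x => f x i j).
Proof.
move=> oU fU.
have linc : linear (fun M : 'M[R]_(m, n) => M i j) by move=> k A B;
  rewrite !mxE.
pose c := HB.pack_for {linear 'M[R]_(m, n) -> R} (fun M : 'M[R]_(m, n) => M i j)
  (GRing.isLinear.Build _ _ _ _ _ linc).
by apply: (smooth_lin (L := c)) => //; apply: coord_continuous.
Qed.

Lemma smooth_mx_linear V m n W (U : set V) (L : 'M[R]_(m, n) -> W)
    (f : V -> 'M[R]_(m, n)) : open U -> linear L ->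
  smooth_on U f -> smooth_on U (fun x => L (f x)).
Proof.
move=> oU linL fU; under eq_fun do rewrite mx_linearE //.
apply: smooth_sum => // i _; apply: smooth_sum => // j _;
  apply: smooth_scale => //.
exact: smooth_coord.
Qed.

(** Bilinear maps are quadratic polynomials in the coordinates. *)
Lemma smooth_mx_bilinear V m n p q W (U : set V)
    (B : 'M[R]_(m, n) -> 'M[R]_(p, q) -> W)
    (f : V -> 'M[R]_(m, n)) (g : V -> 'M[R]_(p, q)) : open U ->
  (forall y, linear (B^~ y)) -> (forall x, linear (B x)) ->
  smooth_on U f -> smooth_on U g -> smooth_on U (fun x => B (f x) (g x)).
Proof.
move=> oU linl linr fU gU.
have BE x : B (f x) (g x) = \sum_i \sum_j \sum_k \sum_l
    (f x i j * g x k l) *: B (delta_mx i j) (delta_mx k l).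
  rewrite (mx_linearE (f x) (linl (g x))).
  apply: eq_bigr => i _; apply: eq_bigr => j _.
  rewrite (mx_linearE (g x) (linr (delta_mx i j))) scaler_sumr.
  apply: eq_bigr => k _; rewrite scaler_sumr.
  by apply: eq_bigr => l _; rewrite scalerA.
rewrite (funext BE); do 4 (apply: smooth_sum => // ? _).
apply: smooth_scale => //; apply: smoothM => //.
  exact: smooth_coord.
exact: smooth_coord.
Qed.

(** A linear map is a combination of the coordinates, hence smooth. *)
Lemma mx_linear_continuous m n W (L : 'M[R]_(m, n) -> W) :
  linear L -> continuous L.
Proof.
move=> linL M; apply: differentiable_continuous.
apply: (@smooth_on_differentiable _ _ setT) => //.
have := smooth_mx_linear openT linL (smooth_id openT).
by apply.
Qed.

Lemma smooth_coords V m n (U : set V) (f : V -> 'M[R]_(m, n)) : open U ->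
  (forall i j, smooth_on U (fun x => f x i j)) -> smooth_on U f.
Proof.
move=> oU fU; have fE x : f x = \sum_i \sum_j f x i j *: delta_mx i j.
  exact: matrix_sum_delta.
rewrite (funext fE); apply: smooth_sum => // i _; apply: smooth_sum => // j _.
exact: smooth_scale.
Qed.

Lemma smoothZ V m n (U : set V) (k : V -> R) (f : V -> 'M[R]_(m, n)) : open U ->
  smooth_on U k -> smooth_on U f -> smooth_on U (fun x => k x *: f x).
Proof.
move=> oU kU fU; apply: smooth_coords => // i j.
under eq_fun do rewrite mxE.
by apply: smoothM => //; apply: smooth_coord.
Qed.

Lemma open_smooth_gt0 V (U : set V) (f : V -> R) : open U ->
  smooth_on U f -> open (U `&` [set x | 0 < f x]).
Proof.
move=> oU fU; rewrite openE => x [Ux fx].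
have cf := differentiable_continuous (smooth_on_differentiable fU Ux).
apply: filterI; first exact: open_nbhs_nbhs.
by apply: (cf [set y | 0 < y]); apply: open_nbhs_nbhs;
  split=> //; apply: open_gt.
Qed.

Lemma derive_mx_linear V m n W (L : 'M[R]_(m, n) -> W)
    (f : V -> 'M[R]_(m, n)) y v :
  linear L -> differentiable f y ->
  differentiable (fun x => L (f x)) y /\ 'D_v (fun x => L (f x)) y =
    L ('D_v f y).
Proof.
move=> linL df; pose L' := HB.pack_for {linear 'M[R]_(m, n) -> W} L
  (GRing.isLinear.Build _ _ _ _ L linL).
exact: (derive_lin (L := L') v (mx_linear_continuous linL) df).
Qed.

Lemma derive_scale V W (f : V -> R) (w : W) y v : differentiable f y ->
  differentiable (fun x => f x *: w) y /\
  'D_v (fun x => f x *: w) y = 'D_v f y *: w.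
Proof.
move=> df; have linw : linear (fun k : R => k *: w).
  by move=> a b c; rewrite scalerDl -[a *: b]/(a * b) scalerA.
pose L := HB.pack_for {linear R -> W} (fun k : R => k *: w)
  (GRing.isLinear.Build _ _ _ _ _ linw).
exact: (derive_lin (L := L) v (@scalel_continuous _ _ w) df).
Qed.

Lemma smooth_map_on V W (A : set V) (f : V -> W) :
  smooth_on setT f -> smooth_map A f.
Proof.
move=> fT x Ax; exists f; split; first exact: (smooth_on_at openT).
by apply: nearW.
Qed.

End SmoothOn.

(** * Representations of the Clifford algebra *)

Section CliffordRep.
Context {R : realType} {n : nat} {A : algType R}.
Variable P : 'I_n -> A.
Hypothesis cliff : forall i j, P i * P j + P j * P i = 2 *+ (i == j).

Lemma cliff_sq i : P i * P i = 1.
Proof.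
apply: (@scalerI _ _ (2 : R)); first by rewrite pnatr_eq0.
by have := cliff i i; rewrite eqxx -mulr2n !scaler_nat.
Qed.

Lemma cliff_anti i j : i != j -> P i * P j = - (P j * P i).
Proof.
move=> /negbTE ij; have := cliff i j; rewrite ij => /eqP.
by rewrite addr_eq0 => /eqP.
Qed.

Definition blade (S : {set 'I_n}) : A := \prod_(i < n | i \in S) P i.

(** With the factors indexed by all natural numbers, the product over an
    interval can be split at a generator; the values beyond n are never
    reached. *)
Definition memn (S : {set 'I_n}) (k : nat) : bool :=
  if insub k is Some i then i \in S else false.

Definition genn (k : nat) : A := if insub k is Some i then P i else 1.

Lemma memn_ord S (i : 'I_n) : memn S i = (i \in S).
Proof. by rewrite /memn valK. Qed.

Lemma bladeE S : blade S = \prod_(0 <= k < n) (if memn S k then genn k else 1).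
Proof.
rewrite big_mkord /blade big_mkcond; apply: eq_bigr => i _.
by rewrite memn_ord /genn valK.
Qed.

Definition above (S : {set 'I_n}) (i : 'I_n) :
  nat := #|[pred j : 'I_n | (j \in S) && (i < j)%N]|.

(** Moving P_i to the left past the factors of larger index costs one sign
    for each of them. *)
Lemma tail_comm (S : {set 'I_n}) (i : 'I_n) :
  (\prod_(i.+1 <= k < n) (if memn S k then genn k else 1)) * P i =
  (-1) ^+ above S i *:
    (P i * \prod_(i.+1 <= k < n) (if memn S k then genn k else 1)).
Proof.
have -> : above S i = (\sum_(i.+1 <= k < n) memn S k)%N.
  rewrite /above -sum1_card big_geq_mkord big_mkcond /=.
  rewrite [RHS]big_mkcond; apply: eq_bigr => j _.
  by rewrite memn_ord !inE; case: ltnP; case: (j \in S).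
suff H m : (m <= n)%N ->
    (\prod_(i.+1 <= k < m) (if memn S k then genn k else 1)) * P i =
    (-1) ^+ (\sum_(i.+1 <= k < m) memn S k)%N *:
      (P i * \prod_(i.+1 <= k < m) (if memn S k then genn k else 1))
        by exact: H.
elim: m => [|m IHm] mn.
  by rewrite !big_geq // mul1r mulr1 scale1r.
have [im|mi] := leqP i.+1 m; last first.
  by rewrite !big_geq // mul1r mulr1 scale1r.
rewrite !big_nat_recr //= -mulrA.
have -> : (if memn S m then genn m else 1) * P i =
  (-1) ^+ memn S m *: (P i * (if memn S m then genn m else 1)).
  rewrite /memn /genn (insubT (fun k => k < n)%N mn) /=.
  case: (Ordinal mn \in S); rewrite ?mul1r ?mulr1 ?scale1r //.
  rewrite scaleN1r cliff_anti // -val_eqE /= gtn_eqF //.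
by rewrite -scalerAr [in LHS]mulrA (IHm (ltnW mn)) -scalerAl scalerA -exprD
  addnC -mulrA.
Qed.

Lemma mem_symdiff (S T : {set 'I_n}) i :
  (i \in symdiff S T) = (i \in S) (+) (i \in T).
Proof. by rewrite !inE; case: (i \in S); case: (i \in T). Qed.

Lemma blade_gen (S : {set 'I_n}) i :
  blade S * P i = (-1) ^+ above S i *: blade (symdiff S [set i]%SET).
Proof.
have E (T : {set 'I_n}) : blade T =
  \prod_(0 <= k < i) (if memn T k then genn k else 1) *
    (if i \in T then P i else 1) *
      \prod_(i.+1 <= k < n) (if memn T k then genn k else 1).
  rewrite bladeE (big_cat_nat (leq0n i) (ltnW (ltn_ord i))) /= -mulrA;
    congr (_ * _).
  by rewrite big_ltn // memn_ord /genn valK.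
rewrite E -mulrA tail_comm -scalerAr; congr (_ *: _).
rewrite E mulrA -[X in X * _]mulrA; congr (_ * _ * _).
- apply: eq_big_nat => k /andP[_ ki].
  have kn : (k < n)%N := ltn_trans ki (ltn_ord i).
  rewrite -[k]/(val (Ordinal kn)) !memn_ord mem_symdiff inE -val_eqE /=.
  by rewrite ltn_eqF // addbF.
- by rewrite mem_symdiff inE eqxx addbT; case: (i \in S);
    rewrite ?cliff_sq ?mul1r.
apply: eq_big_nat => k /andP[ik kn].
rewrite -[k]/(val (Ordinal kn)) !memn_ord mem_symdiff inE -val_eqE /=.
by rewrite gtn_eqF // addbF.
Qed.

(** The generators of T are multiplied in one at a time in increasing order;
    each passes the larger elements of S, and the signs add up to the number
    of inversions that defines cl_sign. *)
Lemma blade_mul S T : blade S * blade T = cl_sign R S T *: blade (symdiff S T).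
Proof.
(* the part of T multiplied in before step k *)
pose below k : {set 'I_n} := [set j in T | (j < k)%N]%SET.
have H k : (k <= n)%N ->
  blade S * \prod_(0 <= j < k) (if memn T j then genn j else 1) =
    (-1) ^+ (\sum_(j < n | (j \in T) && (j < k)%N) above S j)%N
      *: blade (symdiff S (below k)).
  elim: k => [|k IHk] kn.
    rewrite big_geq // mulr1 big_pred0 => [|j]; last by rewrite ltn0 andbF.
    rewrite scale1r; congr blade; apply/setP => j.
    by rewrite mem_symdiff inE ltn0 andbF addbF.
  rewrite big_nat_recr //= mulrA IHk ?(ltnW kn) // -scalerAl.
  pose i := Ordinal kn.
  rewrite -[k]/(val i) memn_ord /genn valK.
  have [iT|iT] := boolP (i \in T); last first.
    rewrite mulr1; congr ((-1) ^+ _ *: blade (symdiff S _)).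
      apply: eq_bigl => j; rewrite ltnS [(j <= _)%N]leq_eqVlt.
      case: eqP => [/val_inj->|//]; by rewrite (negbTE iT).
    apply/setP => j; rewrite !inE ltnS [(j <= _)%N]leq_eqVlt.
    case: eqP => [/val_inj->|//]; by rewrite (negbTE iT).
  rewrite blade_gen scalerA -exprD; congr ((-1) ^+ _ *: blade _).
    rewrite [RHS](bigD1 i) /= ?iT ?ltnSn // addnC; congr (_ + _)%N.
      apply: eq_card => j; rewrite !inE.
      case: (ltnP i j) => ij; rewrite ?andbF //= !andbT.
      have -> : (j < i)%N = false by rewrite ltnNge ltnW.
      by rewrite !andbF /= orbF.
    apply: eq_bigl => j; rewrite ltnS -val_eqE /= [(j <= _)%N]leq_eqVlt.
    by case: eqP => [->|]; rewrite ?ltnn ?andbF ?andbT.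
  apply/setP => j; rewrite !mem_symdiff !inE ltnS.
  have [->|ji] := eqVneq j i; first by rewrite /= ltnn leqnn iT andbF addbF.
  by rewrite addbF ltn_neqAle val_eqE ji.
rewrite {1}(bladeE T) H // /cl_sign; congr ((-1) ^+ _ *: blade (symdiff S _)).
  under eq_bigr do rewrite /above -sum1_card.
  rewrite pair_big_dep /= -[RHS]sum1_card.
  rewrite [RHS](reindex (fun p : 'I_n * 'I_n => (p.2, p.1))) /=; last first.
    by exists (fun p : 'I_n * 'I_n => (p.2, p.1)) => -[].
  by apply: eq_bigl => -[j i]; rewrite !inE ltn_ord andbT /= andbCA.
by apply/setP => j; rewrite !inE ltn_ord andbT.
Qed.

Definition cl_rep (a : Cl R n) : A := \sum_S cl_coef a S *: blade S.

Lemma cl_rep_linear : linear cl_rep.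
Proof.
move=> k a b; rewrite /cl_rep scaler_sumr -big_split; apply: eq_bigr => S _.
by rewrite /cl_coef !mxE scalerDl scalerA.
Qed.

Lemma cl_coef_basis (S T : {set 'I_n}) : cl_coef (cl_basis R S) T = (T == S)%:R.
Proof. by rewrite /cl_coef mxE eqxx andbT (can_eq (@enum_rankK _)). Qed.

Lemma cl_rep_basis S : cl_rep (cl_basis R S) = blade S.
Proof.
rewrite /cl_rep (bigD1 S) //= cl_coef_basis eqxx scale1r big1 ?addr0 // => T TS.
by rewrite cl_coef_basis (negbTE TS) scale0r.
Qed.

Lemma cl_rep_sum I (r : seq I) Q (F : I -> Cl R n) :
  cl_rep (\sum_(i <- r | Q i) F i) = \sum_(i <- r | Q i) cl_rep (F i).
Proof. exact: (linear_sumE cl_rep_linear). Qed.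

Lemma cl_repZ k a : cl_rep (k *: a) = k *: cl_rep a.
Proof. exact: (linear_scale cl_rep_linear). Qed.

Lemma cl_rep_one : cl_rep (cl_one R n) = 1.
Proof. by rewrite cl_rep_basis /blade big_pred0 // => i; rewrite inE. Qed.

Lemma cl_rep_vec v : cl_rep (cl_vec v) = \sum_i v i 0 *: P i.
Proof.
rewrite cl_rep_sum; apply: eq_bigr => i _.
by rewrite cl_repZ cl_rep_basis /blade big_set1.
Qed.

Lemma cl_rep_mul a b : cl_rep (cl_mul a b) = cl_rep a * cl_rep b.
Proof.
rewrite cl_rep_sum mulr_suml; apply: eq_bigr => S _.
rewrite cl_rep_sum mulr_sumr; apply: eq_bigr => T _.
rewrite cl_repZ cl_rep_basis -[in RHS]scalerAl -[in RHS]scalerAr.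
by rewrite blade_mul !scalerA.
Qed.

End CliffordRep.

Lemma bladeZ (R : realType) n (A : algType R) (P : 'I_n -> A) s S :
  blade (fun i => s *: P i) S = s ^+ #|S| *: blade P S.
Proof.
rewrite -sum1_card /blade; elim: (index_enum _) => [|i r IH].
  by rewrite !big_nil scale1r.
rewrite !big_cons; case: ifP => // _.
by rewrite IH -scalerAl -scalerAr scalerA exprS.
Qed.

(** * The even part of the Clifford algebra *)

Section EvenPart.
Context {R : realType} {n : nat}.
Implicit Types (S T : {set 'I_n}) (a b : Cl R n).

Definition cl_even a := forall S, odd #|S| -> cl_coef a S = 0.

Lemma odd_symdiff S T : odd #|symdiff S T| = odd #|S| (+) odd #|T|.
Proof.
rewrite /symdiff cardsU.
have -> : (S :\: T) :&: (T :\: S) = finset.set0.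
  by apply/setP => i; rewrite !inE; case: (i \in S); case: (i \in T).
rewrite cards0 subn0 -(cardsID T S) -[in RHS](cardsID S T) [T :&: S]finset.setIC
  !oddD.
by rewrite addbACA addbb.
Qed.

Lemma symdiffvv S : symdiff S S = finset.set0.
Proof. by apply/setP => i; rewrite mem_symdiff addbb inE. Qed.

Lemma symdiff_eq0 S T : (symdiff S T == finset.set0) = (S == T).
Proof.
apply/eqP/eqP => [ST|->]; last exact: symdiffvv.
apply/setP => i; have := mem_symdiff S T i; rewrite ST inE.
by case: (i \in S); case: (i \in T).
Qed.

Lemma cl_coef_sum I (r : seq I) Q (F : I -> Cl R n) S :
  cl_coef (\sum_(i <- r | Q i) F i) S = \sum_(i <- r | Q i) cl_coef (F i) S.
Proof. by rewrite /cl_coef summxE. Qed.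

Lemma cl_coefZ k a S : cl_coef (k *: a) S = k * cl_coef a S.
Proof. by rewrite /cl_coef mxE. Qed.

(** The algebra is graded by parity since symmetric differences add the
    parities of the cardinals. *)
Lemma cl_mul_parity (p q : bool) a b :
  (forall S, odd #|S| != p -> cl_coef a S = 0) ->
  (forall S, odd #|S| != q -> cl_coef b S = 0) ->
  forall S, odd #|S| != p (+) q -> cl_coef (cl_mul a b) S = 0.
Proof.
move=> ap bq U Upq; rewrite cl_coef_sum big1 // => S _.
rewrite cl_coef_sum big1 // => T _; rewrite cl_coefZ.
have [Sp|/ap->] := eqVneq (odd #|S|) p; last by rewrite !mul0r.
have [Tq|/bq->] := eqVneq (odd #|T|) q; last by rewrite mulr0 !mul0r.
rewrite cl_coef_basis; case: eqP => [UE|]; last by rewrite mulr0.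
by move: Upq; rewrite UE odd_symdiff Sp Tq eqxx.
Qed.

Lemma cl_even_mul a b : cl_even a -> cl_even b -> cl_even (cl_mul a b).
Proof.
move=> ea eb S So; apply: (@cl_mul_parity false false) => //.
- by move=> T; rewrite eqbF_neg negbK; apply: ea.
- by move=> T; rewrite eqbF_neg negbK; apply: eb.
by rewrite So.
Qed.

Definition vecs_mul (s : seq 'cV[R]_n) : Cl R n :=
  foldr (fun v b => cl_mul (cl_vec v) b) (cl_one R n) s.

Lemma vecs_mul_parity s S :
  odd #|S| != odd (size s) -> cl_coef (vecs_mul s) S = 0.
Proof.
elim: s S => [|v s IHs] S; rewrite /= => HS.
  rewrite cl_coef_basis; case: eqP => // SE; by move: HS; rewrite SE cards0.
apply: (@cl_mul_parity true (odd (size s))) => //.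
  move=> T T1; rewrite cl_coef_sum big1 // => i _;
    rewrite cl_coefZ cl_coef_basis.
  by case: eqP => [TE|]; [move: T1; rewrite TE cards1|rewrite mulr0].
Qed.

Lemma Spin_even a : Spin a -> cl_even a.
Proof.
move=> [s [es _ ->]] S So; apply: vecs_mul_parity.
by rewrite So (negbTE es).
Qed.

Lemma cl_vec_linear : linear (@cl_vec R n).
Proof.
move=> k v w; rewrite /cl_vec scaler_sumr -big_split; apply: eq_bigr => i _.
by rewrite !mxE scalerDl scalerA.
Qed.

Lemma cl_mul_linearl b : linear (@cl_mul R n ^~ b).
Proof.
move=> k v w; rewrite /cl_mul scaler_sumr -big_split; apply: eq_bigr => S _.
rewrite scaler_sumr -big_split; apply: eq_bigr => T _ /=.
rewrite scalerA -scalerDl; congr (_ *: _).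
by rewrite /cl_coef !mxE !mulrDl !mulrA.
Qed.

Lemma cl_mul_linearr a : linear (@cl_mul R n a).
Proof.
move=> k v w; rewrite /cl_mul scaler_sumr -big_split; apply: eq_bigr => S _.
rewrite scaler_sumr -big_split; apply: eq_bigr => T _ /=.
rewrite scalerA -scalerDl; congr (_ *: _).
by rewrite /cl_coef !mxE mulrDr mulrDl mulrCA !mulrA.
Qed.

End EvenPart.

(** Toggling one element exchanges the even and the odd subsets. *)
Lemma card_even_sets n :
  #|[set S : {set 'I_n.+1} | ~~ odd #|S|]%SET| = (2 ^ n)%N.
Proof.
set E := [set S : {set 'I_n.+1} | _]%SET.
pose h (S : {set 'I_n.+1}) := symdiff S [set ord0]%SET.
have hh : involutive h.
  by move=> S; apply/setP => i; rewrite !mem_symdiff addbK.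
have EC : #|~: E|%SET = #|E|.
  rewrite -(card_imset _ (inv_inj hh)); apply: eq_card => S.
  rewrite -[S in LHS]hh mem_imset; last exact: inv_inj.
  by rewrite !inE odd_symdiff cards1 addbT negbK.
have : (#|E| * 2 = 2 ^ n * 2)%N.
  rewrite muln2 -addnn -{2}EC cardsC -cardsT -powersetT card_powerset.
  by rewrite cardsT card_ord expnSr.
by move/eqP; rewrite eqn_pmul2r // => /eqP.
Qed.

Section CliffordMatrices.
Context {R : realType} {n N : nat}.
Variable P : 'I_n -> 'M[R]_N.+1.
Hypothesis Psym : forall i, (P i)^T = P i.
Hypothesis cliff : forall i j, P i * P j + P j * P i = 2 *+ (i == j).

Implicit Types (S T : {set 'I_n}) (a b : Cl R n) (X Y : 'M[R]_N.+1).

Let sq := cliff_sq cliff.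
Let anti := cliff_anti cliff.

Lemma blade_orth S : (blade P S)^T * blade P S = 1.
Proof.
rewrite /blade; elim: (index_enum _) => [|i r IH].
  by rewrite big_nil trmx1 mulr1.
rewrite big_cons; case: ifP => // _.
by rewrite -mulmxE trmx_mul Psym mulmxE -mulrA [P i * _]mulrA sq mul1r.
Qed.

Lemma blade0 : blade P finset.set0 = 1.
Proof. by rewrite /blade big_pred0 // => i; rewrite inE. Qed.

Lemma blade_tr S : (blade P S)^T = cl_sign R S S *: blade P S.
Proof.
have s2 : cl_sign R S S * cl_sign R S S = 1 by rewrite -expr2 sqrr_sign.
rewrite -[LHS]mulr1 -blade0 -(symdiffvv S) -[blade P (symdiff _ _)]scale1r -s2.
by rewrite -scalerA -blade_mul // -scalerAr mulrA blade_orth mul1r.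
Qed.

(** The generator anticommutes with each of the other factors and commutes
    with itself. *)
Lemma blade_comm S i :
  P i * blade P S = (-1) ^+ #|S :\ i|%SET *: (blade P S * P i).
Proof.
have -> : #|S :\ i|%SET = (\sum_(j | j \in S) (j != i))%N.
  rewrite -sum1_card big_mkcond [RHS]big_mkcond; apply: eq_bigr => j _.
  by rewrite !inE; case: (j \in S); case: (j == i).
rewrite /blade; elim: (index_enum _) => [|j r IH].
  by rewrite !big_nil mulr1 mul1r scale1r.
rewrite !big_cons; case: ifP => // _.
have -> : P i * (P j * \prod_(k <- r | k \in S) P k) =
   (-1) ^+ (j != i) *: (P j * (P i * \prod_(k <- r | k \in S) P k)).
  rewrite mulrA; have [->|ji] := eqVneq j i; first by rewrite scale1r mulrA.
  by rewrite expr1 scaleN1r anti 1?eq_sym // mulNr mulrA.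
by rewrite IH -scalerAr scalerA -exprD mulrA.
Qed.

(** Conjugation by a generator occurring in an even blade changes its sign,
    but not its trace. *)
Lemma blade_trace S : S != finset.set0 -> ~~ odd #|S| -> \tr (blade P S) = 0.
Proof.
move=> /set0Pn [i iS] Se.
have := blade_comm S i; have := cardsD1 i S; rewrite iS => Si.
have -> : (-1) ^+ #|S :\ i|%SET = -1 :> R.
  by move: Se; rewrite Si -signr_odd /= negbK => ->.
rewrite scaleN1r => /(congr1 (fun X => \tr (X *m P i))).
rewrite mxtrace_mulC mulmxE mulrA sq mul1r mulNr -mulrA sq mulr1.
by rewrite linearN => /eqP; rewrite -subr_eq0 opprK -mulr2n mulrn_eq0 => /eqP.
Qed.

(** Even blades are orthonormal, up to the factor N + 1, for the trace form,
    since the product of two distinct ones is a nontrivial even blade. *)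
Lemma blade_ortho S T : ~~ odd #|S| -> ~~ odd #|T| ->
  \tr ((blade P S)^T * blade P T) = (S == T)%:R * N.+1%:R.
Proof.
move=> Se Te; have [->|ST] := eqVneq S T.
  by rewrite blade_orth mxtrace1 mul1r.
rewrite blade_tr -scalerAl blade_mul // !linearZ /= blade_trace ?mulr0
  ?mul0r //.
  by rewrite symdiff_eq0.
by rewrite odd_symdiff (negbTE Se) (negbTE Te).
Qed.

Lemma rep_coef a S : cl_even a -> ~~ odd #|S| ->
  \tr ((blade P S)^T * cl_rep P a) = cl_coef a S * N.+1%:R.
Proof.
move=> ae Se; rewrite /cl_rep mulr_sumr linear_sum (bigD1 S) //= big1 =>
  [|T TS].
  by rewrite -scalerAr linearZ /= blade_ortho // eqxx mul1r addr0.
rewrite -scalerAr linearZ /=.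
have [/ae->|To] := boolP (odd #|T|); first by rewrite mul0r.
by rewrite blade_ortho // eq_sym (negbTE TS) mul0r mulr0.
Qed.

(** The even element whose coordinates are those of X on the orthogonal
    family of even blades. *)
Definition cl_of_mx (X : 'M[R]_N.+1) : Cl R n :=
  \sum_(S : {set 'I_n} | ~~ odd #|S|)
     (\tr ((blade P S)^T * X) / N.+1%:R) *: cl_basis R S.

Lemma cl_of_mx_coef X S :
  cl_coef (cl_of_mx X) S =
    if odd #|S| then 0 else \tr ((blade P S)^T * X) / N.+1%:R.
Proof.
rewrite cl_coef_sum; under eq_bigr do rewrite cl_coefZ cl_coef_basis.
case: ifP => [So|/negbT Se].
  rewrite big1 // => T Te; case: eqP => [ST|]; last by rewrite mulr0.
  by move: Te; rewrite -ST So.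
rewrite (bigD1 S) //= eqxx mulr1 big1 ?addr0 // => T /andP[_ /negbTE TS].
by rewrite eq_sym TS mulr0.
Qed.

Lemma cl_coefP a b : cl_coef a =1 cl_coef b -> a = b.
Proof.
move=> ab; apply/colP => i.
by have := ab (enum_val i); rewrite /cl_coef enum_valK.
Qed.

Lemma cl_of_mxK a : cl_even a -> cl_of_mx (cl_rep P a) = a.
Proof.
move=> ae; apply: cl_coefP => S; rewrite cl_of_mx_coef.
case: ifP => [/ae->//|/negbT Se].
by rewrite rep_coef // mulfK // pnatr_eq0.
Qed.

Lemma cl_rep_inj a b :
  cl_even a -> cl_even b -> cl_rep P a = cl_rep P b -> a = b.
Proof. by move=> ae be E; rewrite -(cl_of_mxK ae) E cl_of_mxK. Qed.

Lemma cl_of_mx_even X : cl_even (cl_of_mx X).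
Proof. by move=> S So; rewrite cl_of_mx_coef So. Qed.

Lemma cl_of_mx_linear : linear cl_of_mx.
Proof.
move=> k X Y; apply: cl_coefP => S.
rewrite {2}/cl_coef !mxE -!/(cl_coef _ _) !cl_of_mx_coef.
case: ifP => _; first by rewrite mulr0 addr0.
by rewrite mulrDr -scalerAr linearD linearZ /= mulrDl mulrA.
Qed.

Definition cl_full : Cl R n := cl_basis R [set: 'I_n]%SET.

(** Each of the n - 1 factors other than P_i contributes a sign. *)
Lemma blade_full_comm i :
  odd n -> P i * blade P [set: 'I_n]%SET = blade P [set: 'I_n]%SET * P i.
Proof.
move=> on; rewrite blade_comm.
have := cardsD1 i [set: 'I_n]%SET; rewrite inE cardsT card_ord.
by move=> /(congr1 odd); rewrite on /= => /esym/negbTE oS;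
  rewrite -signr_odd oS scale1r.
Qed.

Lemma cl_rep_gen_full i :
  cl_rep P (cl_mul (cl_basis R [set i]%SET) cl_full) = P i *
    blade P [set: 'I_n]%SET.
Proof. by rewrite cl_rep_mul // !cl_rep_basis /blade big_set1. Qed.

(** Since the number of generators is odd, multiplying by the volume element
    exchanges odd and even elements. *)
Lemma cl_gen_full_even i :
  odd n -> cl_even (cl_mul (cl_basis R [set i]%SET) cl_full).
Proof.
move=> on S So; apply: (@cl_mul_parity _ _ true true) => //.
- move=> T T1; rewrite cl_coef_basis; case: eqP => // TE.
  by move: T1; rewrite TE cards1.
- move=> T T1; rewrite cl_coef_basis; case: eqP => // TE.
  by move: T1; rewrite TE cardsT card_ord on.
- by rewrite So.
Qed.

End CliffordMatrices.

(** * The even part as a matrix algebra *)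

Section EvenIso.
Context {R : realType} {n N : nat}.
Variable p : 'I_n.+1 -> 'M[R]_N.+1.
Hypothesis psym : forall i, (p i)^T = p i.
Hypothesis cliff : forall i j, p i * p j + p j * p i = 2 *+ (i == j).
Hypothesis dimE : (2 ^ n = N.+1 * N.+1)%N.

(** Even blades are linearly independent, being orthogonal, and as many as
    the dimension of the matrix algebra, so they span it. *)
Lemma cl_of_mxKV X : cl_rep p (cl_of_mx p X) = X.
Proof.
suff [a ae ->] : exists2 a, cl_even a & X = cl_rep p a by rewrite cl_of_mxK.
pose E := [set S : {set 'I_n.+1} | ~~ odd #|S|]%SET.
pose K := \matrix_(i < #|E|) mxvec (blade p (enum_val i)).
pose comb (x : 'rV[R]_#|E|) : Cl R n.+1 :=
  \sum_i x 0 i *: cl_basis R (enum_val i).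
have comb_coef x i : cl_coef (comb x) (enum_val i) = x 0 i.
  rewrite cl_coef_sum (bigD1 i) //= cl_coefZ cl_coef_basis eqxx mulr1 big1
    ?addr0 // => j ji.
  rewrite cl_coefZ cl_coef_basis; case: eqP => [/enum_val_inj ij|];
    last by rewrite mulr0.
  by move: ji; rewrite ij eqxx.
have comb_even x : cl_even (comb x).
  move=> S So; rewrite cl_coef_sum big1 // => j _;
    rewrite cl_coefZ cl_coef_basis.
  case: eqP => [SE|]; last by rewrite mulr0.
  by have := enum_valP j; rewrite -SE inE So.
have combK x : mxvec (cl_rep p (comb x)) = x *m K.
  rewrite mulmx_sum_row cl_rep_sum linear_sum; apply: eq_bigr => i _.
  by rewrite cl_repZ cl_rep_basis linearZ rowK.
have Kfree : row_free K.
  apply: inj_row_free => x xK; apply/rowP => i; rewrite mxE -(comb_coef x).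
  suff -> : comb x = 0 by rewrite /cl_coef mxE.
  apply: (cl_rep_inj psym cliff) => //; first by move=> S _;
    rewrite /cl_coef mxE.
  have -> : cl_rep p 0 = 0 by rewrite /cl_rep big1 // => S _;
    rewrite /cl_coef mxE scale0r.
  by apply: (can_inj mxvecK); rewrite combK xK linear0.
have Kfull : row_full K.
  by rewrite /row_full (eqP Kfree) card_even_sets dimE.
have /submxP[x xE] : (mxvec X <= K)%MS by apply: submx_full.
exists (comb x) => //; apply: (can_inj mxvecK); by rewrite combK.
Qed.

(** Schur's lemma: the generators generate the full matrix algebra. *)
Lemma cliff_commutant (T : 'M[R]_N.+1) :
  (forall i, T * p i = p i * T) -> exists c, T = c%:M.
Proof.
move=> Tp.
have TS S : T * blade p S = blade p S * T.
  rewrite /blade; elim: (index_enum _) => [|i r IH];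
    first by rewrite big_nil mulr1 mul1r.
  by rewrite big_cons; case: ifP => // _; rewrite mulrA Tp -mulrA IH mulrA.
have TX X : T * X = X * T.
  rewrite -(cl_of_mxKV X) /cl_rep mulr_sumr mulr_suml; apply: eq_bigr => S _.
  by rewrite -scalerAr TS scalerAl.
exists (T 0 0); apply/matrixP => i j; rewrite !mxE.
(* Entry (i, 0) of the equality of T E and E T, for the matrix unit E in
   position (j, 0), reads off the entry (i, j) of T. *)
have := TX (delta_mx j 0) => /matrixP/(_ i 0).
rewrite -!mulmxE !mxE (bigD1 j) //= big1 => [|k kj]; last first.
  by rewrite mxE (negbTE kj) mulr0.
rewrite (bigD1 0) //= big1 => [|k k0];
  last by rewrite mxE (negbTE k0) andbF mul0r.
by rewrite !mxE !eqxx !andbT mulr1 !addr0 => ->; rewrite mulr_natl.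
Qed.

End EvenIso.

(** * Splitting a module over the matrix algebra *)

(** The columns of W are an orthonormal basis of the image of the projection
    Q. A nonzero column of Q lies in this image; once normalised it is split
    off, which lowers the trace by one. *)
Lemma proj_factor (R : realType) k m (Q : 'M[R]_k) :
  Q^T = Q -> Q *m Q = Q -> \tr Q = m%:R ->
  exists W : 'M[R]_(k, m), W^T *m W = 1%:M /\ W *m W^T = Q.
Proof.
have trsq n (B : 'M[R]_(k, n)) : \tr (B^T *m B) = \sum_i \sum_j B j i ^+ 2.
  apply: eq_bigr => i _; rewrite mxE; apply: eq_bigr => j _.
  by rewrite mxE expr2.
have trsq0 n (B : 'M[R]_(k, n)) : \tr (B^T *m B) = 0 -> B = 0.
  rewrite trsq => /eqP; rewrite psumr_eq0 => [/allP H|i _]; last first.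
    by apply: sumr_ge0 => j _; rewrite sqr_ge0.
  apply/matrixP => j i; rewrite mxE.
  have /(_ (mem_index_enum i)) /= := H i.
  rewrite psumr_eq0 => [/allP/(_ j (mem_index_enum j)) /=|? _];
    last exact: sqr_ge0.
  by rewrite sqrf_eq0 => /eqP.
elim: m Q => [|m IHm] Q QT QQ trQ.
  exists 0; split; first by apply/matrixP => -[].
  by rewrite mul0mx; apply/esym/trsq0; rewrite QT QQ.
have [j Qj] : exists j, col j Q != 0.
  apply/existsP; apply: contraT => /existsPn H.
  have Q0 : Q = 0.
    apply/matrixP => a b; have /negPn/eqP/matrixP/(_ a 0) := H b.
    by rewrite !mxE.
  by move: trQ; rewrite Q0 mxtrace0 => /eqP; rewrite eq_sym pnatr_eq0.
pose r := \tr ((col j Q)^T *m col j Q).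
have r_gt0 : 0 < r.
  rewrite lt_def /r; apply/andP; split.
    by apply: contra Qj => /eqP/trsq0 ->.
  by rewrite trsq; apply: sumr_ge0 => i _; apply: sumr_ge0 => l _;
    rewrite sqr_ge0.
pose w : 'cV[R]_k := (Num.sqrt r)^-1 *: col j Q.
have ww : w^T *m w = 1%:M.
  have -> : w^T = (Num.sqrt r)^-1 *: (col j Q)^T by apply/matrixP => a b;
    rewrite !mxE.
  rewrite /w -scalemxAl -scalemxAr scalerA -expr2 exprVn sqr_sqrtr ?ltW //.
  rewrite [_ *m _]mx11_scalar -[X in X%:M]trace_mx11 -/r scale_scalar_mx.
  by rewrite mulVf // gt_eqF.
have Qw : Q *m w = w.
  by rewrite /w -scalemxAr colE mulmxA QQ.
have wQ : w^T *m Q = w^T by rewrite -{2}Qw trmx_mul QT.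
have [] := IHm (Q - w *m w^T).
- by rewrite linearB /= trmx_mul trmxK QT.
- rewrite mulmxBl !mulmxBr QQ mulmxA Qw -mulmxA wQ -mulmxA
    [w^T *m (_ *m _)]mulmxA ww mul1mx.
  by rewrite subrr subr0.
- rewrite linearB /= mxtrace_mulC ww trQ mxtrace1 -natrB // subn1 //.
move=> W [WTW WWT].
have wW : w^T *m W = 0.
  rewrite -[W]mulmx1 -WTW [W *m _]mulmxA WWT mulmxA mulmxBr wQ mulmxA ww mul1mx
    subrr.
  by rewrite mul0mx.
suff : exists V : 'M[R]_(k, 1 + m), V^T *m V = 1%:M /\ V *m V^T = Q by [].
exists (row_mx w W); rewrite tr_row_mx mul_row_col WWT addrC subrK; split=> //.
rewrite mul_col_row ww WTW wW.
have -> : W^T *m w = 0 by rewrite -[W^T *m w]trmxK trmx_mul trmxK wW trmx0.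
by rewrite -scalar_mx_block.
Qed.

Section Intertwiner.
Context {R : realType} {n N M m : nat}.
Variables (p : 'I_n.+1 -> 'M[R]_N.+1) (P : 'I_n.+1 -> 'M[R]_M.+1).
Hypothesis psym : forall i, (p i)^T = p i.
Hypothesis pcliff : forall i j, p i * p j + p j * p i = 2 *+ (i == j).
Hypothesis Psym : forall i, (P i)^T = P i.
Hypothesis Pcliff : forall i j, P i * P j + P j * P i = 2 *+ (i == j).
Hypothesis dimE : (2 ^ n = N.+1 * N.+1)%N.
Hypothesis odim : odd n.+1.
Hypothesis dimM : (M.+1 = m * N.+1)%N.
Variable e : R.
Hypothesis e2 : e * e = 1.
Hypothesis pvol : blade p [set: 'I_n.+1]%SET = e%:A.
Hypothesis Pvol : blade P [set: 'I_n.+1]%SET = e%:A.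

(** The representation P of the even part, transported to the matrix algebra
    by the isomorphism given by p; it is a homomorphism of algebras with
    involution. *)
Definition mx_rep (X : 'M[R]_N.+1) : 'M[R]_M.+1 := cl_rep P (cl_of_mx p X).

Lemma mx_rep_linear : linear mx_rep.
Proof.
by move=> k X Y; rewrite /mx_rep cl_of_mx_linear cl_rep_linear.
Qed.

Lemma mx_repZ k X : mx_rep (k *: X) = k *: mx_rep X.
Proof. exact: (linear_scale mx_rep_linear). Qed.

Lemma mx_rep_sum I (r : seq I) F :
  mx_rep (\sum_(i <- r) F i) = \sum_(i <- r) mx_rep (F i).
Proof. exact: (linear_sumE mx_rep_linear). Qed.

Lemma mx_repE a : cl_even a -> mx_rep (cl_rep p a) = cl_rep P a.
Proof. by move=> ae; rewrite /mx_rep cl_of_mxK. Qed.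

Lemma mx_repM X Y : mx_rep (X * Y) = mx_rep X * mx_rep Y.
Proof.
rewrite -[X](cl_of_mxKV psym pcliff dimE) -[Y](cl_of_mxKV psym pcliff dimE).
have Xe := cl_of_mx_even p X; have Ye := cl_of_mx_even p Y.
rewrite -cl_rep_mul // !mx_repE ?cl_rep_mul //; exact: cl_even_mul.
Qed.

Lemma mx_rep1 : mx_rep 1 = 1.
Proof.
rewrite -(cl_rep_one p) mx_repE ?cl_rep_one // => S So.
by rewrite cl_coef_basis; case: eqP => // SE; move: So; rewrite SE cards0.
Qed.

(** As the volume element acts by the same sign e on both sides, the odd
    generator is e times an even element, on which both representations agree
    through mx_rep. *)
Lemma mx_rep_gen i : mx_rep (p i) = P i.
Proof.
have even_i := @cl_gen_full_even R _ i odim.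
have -> : p i = e *: cl_rep
  p (cl_mul (cl_basis R [set i]%SET) (cl_full (n:=_))).
  by rewrite cl_rep_gen_full // pvol -scalerAr mulr1 scalerA e2 scale1r.
rewrite mx_repZ mx_repE // cl_rep_gen_full // Pvol -scalerAr mulr1.
by rewrite scalerA e2 scale1r.
Qed.

Lemma mx_rep_tr X : mx_rep X^T = (mx_rep X)^T.
Proof.
rewrite /mx_rep /cl_rep linear_sum; apply: eq_bigr => S _ /=.
rewrite linearZ /= blade_tr // scalerA; congr (_ *: _).
rewrite !cl_of_mx_coef; case: ifP => _; first by rewrite mul0r.
rewrite mulrAC; congr (_ / _).
rewrite blade_tr // -!scalerAl !linearZ /=.
rewrite -mxtrace_tr -!mulmxE trmx_mul trmxK blade_tr // -scalemxAr linearZ /=.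
by rewrite mxtrace_mulC [RHS]mulrC.
Qed.

(** Nontrivial even blades have trace zero on both sides, so both traces are
    determined by the component on the identity. *)
Lemma mx_rep_trace X : \tr (mx_rep X) = m%:R * \tr X.
Proof.
rewrite /mx_rep /cl_rep linear_sum (bigD1 finset.set0) //= big1 => [|S S0].
  rewrite addr0 linearZ /= cl_of_mx_coef cards0 /= !blade0 trmx1 mul1r mxtrace1.
  by rewrite dimM natrM mulrC -mulrA; congr (_ * _);
    rewrite mulrC mulfVK // pnatr_eq0.
rewrite linearZ /= cl_of_mx_coef; case: ifP => [|/negbT So];
  first by rewrite mul0r.
by rewrite (blade_trace Pcliff) // mulr0.
Qed.

(** A representation of the matrix algebra of size N + 1 is a sum of m copies
    of the standard one. The image of the matrix unit E_00 is a projection of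
    rank m; an orthonormal basis of its range, moved by the units E_i0, gives
    in each copy a basis on which the algebra acts as on the standard module. *)
Lemma intertwiners : exists X : 'I_m -> 'M[R]_(M.+1, N.+1),
  [/\ forall k l, (X k)^T *m X l = (k == l)%:R%:M,
      \sum_k X k *m (X k)^T = 1%:M
    & forall k i, P i *m X k = X k *m p i].
Proof.
pose E i j : 'M[R]_N.+1 := delta_mx i j.
have EM i j k l : E i j * E k l = (j == k)%:R *: E i l.
  by rewrite -mulmxE mul_delta_mx_cond scaler_nat.
have [||| W [WTW WWT]] := @proj_factor R _ m (mx_rep (E 0 0)).
- by rewrite -mx_rep_tr trmx_delta.
- by rewrite mulmxE -mx_repM EM eqxx scale1r.
- rewrite mx_rep_trace /mxtrace (bigD1 0) //= big1 => [|i i0].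
    by rewrite mxE !eqxx addr0 mulr1.
  by rewrite mxE (negbTE i0).
pose Y i := mx_rep (E i 0) *m W.
have YY i j : (Y i)^T *m Y j = (i == j)%:R%:M.
  rewrite trmx_mul -mx_rep_tr trmx_delta -mulmxA [mx_rep _ *m (_ *m _)]mulmxA
    mulmxE.
  rewrite -mx_repM EM mx_repZ -WWT -scalemxAl -scalemxAr -!mulmxA WTW mulmx1
    WTW.
  by rewrite scalemx1.
have YYT i : Y i *m (Y i)^T = mx_rep (E i i).
  rewrite trmx_mul -mx_rep_tr trmx_delta mulmxA -[X in X *m _]mulmxA WWT.
  rewrite !mulmxE -!mx_repM -[X in _ * X]/(E 0 i).
  by rewrite !(EM, eqxx, scale1r).
have PY i j : P i *m Y j = \sum_l p i l j *: Y l.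
  rewrite mulmxA -mx_rep_gen mulmxE -mx_repM.
  have -> : p i * E j 0 = \sum_l p i l j *: E l 0.
    apply/matrixP => u v; rewrite -mulmxE !mxE summxE.
    under [RHS]eq_bigr do rewrite !mxE.
    rewrite (bigD1 j) //= big1 => [|l lj];
      last by rewrite mxE (negbTE lj) mulr0.
    rewrite [RHS](bigD1 u) //= big1 => [|l lu];
      last by rewrite eq_sym (negbTE lu) mulr0.
    by rewrite !mxE !eqxx.
  rewrite mx_rep_sum mulmx_suml; apply: eq_bigr => l _.
  by rewrite mx_repZ -scalemxAl.
have sumYY : \sum_i Y i *m (Y i)^T = 1%:M.
  under eq_bigr do rewrite YYT.
  rewrite -mx_rep_sum -[RHS]mx_rep1; congr mx_rep.
  rewrite -[RHS]/(1%:M) [RHS]matrix_sum_delta.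
  apply: eq_bigr => i _; rewrite (bigD1 i) //= big1.
    by rewrite mxE eqxx scale1r addr0.
  by move=> j ji; rewrite mxE eq_sym (negbTE ji) scale0r.
clearbody Y.
(* Y_i holds the i-th basis vectors of all copies; X_k collects the basis of
   the k-th copy. *)
exists (fun k => \matrix_(a, i) Y i a k); split.
- move=> k l; apply/matrixP => i j; rewrite !mxE.
  have /matrixP/(_ k l) := YY i j; rewrite !mxE.
  under eq_bigr do rewrite mxE.
  under [in X in _ -> X]eq_bigr do rewrite !mxE.
  by move=> ->; case: (i == j); case: (k == l).
- rewrite -sumYY; apply/matrixP => a b; rewrite !summxE.
  under eq_bigr do rewrite mxE; under [RHS]eq_bigr do rewrite mxE.
  rewrite exchange_big; apply: eq_bigr => i _; apply: eq_bigr => k _.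
  by rewrite !mxE.
move=> k i; apply/matrixP => a j; have /matrixP/(_ a k) := PY i j.
rewrite [in X in X -> _]mxE summxE => E1.
rewrite !mxE; transitivity (\sum_b P i a b * Y j b k).
  by apply: eq_bigr => b _; rewrite mxE.
by rewrite E1; apply: eq_bigr => b _; rewrite !mxE mulrC.
Qed.

End Intertwiner.

(** * Octonions *)

Section Octonions.
Context {R : realType}.
Implicit Types x y z w : 'cV[R]_8.

Definition oct1 : 'cV[R]_8 := delta_mx 0 0.

Definition oct_conj x : 'cV[R]_8 := \col_i if i == 0 then x i 0 else - x i 0.

Local Notation "x '_[' k ]" :=
  (x (inord k) 0) (at level 8, k at level 0, format "x '_[' k ]").

Lemma oct_coordP x y :
  x _[0] = y _[0] -> x _[1] = y _[1] -> x _[2] = y _[2] -> x _[3] = y _[3] ->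
  x _[4] = y _[4] -> x _[5] = y _[5] -> x _[6] = y _[6] -> x _[7] = y _[7] ->
  x = y.
Proof.
move=> *; apply/colP => -[[|[|[|[|[|[|[|[|//]]]]]]]] Hk].
all: match goal with |- _ (@Ordinal _ ?k _) _ = _ =>
  have -> : Ordinal Hk = inord k by apply: val_inj; rewrite /= inordK end; done.
Qed.

Lemma oct_imE x (j : 'Z_7) k : val j = k -> oct_im x j = x _[k.+1].
Proof.
move=> <-; rewrite /oct_im; congr (x _ 0); apply: val_inj.
by rewrite /= inordK // ltnS ltn_ord.
Qed.

Lemma inord0 : inord 0 = 0 :> 'I_8.
Proof. by apply: val_inj; rewrite /= inordK. Qed.

Lemma inordS (j : 'I_7) : inord j.+1 = lift ord0 j :> 'I_8.
Proof. by apply: val_inj; rewrite /= inordK // ltnS ltn_ord. Qed.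

Lemma oct_mul_re x y : (oct_mul x y) _[0] =
  x _[0] * y _[0] - (x _[1] * y _[1] + x _[2] * y _[2] + x _[3] * y _[3] +
  x _[4] * y _[4] + x _[5] * y _[5] + x _[6] * y _[6] + x _[7] * y _[7]).
Proof.
rewrite inord0 !mxE unlift_none; congr (_ - _).
transitivity (\sum_(j < 7) x _[j.+1] * y _[j.+1]).
  by apply: eq_bigr => j _; rewrite !(oct_imE _ (erefl (val j))).
by rewrite !big_ord_recr big_ord0 /= add0r.
Qed.

(** Coordinate 0 is the real part, so the unit e_j has coordinate j + 1 and
    only the index of the unit is reduced modulo 7. *)
Lemma oct_mul_im x y j : (j < 7)%N ->
  let c (k : nat) := ((j + k) %% 7).+1 in
  let d (k l : nat) := x _[c k] * y _[c l] - x _[c l] * y _[c k] in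
  (oct_mul x y) _[j.+1] =
    x _[0] * y _[j.+1] + y _[0] * x _[j.+1] + (d 1 3 + d 2 6 + d 4 5).
Proof.
move=> j7 c d; rewrite (inordS (Ordinal j7)) !mxE liftK -!inord0 /oct_cross.
have im (k : 'Z_7) z : oct_im z (Ordinal j7 + k) = z _[((j + val k) %% 7).+1].
  exact: oct_imE.
by rewrite !im -!inordS !(@oct_imE _ (Ordinal j7) j).
Qed.

Let oct_mul1 x y : (oct_mul x y) _[1] = x _[0] * y _[1] + y _[0] * x _[1] +
  ((x _[2] * y _[4] - x _[4] * y _[2]) + (x _[3] * y _[7] - x _[7] * y _[3])
    + (x _[5] * y _[6] - x _[6] * y _[5])).
Proof. exact: (oct_mul_im x y (isT : (0 < 7)%N)). Qed.

Let oct_mul2 x y : (oct_mul x y) _[2] = x _[0] * y _[2] + y _[0] * x _[2] +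
  ((x _[3] * y _[5] - x _[5] * y _[3]) + (x _[4] * y _[1] - x _[1] * y _[4])
    + (x _[6] * y _[7] - x _[7] * y _[6])).
Proof. exact: (oct_mul_im x y (isT : (1 < 7)%N)). Qed.

Let oct_mul3 x y : (oct_mul x y) _[3] = x _[0] * y _[3] + y _[0] * x _[3] +
  ((x _[4] * y _[6] - x _[6] * y _[4]) + (x _[5] * y _[2] - x _[2] * y _[5])
    + (x _[7] * y _[1] - x _[1] * y _[7])).
Proof. exact: (oct_mul_im x y (isT : (2 < 7)%N)). Qed.

Let oct_mul4 x y : (oct_mul x y) _[4] = x _[0] * y _[4] + y _[0] * x _[4] +
  ((x _[5] * y _[7] - x _[7] * y _[5]) + (x _[6] * y _[3] - x _[3] * y _[6])
    + (x _[1] * y _[2] - x _[2] * y _[1])).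
Proof. exact: (oct_mul_im x y (isT : (3 < 7)%N)). Qed.

Let oct_mul5 x y : (oct_mul x y) _[5] = x _[0] * y _[5] + y _[0] * x _[5] +
  ((x _[6] * y _[1] - x _[1] * y _[6]) + (x _[7] * y _[4] - x _[4] * y _[7])
    + (x _[2] * y _[3] - x _[3] * y _[2])).
Proof. exact: (oct_mul_im x y (isT : (4 < 7)%N)). Qed.

Let oct_mul6 x y : (oct_mul x y) _[6] = x _[0] * y _[6] + y _[0] * x _[6] +
  ((x _[7] * y _[2] - x _[2] * y _[7]) + (x _[1] * y _[5] - x _[5] * y _[1])
    + (x _[3] * y _[4] - x _[4] * y _[3])).
Proof. exact: (oct_mul_im x y (isT : (5 < 7)%N)). Qed.

Let oct_mul7 x y : (oct_mul x y) _[7] = x _[0] * y _[7] + y _[0] * x _[7] +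
  ((x _[1] * y _[3] - x _[3] * y _[1]) + (x _[2] * y _[6] - x _[6] * y _[2])
    + (x _[4] * y _[5] - x _[5] * y _[4])).
Proof. exact: (oct_mul_im x y (isT : (6 < 7)%N)). Qed.

Let oct1_re : oct1 _[0] = 1.
Proof. by rewrite inord0 mxE. Qed.

Let oct1_im k : (0 < k < 8)%N -> oct1 _[k] = 0.
Proof.
by move=> /andP[k0 k8]; rewrite mxE andbT -val_eqE /= inordK // gtn_eqF.
Qed.

Let conj_re x : (oct_conj x) _[0] = x _[0].
Proof. by rewrite inord0 mxE. Qed.

Let conj_im x k : (0 < k < 8)%N -> (oct_conj x) _[k] = - x _[k].
Proof.
by move=> /andP[k0 k8]; rewrite mxE -val_eqE /= inordK // gtn_eqF.
Qed.

Let addE x y i : (x + y) i 0 = x i 0 + y i 0. Proof. by rewrite mxE. Qed.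
Let oppE x i : (- x) i 0 = - x i 0. Proof. by rewrite mxE. Qed.
Let scaleE k x i : (k *: x) i 0 = k * x i 0. Proof. by rewrite mxE. Qed.

Lemma dot_octE x y : dot x y =
  x _[0] * y _[0] + x _[1] * y _[1] + x _[2] * y _[2] + x _[3] * y _[3] +
  x _[4] * y _[4] + x _[5] * y _[5] + x _[6] * y _[6] + x _[7] * y _[7].
Proof.
rewrite /dot; transitivity (\sum_(j < 8) x _[j] * y _[j]).
  by apply: eq_bigr => j _; rewrite inord_val.
by rewrite !big_ord_recr big_ord0 /= add0r.
Qed.

Let octE := (oct_mul_re, oct_mul1, oct_mul2, oct_mul3, oct_mul4, oct_mul5,
  oct_mul6, oct_mul7, addE, oppE, scaleE, oct1_re, conj_re,
  (oct1_im (isT : (0 < 1 < 8)%N), oct1_im (isT : (0 < 2 < 8)%N),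
   oct1_im (isT : (0 < 3 < 8)%N), oct1_im (isT : (0 < 4 < 8)%N),
   oct1_im (isT : (0 < 5 < 8)%N), oct1_im (isT : (0 < 6 < 8)%N),
   oct1_im (isT : (0 < 7 < 8)%N)),
  (fun x => (conj_im x (isT : (0 < 1 < 8)%N), conj_im x (isT : (0 < 2 < 8)%N),
   conj_im x (isT : (0 < 3 < 8)%N), conj_im x (isT : (0 < 4 < 8)%N),
   conj_im x (isT : (0 < 5 < 8)%N), conj_im x (isT : (0 < 6 < 8)%N),
   conj_im x (isT : (0 < 7 < 8)%N)))).

Ltac oct_ring := apply: oct_coordP; rewrite ?octE; ring.

Lemma oct_mul_linearl y : linear (fun x => oct_mul x y).
Proof. by move=> k x z; oct_ring. Qed.

Lemma oct_mul_linearr x : linear (oct_mul x).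
Proof. by move=> k y z; oct_ring. Qed.

Lemma oct_mul1x x : oct_mul oct1 x = x.
Proof. by oct_ring. Qed.

Lemma oct_mulx1 x : oct_mul x oct1 = x.
Proof. by oct_ring. Qed.

Lemma oct_conjK x : oct_conj (oct_conj x) = x.
Proof. by oct_ring. Qed.

Lemma oct_conj_linear : linear oct_conj.
Proof. by move=> k x y; oct_ring. Qed.

Lemma oct_conjM x y :
  oct_conj (oct_mul x y) = oct_mul (oct_conj y) (oct_conj x).
Proof. by oct_ring. Qed.

Lemma oct_conj_mulK w x : oct_mul (oct_conj w) (oct_mul w x) = dot w w *: x.
Proof. by rewrite dot_octE; oct_ring. Qed.

Lemma oct_mul_conjK w x : oct_mul w (oct_mul (oct_conj w) x) = dot w w *: x.
Proof. by rewrite dot_octE; oct_ring. Qed.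

Lemma oct_mul_adj w x y : dot (oct_mul w x) y = dot x (oct_mul (oct_conj w) y).
Proof. by rewrite !dot_octE !octE; ring. Qed.

Lemma oct_mul_adjr w x y : dot (oct_mul w x) y = dot w (oct_mul y (oct_conj x)).
Proof. by rewrite !dot_octE !octE; ring. Qed.

Lemma oct_conj_polar x y :
  oct_mul (oct_conj x) y + oct_mul (oct_conj y) x = (2 * dot x y) *: oct1.
Proof. by rewrite dot_octE; oct_ring. Qed.

(** A line of the Fano plane spans a quaternion subalgebra H, and the
    octonions are H + H l; changing the signs of the units off the line is
    the automorphism that is 1 on H and -1 on H l. *)
Definition oct_flip (N : seq nat) x : 'cV[R]_8 :=
  \col_i if (i : nat) \in N then - x i 0 else x i 0.

(** The coordinates off three lines without common point. *)
Definition fano_flips :=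
  [:: [:: 1; 4; 6; 7]; [:: 1; 2; 5; 7]; [:: 1; 2; 3; 6]]%N.

Lemma oct_flip_linear N : linear (oct_flip N).
Proof.
move=> k x y; apply/colP => i; rewrite !mxE.
by case: ifP => // _; rewrite mulrN opprD.
Qed.

Lemma oct_flipK N : involutive (oct_flip N).
Proof.
by move=> x; apply/colP => i; rewrite !mxE; case: (_ \in N); rewrite ?opprK.
Qed.

Let flipE N x k : (k < 8)%N ->
  (oct_flip N x) _[k] = if k \in N then - x _[k] else x _[k].
Proof. by move=> k8; rewrite mxE inordK. Qed.

Lemma oct_flipM N x y : N \in fano_flips ->
  oct_flip N (oct_mul x y) = oct_mul (oct_flip N x) (oct_flip N y).
Proof.
by rewrite !inE => /or3P[] /eqP ->; apply: oct_coordP;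
  rewrite ?octE !flipE //= ?octE; ring.
Qed.

Lemma oct_flip_fixed x :
  {in fano_flips, forall N, oct_flip N x = x} -> x = x 0 0 *: oct1.
Proof.
move=> fx; have x0 N k : N \in fano_flips -> (k < 8)%N -> k \in N -> x _[k] = 0.
  move=> /fx/(congr1 (fun w : 'cV[R]_8 => w _[k])) + k8 kN; rewrite flipE // kN;
    lra.
rewrite -inord0; apply: oct_coordP; rewrite !octE ?mulr1 ?mulr0 //.
- exact: (x0 [:: 1; 4; 6; 7]%N).
- exact: (x0 [:: 1; 2; 5; 7]%N).
- exact: (x0 [:: 1; 2; 3; 6]%N).
- exact: (x0 [:: 1; 4; 6; 7]%N).
- exact: (x0 [:: 1; 2; 5; 7]%N).
- exact: (x0 [:: 1; 4; 6; 7]%N).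
- exact: (x0 [:: 1; 4; 6; 7]%N).
Qed.

Lemma oct_sqr x : oct_mul x x = (2 * x 0 0) *: x - dot x x *: oct1.
Proof. by rewrite -inord0 dot_octE; oct_ring. Qed.

End Octonions.

(** * The octonionic spin module *)

Section Dot.
Context {R : realType}.

Lemma dotC k (x y : 'cV[R]_k) : dot x y = dot y x.
Proof. by apply: eq_bigr => i _; rewrite mulrC. Qed.

Lemma dotDr k (x y z : 'cV[R]_k) : dot x (y + z) = dot x y + dot x z.
Proof.
by rewrite /dot -big_split; apply: eq_bigr => i _; rewrite !mxE mulrDr.
Qed.

Lemma dotDl k (x y z : 'cV[R]_k) : dot (y + z) x = dot y x + dot z x.
Proof. by rewrite dotC dotDr !(dotC x). Qed.

Lemma dotZr k c (x y : 'cV[R]_k) : dot x (c *: y) = c * dot x y.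
Proof.
by rewrite /dot mulr_sumr; apply: eq_bigr => i _; rewrite !mxE mulrCA.
Qed.

Lemma dotZl k c (x y : 'cV[R]_k) : dot (c *: x) y = c * dot x y.
Proof. by rewrite dotC dotZr dotC. Qed.

Lemma dotNr k (x y : 'cV[R]_k) : dot x (- y) = - dot x y.
Proof. by rewrite -scaleN1r dotZr mulN1r. Qed.

Lemma dotNl k (x y : 'cV[R]_k) : dot (- x) y = - dot x y.
Proof. by rewrite dotC dotNr dotC. Qed.

Lemma dot0r k (x : 'cV[R]_k) : dot x 0 = 0.
Proof. by rewrite /dot big1 // => i _; rewrite mxE mulr0. Qed.

Lemma dot0l k (x : 'cV[R]_k) : dot 0 x = 0.
Proof. by rewrite dotC dot0r. Qed.

Lemma dot_sumr k I (r : seq I) Q (x : 'cV[R]_k) F :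
  dot x (\sum_(i <- r | Q i) F i) = \sum_(i <- r | Q i) dot x (F i).
Proof. by elim/big_ind2: _ => [|? ? ? ? <- <-|//]; rewrite ?dot0r ?dotDr. Qed.

Lemma dot_mul k l (A : 'M[R]_(l, k)) x y : dot (A *m x) y = dot x (A^T *m y).
Proof.
rewrite /dot; under eq_bigr do rewrite mxE mulr_suml.
rewrite exchange_big; apply: eq_bigr => j _ /=; rewrite mxE mulr_sumr.
by apply: eq_bigr => i _; rewrite mxE mulrCA mulrA.
Qed.

Lemma dot_ge0 k (x : 'cV[R]_k) : 0 <= dot x x.
Proof. by apply: sumr_ge0 => i _; rewrite -expr2 sqr_ge0. Qed.

Lemma dot_eq0 k (x : 'cV[R]_k) : (dot x x == 0) = (x == 0).
Proof.
apply/eqP/eqP => [/eqP|->]; last exact: dot0r.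
rewrite psumr_eq0 => [/allP H|i _]; last by rewrite -expr2 sqr_ge0.
apply/colP => i; rewrite mxE; have := H i (mem_index_enum _).
by rewrite /= -expr2 sqrf_eq0 => /eqP.
Qed.

Lemma dot_gt0 k (x : 'cV[R]_k) : (0 < dot x x) = (x != 0).
Proof. by rewrite lt_def dot_ge0 andbT dot_eq0. Qed.

Lemma dot_delta k (x : 'cV[R]_k) i : dot (delta_mx i 0) x = x i 0.
Proof.
rewrite /dot (bigD1 i) //= mxE !eqxx mul1r big1 ?addr0 // => j ji.
by rewrite mxE (negbTE ji) mul0r.
Qed.

Lemma dot_inj k (x y : 'cV[R]_k) : (forall z, dot z x = dot z y) -> x = y.
Proof. by move=> H; apply/colP => i; rewrite -!dot_delta H. Qed.

(** The equality case of the Cauchy-Schwarz inequality. *)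
Lemma unit_eq k (x y : 'cV[R]_k) :
  dot x x = 1 -> dot y y = 1 -> dot x y = 1 -> x = y.
Proof.
move=> x1 y1 xy; apply/eqP; rewrite -subr_eq0 -dot_eq0.
by rewrite dotDr !dotDl !dotNr !dotNl (dotC y x) x1 y1 xy opprK subrr addNr
  addr0.
Qed.

Lemma two_inj k (x : 'cV[R]_k) : x = - x -> x = 0.
Proof.
move=> /eqP; rewrite -subr_eq0 opprK -mulr2n -scaler_nat scaler_eq0 pnatr_eq0
  /=.
by move/eqP.
Qed.

Definition normalize k (x : 'cV[R]_k) := (Num.sqrt (dot x x))^-1 *: x.

Lemma dot_normalize k (x : 'cV[R]_k) :
  x != 0 -> dot (normalize x) (normalize x) = 1.
Proof.
rewrite -dot_gt0 => x0; rewrite dotZl dotZr mulrA -expr2 exprVn sqr_sqrtr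
  ?ltW //.
by rewrite mulVf // gt_eqF.
Qed.

End Dot.

Section OctonionNorm.
Context {R : realType}.
Implicit Types x y z w : 'cV[R]_8.

Lemma oct_normM x y : dot (oct_mul x y) (oct_mul x y) = dot x x * dot y y.
Proof. by rewrite oct_mul_adj oct_conj_mulK dotZr. Qed.

Lemma dot_oct1 : dot (oct1 : 'cV[R]_8) oct1 = 1.
Proof. by rewrite dot_delta mxE. Qed.

Lemma dot_oct1l x : dot oct1 x = x 0 0.
Proof. by rewrite dot_delta. Qed.

Lemma oct_conj_norm x : dot (oct_conj x) (oct_conj x) = dot x x.
Proof.
apply: eq_bigr => i _; rewrite mxE; case: ifP => // _; by rewrite mulrNN.
Qed.

Lemma oct_conj1 : oct_conj oct1 = oct1 :> 'cV[R]_8.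
Proof. by apply/colP => i; rewrite !mxE; case: eqP => //= _; rewrite oppr0. Qed.

Lemma oct_conj_imag x : x 0 0 = 0 -> oct_conj x = - x.
Proof.
by move=> x0; apply/colP => i; rewrite !mxE; case: eqP => // ->;
  rewrite x0 oppr0.
Qed.

Lemma oct_mulZl k x y : oct_mul (k *: x) y = k *: oct_mul x y.
Proof. exact: (linear_scale (oct_mul_linearl y)). Qed.

Lemma oct_mulZr k x y : oct_mul x (k *: y) = k *: oct_mul x y.
Proof. exact: (linear_scale (oct_mul_linearr x)). Qed.

Lemma oct_mulNl x y : oct_mul (- x) y = - oct_mul x y.
Proof. by rewrite -scaleN1r oct_mulZl scaleN1r. Qed.

Lemma oct_mul0l x : oct_mul 0 x = 0.
Proof. exact: (linear_zero (oct_mul_linearl x)). Qed.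

Lemma oct_mul0r x : oct_mul x 0 = 0.
Proof. exact: (linear_zero (oct_mul_linearr x)). Qed.

(** This is polarisation of conj(x) x = |x|^2. *)
Lemma oct_conj_comm x y : y 0 0 = 0 -> dot x y = 0 ->
  oct_mul (oct_conj x) y = oct_mul y x.
Proof.
move=> y0 xy; have := oct_conj_polar x y.
rewrite (oct_conj_imag y0) oct_mulNl xy mulr0 scale0r => /eqP.
by rewrite subr_eq0 => /eqP.
Qed.

Definition mx_of m n (f : 'cV[R]_n -> 'cV[R]_m) : 'M[R]_(m, n) :=
  \matrix_(i, j) f (delta_mx j 0) i 0.

Lemma mx_ofE m n (f : 'cV[R]_n -> 'cV[R]_m) (x : 'cV[R]_n) :
  linear f -> mx_of f *m x = f x.
Proof.
move=> linf; rewrite [RHS](mx_linearE _ linf); apply/colP => i.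
rewrite mxE summxE; apply: eq_bigr => j _.
by rewrite big_ord1 !mxE mulrC.
Qed.

Definition oct_lmx w : 'M[R]_8 := mx_of (oct_mul w).

Lemma oct_lmxE w x : oct_lmx w *m x = oct_mul w x.
Proof. exact/mx_ofE/oct_mul_linearr. Qed.

Lemma mulmx_colP m n (A B : 'M[R]_(m, n)) :
  (forall x : 'cV[R]_n, A *m x = B *m x) -> A = B.
Proof.
move=> AB; apply/matrixP => i j; have := AB (delta_mx j 0).
by rewrite -!colE => /colP/(_ i); rewrite !mxE.
Qed.

Lemma oct_lmx_tr w : (oct_lmx w)^T = oct_lmx (oct_conj w).
Proof.
apply: mulmx_colP => x; apply: dot_inj => z.
by rewrite -dot_mul !oct_lmxE oct_mul_adj.
Qed.

End OctonionNorm.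

Section Model.
Context {R : realType}.
Implicit Types (z : 'cV[R]_9) (w x y : 'cV[R]_8).

Definition re9 z : R := z 0 0.
Definition oct9 z : 'cV[R]_8 := \col_j z (lift ord0 j) 0.
Definition vec9 (r : R) w : 'cV[R]_9 :=
  \col_i if unlift ord0 i is Some j then w j 0 else r.

Lemma re9_vec r w : re9 (vec9 r w) = r.
Proof. by rewrite /re9 mxE unlift_none. Qed.

Lemma oct9_vec r w : oct9 (vec9 r w) = w.
Proof. by apply/colP => j; rewrite !mxE liftK. Qed.

Lemma vec9K z : vec9 (re9 z) (oct9 z) = z.
Proof.
by apply/colP => i; rewrite mxE; case: unliftP => [j ->|->] //; rewrite mxE.
Qed.

Lemma dot9E z z' : dot z z' = re9 z * re9 z' + dot (oct9 z) (oct9 z').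
Proof.
by rewrite /dot big_ord_recl; congr (_ + _); apply: eq_bigr => j _;
  rewrite !mxE.
Qed.

(** Locked, so that unification does not unfold block matrices. *)
Fact pair16_key : unit. Proof. exact: tt. Qed.
Definition pair16 x y : 'cV[R]_16 :=
  locked_with pair16_key (col_mx x y : 'cV[R]_(8 + 8)).

Lemma pair16E x y : pair16 x y = (col_mx x y : 'cV[R]_(8 + 8)).
Proof. exact: locked_withE. Qed.

Definition fst16 (u : 'cV[R]_16) : 'cV[R]_8 := usubmx (u : 'cV[R]_(8 + 8)).
Definition snd16 (u : 'cV[R]_16) : 'cV[R]_8 := dsubmx (u : 'cV[R]_(8 + 8)).

Lemma pair16K u : pair16 (fst16 u) (snd16 u) = u.
Proof. by rewrite pair16E; apply: (@vsubmxK R 8 8 1 u). Qed.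

Lemma fst16_pair x y : fst16 (pair16 x y) = x.
Proof. by rewrite pair16E; apply: (@col_mxKu R 8 8 1 x y). Qed.

Lemma snd16_pair x y : snd16 (pair16 x y) = y.
Proof. by rewrite pair16E; apply: (@col_mxKd R 8 8 1 x y). Qed.

Lemma dot_pair16 x y x' y' :
  dot (pair16 x y) (pair16 x' y') = dot x x' + dot y y'.
Proof.
rewrite /dot (@big_split_ord _ _ _ 8 8).
congr (_ + _); apply: eq_bigr => i _.
  by rewrite !pair16E !(@col_mxEu R 8 8 1).
by rewrite !pair16E !(@col_mxEd R 8 8 1).
Qed.

Lemma pair16D k x y x' y' :
  k *: pair16 x y + pair16 x' y' = pair16 (k *: x + x') (k *: y + y').
Proof. by rewrite !pair16E (@scale_col_mx R 8 8 1) (@add_col_mx R 8 8 1). Qed.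

Lemma pair16Z k x y : k *: pair16 x y = pair16 (k *: x) (k *: y).
Proof. by rewrite !pair16E; apply: (@scale_col_mx R 8 8 1). Qed.

Lemma fst16_linear : linear fst16.
Proof. by move=> k u u'; apply/colP => i; rewrite !mxE. Qed.

Lemma snd16_linear : linear snd16.
Proof. by move=> k u u'; apply/colP => i; rewrite !mxE. Qed.

Lemma pair16N x y : - pair16 x y = pair16 (- x) (- y).
Proof. by rewrite -[LHS]scaleN1r pair16Z !scaleN1r. Qed.

(** The Clifford action of R + O on pairs of octonions, graded by the
    eigenspaces of the vector (1, 0). *)
Definition spin_mx z : 'M[R]_16 :=
  (block_mx (re9 z)%:M (oct_lmx (oct9 z))^T
            (oct_lmx (oct9 z)) (- (re9 z)%:M) : 'M[R]_(8 + 8)).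

Lemma spin_mxE z x y : spin_mx z *m pair16 x y =
  pair16 (re9 z *: x + oct_mul (oct_conj (oct9 z)) y)
         (oct_mul (oct9 z) x - re9 z *: y).
Proof.
rewrite !pair16E;
  apply: (etrans (@mul_block_col R 8 8 8 8 1 (re9 z)%:M (oct_lmx (oct9 z))^T
  (oct_lmx (oct9 z)) (- (re9 z)%:M) x y)).
by rewrite oct_lmx_tr !oct_lmxE mulNmx !mul_scalar_mx.
Qed.

Lemma re9_linear : linear (re9 : 'cV[R]_9 -> R^o).
Proof. by move=> k z z'; rewrite /re9 !mxE. Qed.

Lemma oct9_linear : linear oct9.
Proof. by move=> k z z'; apply/colP => i; rewrite !mxE. Qed.

Lemma spin_mx_linear : linear spin_mx.
Proof.
move=> k z z'; apply: mulmx_colP => x; rewrite -[x]pair16K.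
rewrite mulmxDl -scalemxAl !spin_mxE pair16D re9_linear oct9_linear.
rewrite oct_conj_linear !oct_mul_linearl; congr pair16.
  by rewrite scalerDl scalerDr -scalerA addrACA.
by rewrite scalerBr scalerDl opprD -scalerA addrACA.
Qed.

Lemma spin_mx_tr z : (spin_mx z)^T = spin_mx z.
Proof.
apply: (etrans (@tr_block_mx R 8 8 8 8 (re9 z)%:M (oct_lmx (oct9 z))^T
  (oct_lmx (oct9 z)) (- (re9 z)%:M))).
by rewrite trmxK linearN /= !tr_scalar_mx.
Qed.

(** Alternativity: multiplication by w followed by multiplication by its
    conjugate is multiplication by |w|^2. *)
Lemma spin_mx_sq z : spin_mx z *m spin_mx z = (dot z z)%:M.
Proof.
apply: mulmx_colP => x; rewrite -[x]pair16K -mulmxA !spin_mxE mul_scalar_mx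
  pair16Z.
rewrite dot9E; congr pair16.
  rewrite (linear_add (oct_mul_linearr _)) -scaleNr !oct_mulZr oct_conj_mulK.
  by rewrite scalerDr scalerA addrACA -scalerDl scaleNr subrr addr0.
rewrite (linear_add (oct_mul_linearr _)) !oct_mulZr oct_mul_conjK.
rewrite scalerBr scalerA opprB addrC addrACA.
by rewrite addrA addrK -scalerDl.
Qed.

Definition model (i : 'I_9) : 'M[R]_16 := spin_mx (delta_mx i 0).

Lemma model_sym i : (model i)^T = model i.
Proof. exact: spin_mx_tr. Qed.

Lemma spin_mx_polar z z' :
  spin_mx z *m spin_mx z' + spin_mx z' *m spin_mx z = (2 * dot z z')%:M.
Proof.
have := spin_mx_sq (z + z'); rewrite (linear_add spin_mx_linear).
rewrite mulmxDl !mulmxDr !spin_mx_sq dotDr !dotDl (dotC z' z) !raddfD /= => H.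
apply: (addrI (dot z z)%:M); apply: (addIr (dot z' z')%:M).
rewrite -!addrA in H *; rewrite H mulr_natl mulr2n raddfD /= !addrA.
by [].
Qed.

Lemma model_cliff i j : model i * model j + model j * model i = 2 *+ (i == j).
Proof.
rewrite -!mulmxE spin_mx_polar dot_delta mxE andbT.
by case: eqP => _; rewrite ?mulr1 ?mulr0 ?raddf0 // -[2]/(1 *+ 2) raddfMn.
Qed.

Lemma spin_mxS z : spin_mx z = \sum_i z i 0 *: model i.
Proof.
rewrite (mx_linearE _ spin_mx_linear); apply: eq_bigr => i _.
by rewrite big_ord1.
Qed.

(** The pole of the 8-sphere, locked so that unification does not compare its
    coordinates by computation. *)
Fact pole_key : unit. Proof. exact: tt. Qed.
Definition e0 : 'cV[R]_9 := locked_with pole_key (vec9 1 0).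

Lemma e0E : e0 = vec9 1 0. Proof. exact: locked_withE. Qed.

Lemma re9_e0 : re9 e0 = 1. Proof. by rewrite e0E re9_vec. Qed.
Lemma oct9_e0 : oct9 e0 = 0. Proof. by rewrite e0E oct9_vec. Qed.

Lemma dot_e0 : dot e0 e0 = 1.
Proof. by rewrite dot9E re9_e0 oct9_e0 dot0r mulr1 addr0. Qed.

Lemma spin_e0E x y : spin_mx e0 *m pair16 x y = pair16 x (- y).
Proof.
rewrite spin_mxE re9_e0 oct9_e0 (linear_zero oct_conj_linear) !oct_mul0l.
by rewrite !scale1r addr0 add0r.
Qed.

End Model.

(** * The spin group in the spin module *)

Section SpinModel.
Context {R : realType}.
Implicit Types (z v : 'cV[R]_9) (w x y : 'cV[R]_8) (g h : Cl R 9).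

Definition sigma : Cl R 9 -> 'M[R]_16 := cl_rep (@model R).

Lemma sigma_mul g h : sigma (cl_mul g h) = sigma g *m sigma h.
Proof. exact: (cl_rep_mul (@model_cliff R)). Qed.

Lemma sigma_one : sigma (cl_one R 9) = 1%:M.
Proof. exact: cl_rep_one. Qed.

Lemma sigma_inj g h : cl_even g -> cl_even h -> sigma g = sigma h -> g = h.
Proof. exact: (cl_rep_inj (@model_sym R) (@model_cliff R)). Qed.

Lemma sigma_vec v : sigma (cl_vec v) = spin_mx v.
Proof. by rewrite /sigma cl_rep_vec spin_mxS. Qed.

Definition spin_prod (s : seq 'cV[R]_9) : 'M[R]_16 :=
  foldr (fun v A => spin_mx v *m A) 1%:M s.

Lemma sigma_vecs s : sigma (vecs_mul s) = spin_prod s.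
Proof.
by elim: s => [|v s IHs]; rewrite ?sigma_one //= sigma_mul sigma_vec IHs.
Qed.

Lemma spin_prod_cat s t : spin_prod (s ++ t) = spin_prod s *m spin_prod t.
Proof. by elim: s => [|v s IHs] /=; rewrite ?mul1mx // IHs mulmxA. Qed.

Lemma spin_prod_rev s : spin_prod (rev s) = (spin_prod s)^T.
Proof.
elim: s => [|v s IHs] /=; first by rewrite trmx1.
by rewrite rev_cons -cats1 spin_prod_cat IHs /= mulmx1 trmx_mul spin_mx_tr.
Qed.

Definition unit_vecs (s : seq 'cV[R]_9) := {in s, forall v, dot v v = 1}.

Lemma Spin_vecs s : ~~ odd (size s) -> unit_vecs s -> Spin (vecs_mul s).
Proof. by move=> es us; exists s. Qed.

Lemma unit_vecs_cons v s : unit_vecs (v :: s) -> dot v v = 1 /\ unit_vecs s.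
Proof.
move=> us; split; first by apply: us; rewrite inE eqxx.
by move=> w ws; apply: us; rewrite inE ws orbT.
Qed.

Lemma spin_prod_orth s : unit_vecs s -> (spin_prod s)^T *m spin_prod s = 1%:M.
Proof.
elim: s => [|v s IHs] /=; first by rewrite trmx1 mulmx1.
move=> /unit_vecs_cons[v1 /IHs us].
by rewrite trmx_mul spin_mx_tr mulmxA -[_ *m spin_mx v *m spin_mx v]mulmxA
  spin_mx_sq v1 mulmx1 us.
Qed.

(** Conjugation by a unit vector is the negative of the reflection that it
    defines. *)
Lemma spin_mx_reflect v z : dot v v = 1 ->
  spin_mx v *m spin_mx z *m spin_mx v = spin_mx ((2 * dot v z) *: v - z).
Proof.
move=> v1; have zv : spin_mx z *m spin_mx v =
    (2 * dot v z)%:M - spin_mx v *m spin_mx z.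
  by rewrite -spin_mx_polar [X in X - _]addrC addrK.
rewrite -mulmxA zv mulmxBr mulmxA spin_mx_sq v1 mul1mx.
rewrite (linear_add spin_mx_linear) (linear_scale spin_mx_linear).
by rewrite -[- z]scaleN1r (linear_scale spin_mx_linear) scaleN1r mul_mx_scalar.
Qed.

Lemma spin_prod_conj s z : unit_vecs s ->
  exists z', (spin_prod s)^T *m spin_mx z *m spin_prod s = spin_mx z'.
Proof.
elim: s z => [|v s IHs] z /=; first by exists z; rewrite trmx1 mul1mx mulmx1.
move=> /unit_vecs_cons[v1 us].
have [z' zE] := IHs ((2 * dot v z) *: v - z) us; exists z'.
by rewrite -zE -spin_mx_reflect // trmx_mul spin_mx_tr !mulmxA.
Qed.

(** The product is again a product of unit vectors in the Clifford algebra
    because the representation is faithful on even elements. *)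
Lemma Spin_mul g h : Spin g -> Spin h -> Spin (cl_mul g h).
Proof.
move=> Sg Sh; have ge := Spin_even Sg; have he := Spin_even Sh.
have [s [es us gE]] := Sg; have [t [et ut hE]] := Sh.
have Sst : Spin (vecs_mul (s ++ t)).
  apply: Spin_vecs; first by rewrite size_cat oddD (negbTE es) (negbTE et).
  by move=> v; rewrite mem_cat => /orP[/us|/ut].
rewrite (_ : cl_mul g h = vecs_mul (s ++ t)) //; apply: sigma_inj.
- exact: cl_even_mul.
- exact: Spin_even.
- by rewrite sigma_mul gE hE !sigma_vecs spin_prod_cat.
Qed.

Lemma Spin_one : Spin (cl_one R 9).
Proof. by exists [::]. Qed.

(** The reversed product of unit vectors is both the inverse and, the vectors
    being symmetric, the transpose. *)
Lemma Spin_inv g : Spin g -> exists2 h, Spin h &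
  sigma h = (sigma g)^T.
Proof.
move=> [s [es us ->]]; exists (vecs_mul (rev s)).
  apply: Spin_vecs; first by rewrite size_rev.
  by move=> v; rewrite mem_rev; apply: us.
by rewrite !sigma_vecs spin_prod_rev.
Qed.

Lemma Spin_orth g : Spin g -> (sigma g)^T *m sigma g = 1%:M.
Proof. by move=> [s [_ us ->]]; rewrite sigma_vecs spin_prod_orth. Qed.

Lemma Spin_conj g z : Spin g ->
  exists z', (sigma g)^T *m spin_mx z *m sigma g = spin_mx z'.
Proof. by move=> [s [_ us ->]]; rewrite sigma_vecs; apply: spin_prod_conj. Qed.

(** ** The isotropy group *)

Definition diag_pair (A : 'M[R]_8) :
  'M[R]_16 := (block_mx A 0 0 A : 'M[R]_(8 + 8)).

Lemma diag_pairE A x y : diag_pair A *m pair16 x y = pair16 (A *m x) (A *m y).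
Proof.
rewrite !pair16E; apply: (etrans (@mul_block_col R 8 8 8 8 1 A 0 0 A x y)).
by rewrite !mul0mx addr0 add0r.
Qed.

Lemma mx16P (A B : 'M[R]_16) :
  (forall x y, A *m pair16 x y = B *m pair16 x y) -> A = B.
Proof. by move=> AB; apply: mulmx_colP => u; rewrite -[u]pair16K. Qed.

Lemma pair16_inj x y x' y' : pair16 x y = pair16 x' y' -> x = x' /\ y = y'.
Proof.
move=> E; split; first by rewrite -(fst16_pair x y) E fst16_pair.
by rewrite -(snd16_pair x y) E snd16_pair.
Qed.

(** The images under g of the vectors of R^9 are vectors (twisted commutation
    tw). A vector z with z (1, 0) = (1, 0) is the pole, so g commutes with
    the pole and preserves its eigenspaces, the two octonion factors. *)
Lemma Spin_stab g : Spin g ->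
  sigma g *m pair16 oct1 0 = pair16 oct1 0 ->
  sigma g *m pair16 0 oct1 = pair16 0 oct1 ->
  exists2 A, G2 A & sigma g = diag_pair A.
Proof.
move=> Sg g1 g2.
pose S := sigma g.
have SS : S^T *m S = 1%:M := Spin_orth Sg.
have [h Sh hE] := Spin_inv Sg.
have tw z : exists z', S *m spin_mx z = spin_mx z' *m S.
  have [z' z'E] := Spin_conj z Sh; exists z'.
  by rewrite -z'E hE trmxK -/S -!mulmxA SS mulmx1.
have Se0 : S *m spin_mx e0 = spin_mx e0 *m S.
  have [z zE] := tw e0; rewrite zE; congr (spin_mx _ *m _).
  have := congr1 (mulmx^~ (pair16 oct1 0)) zE.
  rewrite /= -!mulmxA spin_e0E oppr0 g1 spin_mxE scaler0 subr0 oct_mul0r addr0.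
  rewrite oct_mulx1 => /pair16_inj[/colP/(_ 0)]; rewrite !mxE /= mulr1 => z1 z0.
  by rewrite e0E -[z]vec9K -z1 -z0.
pose f x := fst16 (S *m pair16 x 0).
pose f' y := snd16 (S *m pair16 0 y).
have Sf x : S *m pair16 x 0 = pair16 (f x) 0.
  rewrite -[LHS]pair16K -/(f x); congr pair16; apply: two_inj.
  have := congr1 (mulmx^~ (pair16 x 0)) Se0.
  rewrite /= -!mulmxA spin_e0E oppr0 -{2}[S *m _]pair16K spin_e0E => E.
  by rewrite {1}E snd16_pair.
have Sf' y : S *m pair16 0 y = pair16 0 (f' y).
  rewrite -[LHS]pair16K -/(f' y); congr pair16; apply: two_inj.
  have := congr1 (mulmx^~ (pair16 0 y)) Se0.
  rewrite /= -!mulmxA spin_e0E -[S *m pair16 0 y]pair16K spin_e0E pair16K => E.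
  have fE : fst16 (S *m pair16 0 (- y)) = fst16 (S *m pair16 0 y).
    by rewrite E fst16_pair.
  rewrite -{1}fE; have -> : pair16 0 (- y) = - pair16 0 y by rewrite pair16N
    oppr0.
  by rewrite mulmxN -scaleN1r (linear_scale fst16_linear) scaleN1r.
have f'1 : f' oct1 = oct1 by rewrite /f' g2 snd16_pair.
have f1 : f oct1 = oct1 by rewrite /f g1 fst16_pair.
(* Triality: g maps the vector (0, w) to some (r, h(w)) with f'(w x) = h(w)
   f(x). Taking x = 1, then w = 1, gives h = f' = f. *)
have f'M w x : f' (oct_mul w x) = oct_mul (f' w) (f x).
  have [z zE] := tw (vec9 0 w).
  have E y : f' (oct_mul w y) = oct_mul (oct9 z) (f y).
    have := congr1 (mulmx^~ (pair16 y 0)) zE.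
    rewrite /= -!mulmxA Sf !spin_mxE re9_vec oct9_vec !scaler0 !oct_mul0r.
    by rewrite scale0r !subr0 !addr0 Sf' => /pair16_inj[].
  by rewrite -{2}[w]oct_mulx1 !E f1 oct_mulx1.
have ff' x : f' x = f x by rewrite -{1}[x]oct_mul1x f'M f'1 oct_mul1x.
have fM w x : f (oct_mul w x) = oct_mul (f w) (f x).
  by rewrite -ff' f'M ff'.
have linf : linear f.
  move=> k x y; rewrite /f -fst16_linear scalemxAr -mulmxDr pair16D.
  by rewrite scaler0 addr0.
pose A := mx_of f.
have AE x : A *m x = f x by exact: mx_ofE.
exists A; last first.
  apply: mx16P => x y; rewrite diag_pairE !AE -(ff' y).
  have -> : pair16 x y = pair16 x 0 + pair16 0 y.
    by rewrite -[pair16 x 0]scale1r pair16D addr0 scaler0 add0r scale1r.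
  rewrite mulmxDr -/S Sf Sf' -[pair16 _ 0]scale1r pair16D scale1r addr0.
  by rewrite scaler0 add0r.
split; last by move=> x y; rewrite !AE.
suff AA : A^T *m A = 1%:M by have [] := mulmx1_unit AA.
apply: mulmx_colP => x; apply: dot_inj => y.
rewrite -mulmxA mul1mx -dot_mul !AE.
have dp (u w : 'cV[R]_8) : dot u w = dot (pair16 u 0) (pair16 w 0)
  by rewrite dot_pair16 dot0r addr0.
by rewrite dp -!Sf dot_mul mulmxA SS mul1mx -dp.
Qed.

Implicit Types A : 'M[R]_8.

Lemma G2_oct1 A : G2 A -> A *m oct1 = oct1.
Proof.
move=> [Au AM]; have := AM oct1 (invmx A *m oct1).
by rewrite oct_mul1x mulmxA mulmxV // mul1mx oct_mulx1.
Qed.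

(** The square of x is a negative multiple of 1 exactly when x is imaginary, so
    automorphisms preserve the imaginary octonions and their norm. *)
Lemma G2_imag A x : G2 A -> x 0 0 = 0 ->
  (A *m x) 0 0 = 0 /\ dot (A *m x) (A *m x) = dot x x.
Proof.
move=> GA x0; have [Au AM] := GA; have A1 := G2_oct1 GA.
have := AM x x; rewrite !oct_sqr x0 mulr0 scale0r sub0r mulmxN -scalemxAr A1.
set r := (A *m x) 0 0; set k := dot (A *m x) _.
move=> /eqP; rewrite eq_sym subr_eq => /eqP; rewrite addrC -scalerBl => E.
have k0 : k - dot x x = 0.
  have /(can_inj (mulKmx Au)) : A *m ((2 * r) *: x) =
    A *m ((k - dot x x) *: oct1).
    by rewrite -!scalemxAr A1.
  by move=> /colP/(_ 0); rewrite !mxE x0 /= mulr1 mulr0 => <-.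
split; last by apply/eqP; rewrite -subr_eq0 k0.
move: E => /colP/(_ 0); rewrite k0 scale0r [LHS]mxE [RHS]mxE -/r => /eqP.
by rewrite -mulrA mulf_eq0 pnatr_eq0 /= mulf_eq0 orbb => /eqP.
Qed.

Lemma G2_dot A x y : G2 A -> dot (A *m x) (A *m y) = dot x y.
Proof.
move=> GA; have A1 := G2_oct1 GA.
have nrm (z : 'cV[R]_8) : dot (A *m z) (A *m z) = dot z z.
  have [a [u [u0 ->]]] : exists a (u : 'cV[R]_8), u 0 0 = 0 /\ z = a *: oct1 +
    u.
    exists (z 0 0), (z - z 0 0 *: oct1); split; last by rewrite addrC subrK.
    by rewrite !mxE /= mulr1 subrr.
  have [Au0 Auu] := G2_imag GA u0.
  rewrite mulmxDr -scalemxAr A1 !dotDl !dotDr Auu !dotZl !dotZr.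
  by rewrite !(dotC _ oct1) !dot_oct1l Au0 u0.
have := nrm (x + y);
  rewrite mulmxDr !dotDl !dotDr !nrm (dotC (A *m y)) (dotC y).
lra.
Qed.

(** The conjugate of x is 2 <1, x> 1 - x. *)
Lemma G2_conj A x : G2 A -> A *m oct_conj x = oct_conj (A *m x).
Proof.
move=> GA; have A1 := G2_oct1 GA.
have conjE u : oct_conj u = (2 * u 0 0) *: oct1 - u :> 'cV[R]_8.
  apply/colP => i; rewrite !mxE andbT;
    case: eqP => [->|_]; last by rewrite mulr0 sub0r.
  by rewrite mulr1; ring.
have A0 : (A *m x) 0 0 = x 0 0 by rewrite -!dot_oct1l -{1}A1 G2_dot.
by rewrite !conjE A0 mulmxBr -scalemxAr A1.
Qed.

(** An automorphism is compatible with the product and the conjugation, hence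
    with the formula for the action of the vectors. *)
Lemma diag_pair_spin A z : G2 A ->
  diag_pair A *m spin_mx z = spin_mx (vec9 (re9 z) (A *m oct9 z)) *m
    diag_pair A.
Proof.
move=> GA; have [_ AM] := GA; apply: mx16P => x y.
rewrite -!mulmxA diag_pairE !spin_mxE diag_pairE re9_vec oct9_vec.
by rewrite mulmxDr mulmxBr !AM -!scalemxAr G2_conj.
Qed.

Lemma model_dim : (2 ^ 8 = 16 * 16)%N. Proof. by []. Qed.

(** The volume element is central, hence scalar, and orthogonal. *)
Lemma model_vol :
  exists2 e : R, e * e = 1 & blade (@model R) [set: 'I_9]%SET = e%:A.
Proof.
have [|e eE] := cliff_commutant (@model_sym R) (@model_cliff R) model_dim
  (T := blade (@model R) [set: 'I_9]%SET).
  by move=> i; rewrite (blade_full_comm (@model_cliff R)).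
exists e; last by rewrite eE scalemx1.
have := blade_orth (@model_sym R) (@model_cliff R) [set: 'I_9]%SET.
rewrite eE tr_scalar_mx -mulmxE -scalar_mxM => /matrixP/(_ 0 0).
by rewrite !mxE.
Qed.

Definition reflect k (n z : 'cV[R]_k) := z - (2 * dot n z) *: n.

Lemma dot_reflect k (n x y : 'cV[R]_k) : dot n n = 1 ->
  dot (reflect n x) (reflect n y) = dot x y.
Proof.
move=> nn; rewrite /reflect !dotDl !dotDr !dotNl !dotNr !dotZl !dotZr
  nn (dotC x n).
ring.
Qed.

Lemma reflect_orth k (n z : 'cV[R]_k) : dot n z = 0 -> reflect n z = z.
Proof. by move=> nz; rewrite /reflect nz mulr0 scale0r subr0. Qed.

Lemma reflect_sub k (x y : 'cV[R]_k) : x != y -> dot x x = dot y y ->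
  reflect (normalize (x - y)) x = y.
Proof.
move=> xy xx; have n1 : dot (normalize (x - y)) (normalize (x - y)) = 1.
  by rewrite dot_normalize // subr_eq0.
rewrite /reflect /normalize; set v := x - y; set c := (Num.sqrt _)^-1.
have vv : dot v v = 2 * dot v x.
  rewrite /v !dotDl !dotDr !dotNl !dotNr -xx (dotC y); ring.
rewrite dotZl scalerA; have -> : 2 * (c * dot v x) * c = 1.
  by apply: etrans n1; rewrite /normalize -/v -/c dotZl dotZr vv; ring.
by rewrite scale1r /v opprB addrC subrK.
Qed.

Lemma spin_mx_reflectC n z : dot n n = 1 ->
  spin_mx n *m spin_mx z = - (spin_mx (reflect n z) *m spin_mx n).
Proof.
move=> nn; have nI : spin_mx n *m spin_mx n = 1%:M by rewrite spin_mx_sq nn.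
rewrite -[LHS]mulmx1 -nI mulmxA spin_mx_reflect // -mulNmx.
by rewrite -(linear_opp spin_mx_linear) opprB.
Qed.

(** If the isometry G moves the basis vector e, then the reflection
    exchanging e and G e, composed with G, fixes e; it still fixes the
    earlier basis vectors, which are orthogonal to e and G e. A unit vector
    induces the reflection only up to the sign -1, hence the power of -1. *)
Lemma cartan_dieudonne (D : 'M[R]_16) (G : 'cV[R]_9 -> 'cV[R]_9) k :
  (forall z v, dot (G z) (G v) = dot z v) ->
  (forall z, D *m spin_mx z = spin_mx (G z) *m D) -> (k <= 9)%N ->
  exists s G', [/\ unit_vecs s, forall z v, dot (G' z) (G' v) = dot z v,
    forall z, (spin_prod s *m D) *m spin_mx z =
       (-1) ^+ size s *: (spin_mx (G' z) *m (spin_prod s *m D))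
    & forall i : 'I_9, (i < k)%N -> G' (delta_mx i 0) = delta_mx i 0].
Proof.
move=> Giso DG; elim: k => [|k IHk] k9.
  exists [::], G; split=> //= z; by rewrite !mul1mx expr0 scale1r.
have [s [G' [us G'iso sG' G'fix]]] := IHk (ltnW k9).
pose i := Ordinal k9; pose e : 'cV[R]_9 := delta_mx i 0.
have [Ge|Gne] := eqVneq (G' e) e.
  exists s, G'; split=> // j; rewrite ltnS leq_eqVlt => /orP[/eqP jk|/G'fix//].
  by have -> : j = i by apply: val_inj.
have nn : dot (normalize (G' e - e)) (normalize (G' e - e)) = 1.
  by rewrite dot_normalize // subr_eq0.
exists (normalize (G' e - e) :: s),
  (fun z => reflect (normalize (G' e - e)) (G' z)).
split.
- by move=> w; rewrite inE => /orP[/eqP->|/us].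
- by move=> z v; rewrite dot_reflect.
- move=> z /=; rewrite -!mulmxA [spin_prod s *m _]mulmxA sG' -!scalemxAr.
  set C := spin_prod s *m D; rewrite [in LHS](mulmxA _ _ C) spin_mx_reflectC //.
  by rewrite mulNmx -mulmxA exprS mulN1r scaleNr scalerN.
move=> j; rewrite ltnS leq_eqVlt => /orP[/eqP jk|jk].
  have -> : j = i by apply: val_inj.
  by rewrite reflect_sub.
have Z : dot (G' e - e) (delta_mx j 0) = 0.
  by rewrite dotDl dotNl -[X in dot (G' e) X](G'fix j jk) G'iso subrr.
by rewrite G'fix // reflect_orth // dotZl Z mulr0.
Qed.

Lemma blade_anticomm (C : 'M[R]_16) :
  (forall i, C * model i = - (model i * C)) -> forall S : {set 'I_9},
  C * blade (@model R) S = (-1) ^+ #|S| *: (blade (@model R) S * C).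
Proof.
move=> Cp S; rewrite -sum1_card /blade; elim: (index_enum _) => [|i r IH].
  by rewrite !big_nil mulr1 mul1r scale1r.
rewrite !big_cons; case: ifP => // _.
by rewrite (mulrA C) Cp mulNr -(mulrA _ C) IH -scalerAr exprS mulN1r scaleNr
  mulrA.
Qed.

(** Composed with suitable reflections, D becomes a matrix T that commutes or
    anticommutes with all generators. Nine anticommutations would make T
    anticommute with the volume element, which is a scalar, so the number of
    reflections is even and T is a scalar of square 1. *)
Lemma Spin_of_isometry (D : 'M[R]_16) (G : 'cV[R]_9 -> 'cV[R]_9) :
  D^T *m D = 1%:M -> (forall z v, dot (G z) (G v) = dot z v) ->
  (forall z, D *m spin_mx z = spin_mx (G z) *m D) ->
  exists2 g, Spin g & sigma g = D.
Proof.
move=> DD Giso DG.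
have [s [G' [us _ sG' G'fix]]] := cartan_dieudonne Giso DG (leqnn 9).
pose T := spin_prod s *m D.
have TT : T^T *m T = 1%:M.
  by rewrite trmx_mul mulmxA -[_ *m spin_prod s]mulmxA spin_prod_orth // mulmx1.
have Tp i : T * model i = (-1) ^+ size s *: (model i * T).
  by have := sG' (delta_mx i 0); rewrite G'fix.
have even_s : ~~ odd (size s).
  apply/negP => os.
  have TB : forall S, T * blade (@model R) S = (-1) ^+ #|S|
    *: (blade (@model R) S * T).
    by apply: blade_anticomm => i; rewrite Tp -signr_odd os expr1 scaleN1r.
  have [e e2 eE] := model_vol; have := TB [set: 'I_9]%SET.
  rewrite cardsT card_ord eE -scalerAr mulr1 -scalerAl mul1r scalerA.
  have -> : (-1) ^+ 9 * e = - e :> R by ring.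
  move=> /(congr1 ( *:%R e)); rewrite !scalerA mulrN e2 scale1r scaleN1r.
  move/eqP; rewrite -subr_eq0 opprK -mulr2n -scaler_nat scaler_eq0 pnatr_eq0 /=.
  move=> /eqP T0; move: TT; rewrite T0 mulmx0 => /matrixP/(_ 0 0)/eqP.
  by rewrite !mxE eq_sym oner_eq0.
have [|c cE] := cliff_commutant (@model_sym R) (@model_cliff R)
  model_dim (T := T).
  by move=> i; rewrite Tp -signr_odd (negbTE even_s) scale1r.
have c2 : c * c = 1.
  by move: TT; rewrite cE tr_scalar_mx -scalar_mxM => /matrixP/(_ 0 0);
    rewrite !mxE.
have DE : D = c *: spin_prod (rev s).
  rewrite spin_prod_rev -mul_mx_scalar -cE /T mulmxA spin_prod_orth // mul1mx.
  by [].
have ur : unit_vecs (rev s) by move=> v; rewrite mem_rev; apply: us.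
move/eqP: c2; rewrite -expr2 sqrf_eq1 => /orP[/eqP c1|/eqP c1].
  exists (vecs_mul (rev s)); first by apply: Spin_vecs; rewrite ?size_rev.
  by rewrite sigma_vecs DE c1 scale1r.
pose d (i : 'I_9) : 'cV[R]_9 := delta_mx i 0.
(* This product is -1, which shows that -1 belongs to the group. *)
pose m := [:: d 0; d 1; d 0; d 1].
have dd i : dot (d i) (d i) = 1 by rewrite dot_delta mxE !eqxx.
exists (vecs_mul (m ++ rev s)).
  apply: Spin_vecs; first by rewrite size_cat size_rev oddD (negbTE even_s).
  move=> v; rewrite mem_cat => /orP[|/ur//].
  by rewrite !inE => /or4P[] /eqP ->.
rewrite sigma_vecs spin_prod_cat DE c1 scaleN1r /= mulmx1.
have -> : spin_mx (d 1) *m (spin_mx (d 0) *m spin_mx (d 1)) = - spin_mx (d 0).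
  rewrite mulmxA spin_mx_reflect //.
  have -> : dot (d 1) (d 0) = 0 by rewrite dot_delta mxE.
  rewrite mulr0 scale0r sub0r -scaleN1r (linear_scale spin_mx_linear) scaleN1r.
  by [].
by rewrite mulmxN spin_mx_sq dd mulNmx mul1mx.
Qed.

Lemma G2_Spin A : G2 A -> exists2 g, Spin g & sigma g = diag_pair A.
Proof.
move=> GA; apply: (Spin_of_isometry (G := fun z => vec9 (re9 z) (A *m oct9 z))).
- apply: mulmx_colP => u; apply: dot_inj => v.
  rewrite -mulmxA mul1mx -dot_mul -[u]pair16K -[v]pair16K !diag_pairE
    !dot_pair16.
  by rewrite !G2_dot.
- by move=> x y; rewrite !dot9E !re9_vec !oct9_vec G2_dot.
by move=> z; apply: diag_pair_spin.
Qed.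

End SpinModel.

(** * Transitivity *)

Section Transport.
Context {R : realType}.
Implicit Types (z : 'cV[R]_9) (w x y : 'cV[R]_8) (u v : 'cV[R]_16).

(** The octonionic Hopf map, as hopf_pair shows. *)
Definition hopf u : 'cV[R]_9 := \col_i dot (model i *m u) u.

Lemma hopfE u z : dot (spin_mx z *m u) u = dot z (hopf u).
Proof.
rewrite spin_mxS mulmx_suml dotC dot_sumr; apply: eq_bigr => i _.
by rewrite -scalemxAl dotZr mxE dotC.
Qed.

Lemma hopf_pair x y : hopf (pair16 x y) =
  vec9 (dot x x - dot y y) (2 *: oct_mul y (oct_conj x)).
Proof.
apply: dot_inj => z; rewrite -hopfE spin_mxE dot_pair16 dot9E re9_vec oct9_vec.
rewrite !dotDl dotNl !dotZl dotZr -oct_mul_adjr.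
rewrite (dotC (oct_mul (oct_conj _) _) x) -oct_mul_adj; ring.
Qed.

Lemma hopf_norm u : dot (hopf u) (hopf u) = dot u u ^+ 2.
Proof.
rewrite -[u]pair16K hopf_pair dot9E !re9_vec !oct9_vec !dot_pair16 dotZl dotZr.
rewrite oct_normM oct_conj_norm; ring.
Qed.

(** Both sides are unit vectors, and their inner product is |hopf u|^2 = 1. *)
Lemma hopf_fix u : dot u u = 1 -> spin_mx (hopf u) *m u = u.
Proof.
move=> u1; have h1 : dot (hopf u) (hopf u) = 1 by rewrite hopf_norm u1 expr1n.
apply: unit_eq => //; last by rewrite hopfE.
by rewrite dot_mul spin_mx_tr mulmxA spin_mx_sq h1 mul1mx.
Qed.

Lemma spin_mx_norm z u :
  dot (spin_mx z *m u) (spin_mx z *m u) = dot z z * dot u u.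
Proof. by rewrite dot_mul spin_mx_tr mulmxA spin_mx_sq mul_scalar_mx dotZr. Qed.

Lemma spin_octE w x y : spin_mx (vec9 0 w) *m pair16 x y =
  pair16 (oct_mul (oct_conj w) y) (oct_mul w x).
Proof. by rewrite spin_mxE re9_vec oct9_vec !scale0r add0r subr0. Qed.

Lemma spin_oct_fst w x :
  spin_mx (vec9 0 w) *m pair16 x 0 = pair16 0 (oct_mul w x).
Proof. by rewrite spin_octE oct_mul0r. Qed.

Lemma spin_oct_snd w y :
  spin_mx (vec9 0 w) *m pair16 0 y = pair16 (oct_mul (oct_conj w) y) 0.
Proof. by rewrite spin_octE oct_mul0r. Qed.

Lemma dot_vec9 r w : dot (vec9 r w) (vec9 r w) = r ^+ 2 + dot w w.
Proof. by rewrite dot9E re9_vec oct9_vec expr2. Qed.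

(** The vector zeta carries the fibre over the pole to another fibre; the
    octonion u is the prescribed value in the first factor, and a is a square
    root of the octonion that compares both values. The imaginary unit b,
    orthogonal to a, makes the last four factors distinguish the two copies
    of O. *)
Definition mover (zeta : 'cV[R]_9) (u a b : 'cV[R]_8) : seq 'cV[R]_9 :=
  [:: zeta; e0; vec9 0 oct1; vec9 0 u; vec9 0 a; vec9 0 b;
      vec9 0 (oct_mul (oct_conj a) b); vec9 0 oct1].

Lemma mover_unit zeta (u a b : 'cV[R]_8) :
  dot zeta zeta = 1 -> dot u u = 1 -> dot a a = 1 -> dot b b = 1 ->
  unit_vecs (mover zeta u a b).
Proof.
move=> z1 u1 a1 b1 v; rewrite !inE.
have o w : dot w w = 1 -> dot (vec9 0 w) (vec9 0 w) = 1.
  by move=> w1; rewrite dot_vec9 w1 expr0n add0r.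
have c1 : dot (oct_mul (oct_conj a) b) (oct_mul (oct_conj a) b) = 1.
  by rewrite oct_normM oct_conj_norm a1 b1 mulr1.
by do ![case/orP] => /eqP ->; rewrite ?dot_e0 ?o ?dot_oct1.
Qed.

Lemma mover_act zeta (u a b : 'cV[R]_8) (W : 'cV[R]_16) :
  spin_prod (mover zeta u a b) *m W = spin_mx zeta *m (spin_mx e0 *m
    (spin_mx (vec9 0 oct1) *m (spin_mx (vec9 0 u) *m (spin_mx (vec9 0 a) *m
    (spin_mx (vec9 0 b) *m (spin_mx (vec9 0 (oct_mul (oct_conj a) b)) *m
    (spin_mx (vec9 0 oct1) *m W))))))).
Proof. by rewrite /= mulmx1 -!mulmxA. Qed.

(** With c = conj(a) b, the last four factors send 1 to conj(a) (b conj(c))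
    in the first copy of O and to a (conj(b) c) in the second; as b is
    imaginary and orthogonal to a, both b conj(c) and conj(b) c are equal to
    a. The two factors before them move (1, 0) to (u, 0), and e0 only changes
    a sign. *)
Lemma mover_poles zeta (u a b : 'cV[R]_8) :
  dot a a = 1 -> dot b b = 1 -> b 0 0 = 0 -> dot a b = 0 ->
  spin_prod (mover zeta u a b) *m pair16 oct1 0 = spin_mx zeta *m pair16 u 0 /\
  spin_prod (mover zeta u a b) *m pair16 0 oct1 =
    spin_mx zeta *m pair16 0 (- oct_mul (oct_conj u) (oct_mul a a)).
Proof.
move=> a1 b1 b0 ab.
have bca : oct_mul b (oct_conj (oct_mul (oct_conj a) b)) = a.
  by rewrite oct_conjM oct_conjK oct_mul_conjK b1 scale1r.
have bca' : oct_mul (oct_conj b) (oct_mul (oct_conj a) b) = a.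
  by rewrite (oct_conj_comm b0 ab) oct_conj_mulK b1 scale1r.
have aca : oct_mul (oct_conj a) a = oct1.
  by have := oct_conj_mulK a oct1; rewrite oct_mulx1 a1 scale1r.
split; rewrite mover_act.
  rewrite (spin_oct_fst oct1) (oct_mulx1 oct1) (spin_oct_snd _ oct1) oct_mulx1.
  rewrite (spin_oct_fst b) bca (spin_oct_snd a) aca (spin_oct_fst u)
    (oct_mulx1 u).
  by rewrite (spin_oct_snd oct1) oct_conj1 oct_mul1x spin_e0E oppr0.
rewrite (spin_oct_snd oct1) oct_conj1 (oct_mulx1 oct1) (spin_oct_fst _ oct1)
  oct_mulx1.
rewrite (spin_oct_snd b) bca' (spin_oct_fst a) (spin_oct_snd u)
  (spin_oct_fst oct1).
by rewrite oct_mul1x spin_e0E.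
Qed.

Section Mover.
Variables (zeta z : 'cV[R]_9) (U V : 'cV[R]_16).
Hypothesis z1 : dot zeta zeta = 1.
(* conjugation by zeta maps e0 to z *)
Hypothesis zz : spin_mx z *m spin_mx zeta *m spin_mx e0 = spin_mx zeta.
Hypotheses (zU : spin_mx z *m U = U) (zV : spin_mx z *m V = - V).
Hypotheses (U1 : dot U U = 1) (V1 : dot V V = 1).

Let u := fst16 (spin_mx zeta *m U).
Let w := snd16 (spin_mx zeta *m V).
Let v := oct_mul u (- w).

Let zzT : spin_mx e0 *m spin_mx zeta *m spin_mx z = spin_mx zeta.
Proof. by have := congr1 trmx zz; rewrite !trmx_mul !spin_mx_tr mulmxA. Qed.

Let UE : spin_mx zeta *m U = pair16 u 0.
Proof.
have E : spin_mx e0 *m (spin_mx zeta *m U) = spin_mx zeta *m U.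
  by rewrite mulmxA -{1}zU mulmxA zzT.
rewrite -[LHS]pair16K -/u; congr pair16; apply: two_inj.
by move: E; rewrite -{1}[_ *m U]pair16K spin_e0E => {1}<-; rewrite snd16_pair.
Qed.

Let VE : spin_mx zeta *m V = pair16 0 w.
Proof.
have E : spin_mx e0 *m (spin_mx zeta *m V) = - (spin_mx zeta *m V).
  by rewrite mulmxA -{1}[V]opprK -zV mulmxN mulmxA zzT.
rewrite -[LHS]pair16K; congr pair16; apply: two_inj.
move: E; rewrite -{1}[_ *m V]pair16K spin_e0E => E.
have := congr1 (@fst16 R) E; rewrite fst16_pair => {1}->.
by rewrite (linear_opp fst16_linear).
Qed.

Let u1 : dot u u = 1.
Proof.
have := spin_mx_norm zeta U; rewrite UE dot_pair16 dot0r addr0 => ->.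
by rewrite z1 U1 mulr1.
Qed.

Lemma mover_norm : dot v v = 1.
Proof.
have := spin_mx_norm zeta V; rewrite VE dot_pair16 dot0r add0r => w1.
by rewrite /v oct_normM u1 dotNr dotNl opprK w1 z1 V1 !mulr1.
Qed.

Lemma mover_spec (a b : 'cV[R]_8) :
  dot a a = 1 -> dot b b = 1 -> b 0 0 = 0 -> dot a b = 0 -> oct_mul a a = v ->
  [/\ unit_vecs (mover zeta u a b),
      spin_prod (mover zeta u a b) *m pair16 oct1 0 = U
    & spin_prod (mover zeta u a b) *m pair16 0 oct1 = V].
Proof.
move=> a1 b1 b0 ab aa.
have zetaK (W : 'cV[R]_16) : spin_mx zeta *m (spin_mx zeta *m W) = W.
  by rewrite mulmxA spin_mx_sq z1 mul1mx.
have [-> ->] := mover_poles zeta u a1 b1 b0 ab.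
split; [exact: mover_unit|by rewrite -UE zetaK|].
by rewrite aa /v oct_conj_mulK u1 scale1r opprK -VE zetaK.
Qed.

End Mover.

(** For a unit octonion v, the square of 1 + v is 2 Re(1 + v) v, and 2 Re(1 +
    v) is |1 + v|^2. *)
Lemma oct_sqrt_normalize (v : 'cV[R]_8) : dot v v = 1 -> oct1 + v != 0 ->
  oct_mul (normalize (oct1 + v)) (normalize (oct1 + v)) = v.
Proof.
move=> v1 n0; have n1 := dot_normalize n0.
move: n1; rewrite /normalize; set c := (Num.sqrt _)^-1;
  rewrite dotZl dotZr => n1.
have nE : dot (oct1 + v) (oct1 + v) = 2 * (oct1 + v) 0 0.
  rewrite !dotDl !dotDr (dotC v oct1) dot_oct1 v1 dot_oct1l !mxE /=; ring.
rewrite oct_mulZl oct_mulZr oct_sqr -nE -scalerBr !scalerA [oct1 + v]addrC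
  addrK.
by rewrite addrC -mulrA n1 scale1r.
Qed.

(** An imaginary octonion orthogonal to v, linear in v and thus smooth, but
    zero on a subspace. *)
Definition oct_perp (v : 'cV[R]_8) : 'cV[R]_8 :=
  v (inord 2) 0 *: delta_mx (inord 1) 0 - v (inord 1) 0 *: delta_mx (inord 2) 0.

Let imag_unit k : (0 < k < 8)%N -> (delta_mx (inord k) 0 : 'cV[R]_8) 0 0 = 0.
Proof.
by case/andP=> k0 k8; rewrite mxE -val_eqE /= inordK // andbT ltn_eqF.
Qed.

Lemma oct_perp_re (v : 'cV[R]_8) : oct_perp v 0 0 = 0.
Proof. by rewrite !mxE -!val_eqE /= !inordK //= !mulr0 subr0. Qed.

Lemma dot_oct_perp (v : 'cV[R]_8) : dot v (oct_perp v) = 0.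
Proof.
rewrite dotDr dotNr !dotZr !(dotC v) !dot_delta; ring.
Qed.

Lemma dot_delta2 (i j : 'I_8) :
  dot (delta_mx i 0 : 'cV[R]_8) (delta_mx j 0) = (i == j)%:R.
Proof. by rewrite dot_delta mxE andbT. Qed.

(** The normalised 1 + v and oct_perp v will do, except where they vanish;
    there, two orthogonal imaginary units or an imaginary unit orthogonal to
    v replace them. *)
Lemma oct_sqrt_perp (v : 'cV[R]_8) : dot v v = 1 -> exists a b : 'cV[R]_8,
  [/\ dot a a = 1, dot b b = 1, b 0 0 = 0, dot a b = 0 & oct_mul a a = v].
Proof.
move=> v1; have [v0|vn] := eqVneq (oct1 + v) 0.
  exists (delta_mx (inord 1) 0), (delta_mx (inord 2) 0).
  rewrite !dot_delta2 !eqxx !imag_unit //; split=> //.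
    by rewrite -val_eqE /= !inordK.
  rewrite oct_sqr imag_unit // mulr0 scale0r sub0r dot_delta2 eqxx scale1r.
  by apply/esym/eqP; rewrite -addr_eq0 addrC v0.
exists (normalize (oct1 + v)).
have ab (b : 'cV[R]_8) : b 0 0 = 0 -> dot v b = 0 ->
  dot (normalize (oct1 + v)) b = 0.
  move=> b0 vb; rewrite dotZl (dotDl b) dot_oct1l.
  by rewrite b0 vb addr0 mulr0.
have [p0|pn] := eqVneq (oct_perp v) 0.
  exists (delta_mx (inord 1) 0); split.
  - exact: dot_normalize.
  - by rewrite dot_delta2 eqxx.
  - exact: imag_unit.
  - apply: ab; first exact: imag_unit.
    rewrite dotC dot_delta; move: p0 => /colP/(_ (inord 2)).
    rewrite !mxE -!val_eqE /= !inordK //= mulr0 mulr1 sub0r => /eqP.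
    by rewrite oppr_eq0 => /eqP.
  - exact: oct_sqrt_normalize.
exists (normalize (oct_perp v)); split.
- exact: dot_normalize.
- exact: dot_normalize.
- by rewrite /normalize mxE oct_perp_re mulr0.
- by apply: ab; rewrite ?dotZr ?dot_oct_perp ?mulr0 // mxE oct_perp_re mulr0.
- exact: oct_sqrt_normalize.
Qed.

(** Since z and e0 are involutions, z (z + e0) e0 = e0 + z. *)
Lemma pole_mover z : dot z z = 1 ->
  spin_mx z *m spin_mx (normalize (z + e0)) *m spin_mx e0 =
    spin_mx (normalize (z + e0)).
Proof.
move=> z1; rewrite !(linear_scale spin_mx_linear) !(linear_add spin_mx_linear).
rewrite -scalemxAr -scalemxAl mulmxDr mulmxDl spin_mx_sq z1 mul1mx -mulmxA
  spin_mx_sq.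
by rewrite dot_e0 mulmx1 [spin_mx e0 + _]addrC.
Qed.

Lemma pole_mover_exists z : dot z z = 1 -> exists2 zeta, dot zeta zeta = 1 &
  spin_mx z *m spin_mx zeta *m spin_mx e0 = spin_mx zeta.
Proof.
move=> z1; have [z0|zn] := eqVneq (z + e0) 0; last first.
  by exists (normalize (z + e0)); [exact: dot_normalize|exact: pole_mover].
have -> : z = - e0 by apply/eqP; rewrite -addr_eq0 z0.
exists (vec9 0 oct1); first by rewrite dot_vec9 dot_oct1 expr0n add0r.
rewrite (linear_opp spin_mx_linear) !mulNmx spin_mx_reflect ?dot_e0 //.
rewrite dot9E re9_e0 oct9_e0 re9_vec oct9_vec dot0l mulr0 addr0 mulr0 scale0r
  sub0r.
by rewrite (linear_opp spin_mx_linear) opprK.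
Qed.

Lemma Spin_transitive (U V : 'cV[R]_16) :
  dot U U = 1 -> dot V V = 1 -> hopf U = - hopf V ->
  exists g,
    [/\ Spin g, sigma g *m pair16 oct1 0 = U & sigma g *m pair16 0 oct1 = V].
Proof.
move=> U1 V1 UV.
have z1 : dot (hopf U) (hopf U) = 1 by rewrite hopf_norm U1 expr1n.
have zU := hopf_fix U1.
have zV : spin_mx (hopf U) *m V = - V.
  by rewrite UV (linear_opp spin_mx_linear) mulNmx hopf_fix.
have [zeta zeta1 zz] := pole_mover_exists z1.
have v1 := mover_norm zeta1 zz zU zV U1 V1.
have [a [b [a1 b1 b0 ab aa]]] := oct_sqrt_perp v1.
have [us sU sV] := mover_spec zeta1 zz zU zV U1 a1 b1 b0 ab aa.
by eexists; split;
  [exact: (Spin_vecs _ us)|rewrite sigma_vecs; exact: sU|rewrite sigma_vecs;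
  exact: sV].
Qed.

End Transport.

(** * Smooth local sections *)

Section SmoothMover.
Context {R : realType} {T : normedModType R}.
Variable D : set T.
Hypothesis oD : open D.

Lemma smooth_dot k (f g : T -> 'cV[R]_k) :
  smooth_on D f -> smooth_on D g -> smooth_on D (fun t => dot (f t) (g t)).
Proof.
move=> fD gD; apply: smooth_sum => // i _;
  apply: smoothM => //; exact: smooth_coord.
Qed.

Lemma smooth_normalize k (f : T -> 'cV[R]_k) :
  (forall t, D t -> f t != 0) -> smooth_on D f ->
    smooth_on D (fun t => normalize (f t)).
Proof.
move=> f0 fD;
  apply: smoothZ => //; apply: smooth_invsqrt => //; last exact: smooth_dot.
by move=> t /f0; rewrite dot_gt0.
Qed.

Lemma smooth_hopf (f : T -> 'cV[R]_16) :
  smooth_on D f -> smooth_on D (fun t => hopf (f t)).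
Proof.
move=> fD; apply: smooth_coords => // i j; under eq_fun do rewrite mxE.
apply: smooth_dot => //; apply: (smooth_mx_linear (L := mulmx (model i))) => //.
by move=> k x y; rewrite mulmxDr scalemxAr.
Qed.

Lemma smooth_mulmx m n p (f : T -> 'M[R]_(m, n)) (g : T -> 'M[R]_(n, p)) :
  smooth_on D f -> smooth_on D g -> smooth_on D (fun t => f t *m g t).
Proof.
apply: smooth_mx_bilinear => // [y k a b|x k a b];
  first by rewrite mulmxDl scalemxAl.
by rewrite mulmxDr scalemxAr.
Qed.

Lemma vec9_linear : linear (vec9 0 : 'cV[R]_8 -> 'cV[R]_9).
Proof.
move=> k x y; apply/colP => i; rewrite !mxE;
  case: unlift => [j|]; rewrite ?mxE //.
by rewrite mulr0 addr0.
Qed.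

Lemma oct_perp_linear : linear (@oct_perp R).
Proof. by move=> k x y; apply/colP => i; rewrite !mxE; ring. Qed.

Lemma smooth_cl_vec (f : T -> 'cV[R]_9) b : smooth_on D f -> smooth_on D b ->
  smooth_on D (fun t => cl_mul (cl_vec (f t)) (b t)).
Proof.
move=> fD bD; apply: (smooth_mx_bilinear (B := @cl_mul R 9)) => //.
- exact: cl_mul_linearl.
- exact: cl_mul_linearr.
exact: (smooth_mx_linear oD (@cl_vec_linear R 9)).
Qed.

(** A product of vectors is multilinear in them, and their entries are
    bilinear in the data. *)
Lemma smooth_mover (zeta : T -> 'cV[R]_9) (u a b : T -> 'cV[R]_8) :
  smooth_on D zeta -> smooth_on D u -> smooth_on D a -> smooth_on D b ->
  smooth_on D (fun t => vecs_mul (mover (zeta t) (u t) (a t) (b t))).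
Proof.
move=> zD uD aD bD; have vD w : smooth_on D w ->
  smooth_on D (fun t => vec9 0 (w t)).
  exact: (smooth_mx_linear oD vec9_linear).
do !apply: smooth_cl_vec; rewrite //; try exact: vD; try exact: smooth_cst.
apply: vD;
  apply: smooth_mx_bilinear =>
  //; [exact: oct_mul_linearl|exact: oct_mul_linearr|].
exact: (smooth_mx_linear oD oct_conj_linear).
Qed.

End SmoothMover.

Section LocalSection.
Context {R : realType}.
Implicit Types U V : 'cV[R]_16.

Definition sec_zeta U := normalize (hopf U + e0).
Definition sec_u U := fst16 (spin_mx (sec_zeta U) *m U).
Definition sec_v U V := oct_mul (sec_u U) (- snd16 (spin_mx (sec_zeta U) *m V)).

(** The product of vectors in the proof of transitivity, with the choices
    that depend smoothly on the pair (U, V). *)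
Definition sec U V : Cl R 9 :=
  vecs_mul (mover (sec_zeta U) (sec_u U) (normalize (oct1 + sec_v U V))
                  (normalize (oct_perp (sec_v U V)))).

Definition sec_dom U V :=
  [/\ hopf U + e0 != 0, oct1 + sec_v U V != 0 & oct_perp (sec_v U V) != 0].

Lemma sec_spec U V :
  dot U U = 1 -> dot V V = 1 -> hopf U = - hopf V -> sec_dom U V ->
  [/\ Spin (sec U V), sigma (sec U V) *m pair16 oct1 0 = U
    & sigma (sec U V) *m pair16 0 oct1 = V].
Proof.
move=> U1 V1 UV [n1 n2 n3].
have z1 : dot (hopf U) (hopf U) = 1 by rewrite hopf_norm U1 expr1n.
have zU := hopf_fix U1.
have zV : spin_mx (hopf U) *m V = - V.
  by rewrite UV (linear_opp spin_mx_linear) mulNmx hopf_fix.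
have zeta1 : dot (sec_zeta U) (sec_zeta U) = 1 by apply: dot_normalize.
have zz := pole_mover z1.
have v1 : dot (sec_v U V) (sec_v U V) = 1 := mover_norm zeta1 zz zU zV U1 V1.
have p0 : normalize (oct_perp (sec_v U V)) 0 0 = 0 by rewrite /normalize mxE
  oct_perp_re mulr0.
have ap : dot (normalize (oct1 + sec_v U V)) (normalize (oct_perp (sec_v U V)))
  = 0.
  by rewrite dotZl (dotDl (normalize _)) dot_oct1l p0 dotZr dot_oct_perp mulr0
    addr0 mulr0.
have [us sU sV] := mover_spec zeta1 zz zU zV U1 (dot_normalize n2)
  (dot_normalize n3)
  p0 ap (oct_sqrt_normalize v1 n2).
by split; [exact: Spin_vecs|rewrite sigma_vecs|rewrite sigma_vecs].
Qed.

(** The domain is cut out by the positivity of three smooth norms, each of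
    which is defined where the previous ones are positive. *)
Lemma smooth_sec (T : normedModType R) (D : set T) (U V : T -> 'cV[R]_16) t0 :
  open D -> smooth_on D U -> smooth_on D V -> D t0 -> sec_dom (U t0) (V t0) ->
  exists D', [/\ open D', D' t0, (forall t, D' t -> sec_dom (U t) (V t))
    & smooth_on D' (fun t => sec (U t) (V t))].
Proof.
move=> oD UD VD Dt0 [n1 n2 n3].
pose f1 t := dot (hopf (U t) + e0) (hopf (U t) + e0).
have s1 : smooth_on D (fun t => hopf (U t) + e0).
  by apply: smoothD => //; [exact: smooth_hopf|exact: smooth_cst].
pose D1 := D `&` [set t | 0 < f1 t].
have oD1 : open D1 by apply: open_smooth_gt0 => //; apply: smooth_dot.
have D1D : D1 `<=` D by move=> t [].
have sz : smooth_on D1 (fun t => sec_zeta (U t)).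
  apply: smooth_normalize => // [t [_]|]; first by rewrite /f1 /= dot_gt0.
  exact: smooth_onS s1.
have sm W : smooth_on D W ->
  smooth_on D1 (fun t => spin_mx (sec_zeta (U t)) *m W t).
  move=> WD; apply: smooth_mulmx => //; last exact: smooth_onS WD.
  exact: (smooth_mx_linear oD1 spin_mx_linear).
have su : smooth_on D1 (fun t => sec_u (U t)).
  apply: (smooth_mx_linear (L := @fst16 R)) => //; first exact: fst16_linear.
  exact: sm.
have sv : smooth_on D1 (fun t => sec_v (U t) (V t)).
  apply: (smooth_mx_bilinear (B := @oct_mul R)) => //.
  - exact: oct_mul_linearl.
  - exact: oct_mul_linearr.
  apply: (smooth_mx_linear (L := fun w => - snd16 w)) => //; last exact: sm.
  by move=> k x y; rewrite snd16_linear opprD scalerN.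
have sa : smooth_on D1 (fun t => oct1 + sec_v (U t) (V t)).
  by apply: smoothD => //; exact: smooth_cst.
have sb : smooth_on D1 (fun t => oct_perp (sec_v (U t) (V t))).
  exact: (smooth_mx_linear oD1 oct_perp_linear sv).
pose D2 :=
  D1 `&` [set t | 0 < dot (oct1 + sec_v (U t) (V t))
  (oct1 + sec_v (U t) (V t))].
have oD2 : open D2 by apply: open_smooth_gt0 => //; apply: smooth_dot.
have D21 : D2 `<=` D1 by move=> t [].
pose D3 :=
  D2 `&` [set t | 0 < dot (oct_perp (sec_v (U t) (V t)))
  (oct_perp (sec_v (U t) (V t)))].
have oD3 : open D3.
  by apply: open_smooth_gt0 => //; apply: smooth_dot => //; apply: smooth_onS
    sb.
have D32 : D3 `<=` D2 by move=> t [].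
have D31 : D3 `<=` D1 by move=> t /D32/D21.
have D3d t : D3 t -> sec_dom (U t) (V t).
  by move=> [[[_]]]; rewrite /= !dot_gt0.
exists D3; split=> //.
  by split; [split; [split|]|]; rewrite //= ?dot_gt0.
apply: smooth_mover => //.
- exact: smooth_onS sz.
- exact: smooth_onS su.
- apply: smooth_normalize => // [t /D3d[]//|]; exact: smooth_onS sa.
- apply: smooth_normalize => // [t /D3d[]//|]; exact: smooth_onS sb.
Qed.

(** Over the pole zeta is the pole itself, and for this pair the octonion to
    be squared is the imaginary unit in coordinate 1, whose oct_perp is not
    zero. *)
Lemma sec_dom_point : sec_dom (pair16 oct1 0) (pair16 0 (delta_mx (inord 1) 0)).
Proof.
have hE : hopf (pair16 oct1 0) = e0 :> 'cV[R]_9.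
  rewrite hopf_pair oct_mul0l dot0r dot_oct1 scaler0 subr0 e0E //.
have zE : sec_zeta (pair16 oct1 0) = e0.
  rewrite /sec_zeta hE /normalize.
  have -> : dot (e0 + e0) (e0 + e0) = 2 ^+ 2 :> R.
    by rewrite !dotDl !dotDr dot_e0; ring.
  rewrite sqrtr_sqr ger0_norm ?ler0n //.
  have -> : e0 + e0 = 2 *: e0 :> 'cV[R]_9 by rewrite scaler_nat mulr2n.
  by rewrite scalerA mulVf ?scale1r // pnatr_eq0.
have vE : sec_v (pair16 oct1 0) (pair16 0 (delta_mx (inord 1) 0)) =
  delta_mx (inord 1) 0.
  rewrite /sec_v /sec_u zE !spin_e0E fst16_pair snd16_pair opprK oct_mul1x.
  by [].
split; rewrite ?hE ?vE.
- by rewrite -dot_gt0 !dotDl !dotDr dot_e0; lra.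
- apply/eqP => /colP/(_ 0) /eqP.
  by rewrite !mxE -!val_eqE /= inordK //= addr0 oner_eq0.
- apply/eqP => /colP/(_ (inord 2)) /eqP.
  by rewrite !mxE -!val_eqE /= !inordK //= mulr0 mul1r sub0r oppr_eq0 oner_eq0.
Qed.

End LocalSection.

(** * The subgroup G_2 of the spin group *)

Section SpinG2.
Context {R : realType}.
Implicit Types (g h : Cl R 9) (A B : 'M[R]_8) (x y : 'cV[R]_8).

(** The linear extension to the whole algebra of the map from the isotropy
    group to the automorphisms of the octonions; iso_lift is the linear
    inverse. *)
Definition iso_mx (g : Cl R 9) :
  'M[R]_8 := mx_of (fun x => fst16 (sigma g *m pair16 x 0)).

Lemma sigma_linear : linear (sigma : Cl R 9 -> 'M[R]_16).
Proof. exact: cl_rep_linear. Qed.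

Lemma iso_mx_linear : linear iso_mx.
Proof.
have E g i j : iso_mx g i j = fst16 (sigma g *m pair16 (delta_mx j 0) 0) i 0.
  by rewrite mxE.
move=> k g h; apply/matrixP => i j.
have -> : (k *: iso_mx g + iso_mx h) i j = k * iso_mx g i j + iso_mx h i j.
  by rewrite mxE; congr (_ + _); rewrite mxE.
rewrite !E sigma_linear mulmxDl -scalemxAl fst16_linear.
by rewrite [LHS]mxE; congr (_ + _); rewrite mxE.
Qed.

Lemma iso_mxE g A : sigma g = diag_pair A -> iso_mx g = A.
Proof.
move=> gA; apply/matrixP => i j; rewrite mxE gA diag_pairE mulmx0 fst16_pair.
by rewrite -colE mxE.
Qed.

Lemma diag_pair_linear : linear (@diag_pair R).
Proof.
move=> k A B; apply: mx16P => x y;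
  rewrite mulmxDl -scalemxAl !diag_pairE pair16D.
by rewrite !mulmxDl !scalemxAl.
Qed.

Lemma diag_pairM A B :
  diag_pair (A *m B) = diag_pair A *m diag_pair B :> 'M[R]_16.
Proof. by apply: mx16P => x y; rewrite -mulmxA !diag_pairE !mulmxA. Qed.

Definition iso_lift (A : 'M[R]_8) : Cl R 9 := cl_of_mx (@model R) (diag_pair A).

Lemma sigma_iso_lift A : sigma (iso_lift A) = diag_pair A.
Proof. exact: (cl_of_mxKV (@model_sym R) (@model_cliff R) model_dim). Qed.

(** The isotropy group, described by conditions from which its closedness can
    be read off, unlike products of vectors. *)
Definition spinG2 : set (Cl R 9) :=
  [set g | cl_even g /\ exists2 A, G2 A & sigma g = diag_pair A].

Lemma spinG2_lie : lie_isomorphic (@cl_mul R 9) spinG2 mulmx (@G2 R).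
Proof.
exists iso_mx, iso_lift; split.
- split=> [g [_ [A GA /iso_mxE ->]]//|A GA].
  split; first exact: cl_of_mx_even.
  by exists A; rewrite ?sigma_iso_lift.
- split=> [g [ge [A GA gA]]|A _]; last exact/iso_mxE/sigma_iso_lift.
  rewrite (iso_mxE gA); apply: sigma_inj => //; first exact: cl_of_mx_even.
  by rewrite sigma_iso_lift.
- move=> g h [_ [A _ gA]] [_ [B _ hB]].
  rewrite (iso_mxE gA) (iso_mxE hB); apply: iso_mxE.
  by rewrite sigma_mul gA hB diag_pairM.
split; apply: smooth_map_on.
  exact: (smooth_mx_linear openT iso_mx_linear (smooth_id openT)).
have linl : linear iso_lift.
  by move=> k A B; rewrite /iso_lift diag_pair_linear cl_of_mx_linear.
exact: (smooth_mx_linear openT linl (smooth_id openT)).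
Qed.

(** Orthogonality replaces invertibility, which is not a closed condition. *)
Lemma G2P A : G2 A <-> A^T *m A = 1%:M /\
  forall x y, A *m oct_mul x y - oct_mul (A *m x) (A *m y) = 0.
Proof.
split=> [GA|[AA AM]].
  split; last by case: GA => _ AM x y; rewrite AM subrr.
  apply: mulmx_colP => x; apply: dot_inj => y.
  by rewrite -mulmxA mul1mx -dot_mul G2_dot.
split; first by have [] := mulmx1_unit AA.
by move=> x y; apply/eqP; rewrite -subr_eq0 AM.
Qed.

Lemma closed_zeros (T : normedModType R) m n (F : T -> 'M[R]_(m, n)) :
  smooth_on setT F -> closed [set x | F x = 0].
Proof.
move=> FT.
have -> : [set x | F x = 0] = F @^-1` [set 0] by [].
apply: preimage_closed; last first.
  exact/accessible_closed_set1/hausdorff_accessible/norm_hausdorff.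
by move=> x _; apply/differentiable_continuous/(smooth_on_differentiable FT).
Qed.

(** The group is the common zero set of polynomial maps. *)
Lemma spinG2_closed : closed spinG2.
Proof.
have lin (T : normedModType R) (L : Cl R 9 -> T) : linear L -> smooth_on setT L.
  by move=> linL; exact: (smooth_mx_linear openT linL (smooth_id openT)).
pose F1 := \bigcap_(S in [set S : {set 'I_9} | odd #|S|])
  [set g : Cl R 9 | row (enum_rank S) g = 0].
pose F2 := [set g | (iso_mx g)^T *m iso_mx g - 1%:M = 0].
pose F3 := \bigcap_(q in [set: 'cV[R]_8 * 'cV[R]_8])
  [set g | iso_mx g *m oct_mul q.1 q.2 - oct_mul (iso_mx g *m q.1)
    (iso_mx g *m q.2) = 0].
pose F4 := [set g | sigma g - diag_pair (iso_mx g) = 0].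
have -> : spinG2 = F1 `&` F2 `&` F3 `&` F4.
  apply/seteqP; split=> g.
    move=> [ge [A GA gA]]; have /G2P[AA AM] := GA.
    split; [split; [split|]|].
    - move=> S /= /ge gS; apply/rowP => i; rewrite !mxE (ord1 i); exact: gS.
    - by rewrite /F2 /= (iso_mxE gA) AA subrr.
    - by move=> [x y] _ /=; rewrite (iso_mxE gA).
    - by rewrite /F4 /= (iso_mxE gA) gA subrr.
  move=> [[[g1 /eqP g2] g3] /eqP g4]; split.
    by move=> S So; have := g1 S So => /rowP/(_ 0); rewrite !mxE.
  exists (iso_mx g); last by apply/eqP; rewrite -subr_eq0.
  apply/G2P; split; first by apply/eqP; rewrite -subr_eq0.
  by move=> x y; apply: (g3 (x, y)).
do !apply: closedI.
- apply: closed_bigI => S _; apply: closed_zeros; apply: lin => k a b.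
  by apply/rowP => i; rewrite !mxE.
- apply: closed_zeros; apply: smoothD; [exact: openT| |exact: smooth_cst].
  apply: smooth_mulmx; [exact: openT| |exact: lin iso_mx_linear].
  by apply: lin => k a b; rewrite iso_mx_linear linearD linearZ.
- apply: closed_bigI => -[x y] _; apply: closed_zeros; apply: smoothD.
  + exact: openT.
  + apply: lin => k a b; by rewrite iso_mx_linear mulmxDl scalemxAl.
  + have linx z : smooth_on setT (fun g => iso_mx g *m z).
      by apply: lin => k a b; rewrite iso_mx_linear mulmxDl scalemxAl.
    apply: (smooth_lin (L := -%R)); [exact: openT|exact: opp_continuous|].
    apply: (smooth_mx_bilinear (B := @oct_mul R)); rewrite /=;
      first exact: openT.
    * exact: oct_mul_linearl.
    * exact: oct_mul_linearr.
    * exact: linx.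
    * exact: linx.
- apply: closed_zeros; apply: lin => k a b.
  rewrite iso_mx_linear sigma_linear diag_pair_linear scalerBr addrACA opprD.
  by [].
Qed.

End SpinG2.
(** * Tangent vectors and quadratic forms *)

Section Tangent.
Context {R : realType}.

Lemma derive_dot (V : normedModType R) k (f g : V -> 'cV[R]_k) (y v : V) :
  differentiable f y -> differentiable g y ->
  'D_v (fun x => dot (f x) (g x)) y = dot ('D_v f y) (g y) +
    dot (f y) ('D_v g y).
Proof.
move=> df dg; have linc i : linear (fun w : 'cV[R]_k => w i 0 : R).
  by move=> a b c; rewrite !mxE.
have -> : (fun x => dot (f x) (g x)) =
    \sum_i ((fun x => f x i 0 : R) * (fun x => g x i 0)).
  by apply: funext => x; rewrite fct_sumE.
have cf i := derive_mx_linear v (linc i) df.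
have cg i := derive_mx_linear v (linc i) dg.
rewrite derive_sum => [|i]; last first.
  by apply: derivableM; apply: diff_derivable; [case: (cf i)|case: (cg i)].
rewrite /dot -big_split; apply: eq_bigr => i _ /=.
rewrite deriveM; last 2 first.
- by apply: diff_derivable; case: (cf i).
- by apply: diff_derivable; case: (cg i).
by rewrite (cf i).2 (cg i).2 [RHS]addrC; congr (_ + _); exact: mulrC.
Qed.

(** A tangent vector annihilates the differential of any quadratic form that is
    constant along the submanifold. *)
Lemma tangent_quadratic n (M : set 'cV[R]_n) (A : 'M[R]_n) q x v :
  A^T = A -> (forall y, M y -> dot (A *m y) y = q) -> tangent M x v ->
  dot (A *m x) v = 0.
Proof.
move=> AT Mq [c [sc c0 cM cv]].
have dc := smooth_at_differentiable sc.
have linA : linear (mulmx A : 'cV[R]_n -> 'cV[R]_n).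
  by move=> k a b; rewrite mulmxDr scalemxAr.
have [dAc DAc] := derive_mx_linear (1 : R) linA dc.
have : 'D_1 (fun t => dot (A *m c t) (c t)) 0 = 0.
  transitivity ('D_1 (cst q : R -> R) (0 : R)); last exact: derive_cst.
  by apply: near_eq_derive; apply: filterS cM => t /Mq.
rewrite derive_dot // DAc c0 cv dot_mul AT dotC -mulr2n => /eqP.
by rewrite mulrn_eq0 => /eqP.
Qed.

End Tangent.

(** * The focal submanifold *)

Section Focal.
Context {R : realType}.
Variables (P : 'I_9 -> 'M[R]_32) (X : 'I_2 -> 'M[R]_(32, 16)).
Hypothesis Psym : forall i, (P i)^T = P i.
Hypothesis Pcliff : forall i j, P i * P j + P j * P i = 2 *+ (i == j).
Hypothesis XX : forall k l, (X k)^T *m X l = (k == l)%:R%:M.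
Hypothesis sumXX : \sum_k X k *m (X k)^T = 1%:M.
Hypothesis PX : forall k i, P i *m X k = X k *m model i.
Implicit Types (u v : 'cV[R]_16) (x y : 'cV[R]_32) (g h : Cl R 9).

Definition join u v : 'cV[R]_32 := X 0 *m u + X 1 *m v.
Definition spinor k x : 'cV[R]_16 := (X k)^T *m x.

Lemma spinorK x : join (spinor 0 x) (spinor 1 x) = x.
Proof.
rewrite /join /spinor !mulmxA -mulmxDl.
have := sumXX; rewrite big_ord_recl big_ord1.
have -> : lift ord0 ord0 = 1 :> 'I_2 by apply: val_inj.
by move=> ->; rewrite mul1mx.
Qed.

Lemma spinor0_join u v : spinor 0 (join u v) = u.
Proof.
by rewrite /spinor mulmxDr !mulmxA !XX /= mul1mx raddf0 mul0mx addr0.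
Qed.

Lemma spinor1_join u v : spinor 1 (join u v) = v.
Proof.
by rewrite /spinor mulmxDr !mulmxA !XX /= mul1mx raddf0 mul0mx add0r.
Qed.

Lemma join_inj u v u' v' : join u v = join u' v' -> u = u' /\ v = v'.
Proof.
move=> E; split; first by rewrite -(spinor0_join u v) E spinor0_join.
by rewrite -(spinor1_join u v) E spinor1_join.
Qed.

Lemma dot_join u v u' v' : dot (join u v) (join u' v') = dot u u' + dot v v'.
Proof.
rewrite -[LHS]/(dot (join u v) (X 0 *m u' + X 1 *m v')) dotDr.
rewrite !(dotC (join u v)) !dot_mul -/(spinor 0 _) -/(spinor 1 _)
  spinor0_join spinor1_join.
by rewrite (dotC u') (dotC v').
Qed.

Lemma joinZ k u v : k *: join u v = join (k *: u) (k *: v).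
Proof. by rewrite /join scalerDr !scalemxAr. Qed.

Lemma P_join i u v : P i *m join u v = join (model i *m u) (model i *m v).
Proof. by rewrite /join mulmxDr !mulmxA !PX. Qed.

Definition rho : Cl R 9 -> 'M[R]_32 := cl_rep P.

Lemma rho_mul g h : rho (cl_mul g h) = rho g *m rho h.
Proof. exact: (cl_rep_mul Pcliff). Qed.

Lemma rho_one : rho (cl_one R 9) = 1%:M.
Proof. exact: cl_rep_one. Qed.

Lemma blade_X k S : blade P S *m X k = X k *m blade (@model R) S.
Proof.
rewrite /blade; elim: (index_enum _) => [|i r IH].
  by rewrite !big_nil mul1mx mulmx1.
rewrite !big_cons; case: ifP => // _.
by rewrite -!mulmxE -mulmxA IH mulmxA PX -mulmxA.
Qed.

Lemma rho_X k g : rho g *m X k = X k *m sigma g.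
Proof.
rewrite /rho /sigma /cl_rep mulmx_suml mulmx_sumr; apply: eq_bigr => S _.
by rewrite -scalemxAl blade_X scalemxAr.
Qed.

Lemma rho_join g u v : rho g *m join u v = join (sigma g *m u) (sigma g *m v).
Proof. by rewrite /join mulmxDr !mulmxA !rho_X. Qed.

Lemma focal_plusP x : focal_plus P x <->
  dot x x = 1 /\ forall i, dot (P i *m x) x = 0.
Proof.
rewrite /focal_plus /FKM_polynomial; split=> [[x1]|[x1 Px]].
  rewrite x1 expr1n => /eqP; rewrite -subr_eq0 addrAC subrr sub0r oppr_eq0.
  rewrite mulf_eq0 pnatr_eq0 /= psumr_eq0 => [/allP H|i _]; last exact: sqr_ge0.
  split=> // i; have := H i (mem_index_enum _).
  by rewrite /= sqrf_eq0 => /eqP.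
split=> //; rewrite x1 expr1n big1 ?mulr0 ?subr0 // => i _.
by rewrite Px expr0n.
Qed.

Lemma focal_join u v : focal_plus P (join u v) <->
  dot u u + dot v v = 1 /\ hopf u = - hopf v.
Proof.
rewrite focal_plusP dot_join; split=> -[uv H]; split=> //.
  apply/colP => i; have -> : (- hopf v) i 0 = - hopf v i 0 by rewrite mxE.
  by apply/eqP; rewrite -addr_eq0 !mxE -dot_join -P_join H.
move=> i; rewrite P_join dot_join.
by have := congr1 (fun w : 'cV[R]_9 => w i 0) H;
  rewrite !mxE => ->; rewrite addNr.
Qed.

Lemma hopfZ k u : hopf (k *: u) = k ^+ 2 *: hopf u.
Proof.
by apply/colP => i; rewrite !mxE -scalemxAr dotZl dotZr mulrA expr2.
Qed.

(** The images under the Hopf map are opposite and have norms |u|^2 and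
    |v|^2. *)
Lemma focal_norm u v :
  focal_plus P (join u v) -> dot u u = 2^-1 /\ dot v v = 2^-1.
Proof.
move=> /focal_join[uv H].
have := hopf_norm u; rewrite H dotNl dotNr opprK hopf_norm => /eqP.
rewrite eqrXn2 ?dot_ge0 // => /eqP E; move: uv; rewrite E => uv; split; lra.
Qed.

(** An element g moves the image under the Hopf map by an isometry of R^9,
    the same for both spinors. *)
Lemma rho_focal g x : Spin g -> focal_plus P x -> focal_plus P (rho g *m x).
Proof.
move=> Sg; rewrite -[x]spinorK rho_join => /focal_join[uv H]; apply/focal_join.
have orth u : dot (sigma g *m u) (sigma g *m u) = dot u u.
  by rewrite dot_mul mulmxA Spin_orth // mul1mx.
split; first by rewrite !orth.
apply: dot_inj => z; rewrite dotNr -!hopfE.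
have [z' zE] := Spin_conj z Sg.
have E u : dot (spin_mx z *m (sigma g *m u)) (sigma g *m u) = dot z' (hopf u).
  by rewrite -hopfE -zE -!mulmxA dotC dot_mul dotC.
by rewrite !E H dotNr.
Qed.

(** The norm of each of the two spinors at a point of the focal submanifold. *)
Definition r2 : R := (Num.sqrt 2)^-1.

Lemma r2_sq : r2 * r2 = 2^-1.
Proof. by rewrite -expr2 exprVn sqr_sqrtr // ler0n. Qed.

Lemma r2_neq0 : r2 != 0.
Proof. by rewrite invr_eq0 gt_eqF // sqrtr_gt0 ltr0n. Qed.

Definition base : 'cV[R]_32 := r2 *: join (pair16 oct1 0) (pair16 0 oct1).

Lemma rho_base g : rho g *m base = base <->
  sigma g *m pair16 oct1 0 = pair16 oct1 0 /\ sigma g *m pair16 0 oct1 =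
    pair16 0 oct1.
Proof.
rewrite /base -scalemxAr rho_join; split=> [/(scalerI r2_neq0)/join_inj//|].
by case=> -> ->.
Qed.

Lemma focal_base : focal_plus P base.
Proof.
rewrite /base joinZ; apply/focal_join.
rewrite !dotZl !dotZr !dot_pair16 dot_oct1 !dot0r addr0 add0r mulr1 r2_sq.
split; first lra.
rewrite !hopfZ -scalerN; congr (_ *: _); rewrite !hopf_pair.
rewrite oct_mul0l (linear_zero oct_conj_linear) oct_mul0r dot0r dot_oct1
  !scaler0.
apply: dot_inj => z; rewrite dotNr !dot9E !re9_vec !oct9_vec !dot0r; ring.
Qed.

Lemma focal_rescale x : focal_plus P x ->
  let U := r2^-1 *: spinor 0 x in let V := r2^-1 *: spinor 1 x in
  [/\ dot U U = 1, dot V V = 1, hopf U = - hopf V & x = r2 *: join U V].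
Proof.
rewrite -{1}[x]spinorK => fx U V.
have [u1 v1] := focal_norm fx; have /focal_join[_ H] := fx.
have r22 : r2^-1 * (r2^-1 * 2^-1) = 1.
  by rewrite -r2_sq mulrA -invfM mulVf // mulf_neq0 // r2_neq0.
rewrite /U /V !dotZl !dotZr u1 v1 r22 !hopfZ H scalerN; split=> //.
by rewrite joinZ !scalerA mulfV ?r2_neq0 // !scale1r spinorK.
Qed.

Lemma focal_transitive x :
  focal_plus P x -> exists2 g, Spin g & rho g *m base = x.
Proof.
move=> /focal_rescale[U1 V1 UV xE].
have [g [Sg gU gV]] := Spin_transitive U1 V1 UV; exists g => //.
by rewrite /base -scalemxAr rho_join gU gV -xE.
Qed.

Lemma rho_inv g h : Spin g -> sigma h = (sigma g)^T -> rho h *m rho g = 1%:M.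
Proof.
move=> Sg hE; apply: mulmx_colP => x; rewrite -mulmxA mul1mx -[x]spinorK
  !rho_join.
by rewrite !mulmxA hE Spin_orth // !mul1mx.
Qed.

(** The section of the explicit product is defined near one point;
    translating it by an element of the group that moves this point to x
    gives a section near x. *)
Lemma local_section x : focal_plus P x -> exists2 s : 'cV[R]_32 -> Cl R 9,
  smooth_at s x & \forall y \near x, focal_plus P y ->
    Spin (s y) /\ rho (s y) *m base = y.
Proof.
move=> fx.
pose U0 : 'cV[R]_16 := pair16 oct1 0.
pose V0 : 'cV[R]_16 := pair16 0 (delta_mx (inord 1) 0).
have [g0 [Sg0 g0U g0V]] : exists g, [/\ Spin g, sigma g *m pair16 oct1 0 = U0
    & sigma g *m pair16 0 oct1 = V0].
  apply: Spin_transitive.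
  - by rewrite dot_pair16 dot_oct1 dot0r addr0.
  - by rewrite dot_pair16 dot_delta2 eqxx dot0r add0r.
  rewrite !hopf_pair oct_mul0l (linear_zero oct_conj_linear) oct_mul0r.
  rewrite !dot0r dot_oct1 dot_delta2 eqxx mulr1n !scaler0.
  apply: dot_inj => z; rewrite dotNr !dot9E !re9_vec !oct9_vec !dot0r; ring.
have [g1 Sg1 g1x] := focal_transitive fx.
have [h0 Sh0 h0E] := Spin_inv Sg0.
pose g := cl_mul g1 h0.
have Sg : Spin g by apply: Spin_mul.
have [h Sh hE] := Spin_inv Sg.
have hg : rho h *m rho g = 1%:M := rho_inv Sg hE.
have gh : rho g *m rho h = 1%:M := mulmx1C hg.
have hx : rho h *m x = r2 *: join U0 V0.
  have <- : rho g0 *m base = r2 *: join U0 V0.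
    by rewrite /base -scalemxAr rho_join g0U g0V.
  rewrite -{1}g1x -{1}[base]mul1mx -(rho_inv Sg0 h0E) !mulmxA
    -[_ *m rho g1 *m rho h0]mulmxA.
  by rewrite -rho_mul hg mul1mx.
pose U y := r2^-1 *: spinor 0 (rho h *m y).
pose V y := r2^-1 *: spinor 1 (rho h *m y).
have lin k : linear (fun y => r2^-1 *: spinor k (rho h *m y)).
  move=> c y z; rewrite /spinor mulmxDr -scalemxAr mulmxDr -scalemxAr scalerDr
    !scalerA.
  by rewrite mulrC.
have UD : smooth_on setT U by apply: (smooth_mx_linear openT (lin 0));
  exact: (smooth_id openT).
have VD : smooth_on setT V by apply: (smooth_mx_linear openT (lin 1));
  exact: (smooth_id openT).
have [D [oD Dx Ddom secD]] : exists D, [/\ open D, D x,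
    forall y, D y -> sec_dom (U y) (V y) &
      smooth_on D (fun y => sec (U y) (V y))].
  apply: (smooth_sec (t0 := x) openT UD VD) => //.
  rewrite /U /V hx joinZ spinor0_join spinor1_join !scalerA mulVf
    ?r2_neq0 // !scale1r.
  exact: sec_dom_point.
exists (fun y => cl_mul g (sec (U y) (V y))).
  apply: (smooth_on_at oD Dx).
  exact: (smooth_mx_linear oD (@cl_mul_linearr R 9 g) secD).
apply: filterS (open_nbhs_nbhs (conj oD Dx)) => y /Ddom dy fy.
have fhy := rho_focal Sh fy.
have [U1 V1 UV hyE] := focal_rescale fhy.
have [Ss sU sV] := sec_spec U1 V1 UV dy.
split; first exact: Spin_mul.
rewrite rho_mul -mulmxA.
have -> : rho (sec (U y) (V y)) *m base = rho h *m y.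
  by rewrite /base -scalemxAr rho_join sU sV -hyE.
by rewrite mulmxA gh mul1mx.
Qed.

Definition isotropy : set (Cl R 9) := [set g | Spin g /\ rho g *m base = base].

Lemma isotropyP g : isotropy g <-> spinG2 g.
Proof.
split=> [[Sg /rho_base[g1 g2]]|[ge [A GA gA]]].
  by split; [exact: Spin_even|exact: Spin_stab].
have [h Sh hA] := G2_Spin GA.
have <- : h = g by apply: sigma_inj; rewrite ?hA //; apply: Spin_even.
split=> //; apply/rho_base; rewrite hA !diag_pairE mulmx0.
by rewrite (G2_oct1 GA).
Qed.

Lemma rho_linear : linear rho.
Proof. exact: cl_rep_linear. Qed.

Definition act g x : 'cV[R]_32 := rho g *m x.

Lemma act_linearr g : linear (act g).
Proof. by move=> k x y; rewrite /act mulmxDr scalemxAr. Qed.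

Lemma act_linearl x : linear (act^~ x).
Proof. by move=> k g h; rewrite /act rho_linear mulmxDl scalemxAl. Qed.

Lemma act_smooth :
  smooth_action (@cl_mul R 9) (@cl_one R 9) (@Spin R 9) (focal_plus P) act.
Proof.
split.
- exact: rho_focal.
- by move=> x _; rewrite /act rho_one mul1mx.
- by move=> g h x _ _ _; rewrite /act rho_mul mulmxA.
apply: smooth_map_on.
have s1 : smooth_on setT (fun p : Cl R 9 * 'cV[R]_32 => p.1).
  apply: (smooth_lin (L := fst) openT _ (smooth_id openT)) => p; exact: cvg_fst.
have s2 : smooth_on setT (fun p : Cl R 9 * 'cV[R]_32 => p.2).
  apply: (smooth_lin (L := snd) openT _ (smooth_id openT)) => p; exact: cvg_snd.
exact: (smooth_mx_bilinear (B := act) openT act_linearl act_linearr s1 s2).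
Qed.

Lemma act_transitive : transitive_action (@Spin R 9) (focal_plus P) act.
Proof.
move=> x y /focal_transitive[g Sg gx] /focal_transitive[h Sh hy].
have [k Sk kE] := Spin_inv Sg.
exists (cl_mul h k); first exact: Spin_mul.
by rewrite /act rho_mul -gx -mulmxA [rho k *m _]mulmxA (rho_inv Sg kE) mul1mx.
Qed.

Lemma isotropyE : isotropy = spinG2.
Proof. by apply/seteqP; split=> g /isotropyP. Qed.

Lemma isotropy_subgroup :
  closed_subgroup (@cl_mul R 9) (@cl_one R 9) (@Spin R 9) isotropy.
Proof.
split.
- by move=> g [].
- by rewrite isotropyE; exact: spinG2_closed.
- by split; [exact: Spin_one|rewrite rho_one mul1mx].
- move=> g h [Sg gb] [Sh hb]; split; first exact: Spin_mul.
  by rewrite rho_mul -mulmxA hb gb.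
move=> h [Sh hb]; have [k Sk kE] := Spin_inv Sh; exists k.
  by split=> //; rewrite -{1}hb mulmxA (rho_inv Sh kE) mul1mx.
apply: sigma_inj; first by apply: cl_even_mul; exact: Spin_even.
  exact/Spin_even/Spin_one.
by rewrite sigma_mul kE sigma_one; apply: mulmx1C; exact: Spin_orth.
Qed.

(** The value does not depend on the element chosen in the coset. *)
Definition orbit_map (C : set (Cl R 9)) :
  'cV[R]_32 := rho (xget (cl_one R 9) C) *m base.

Lemma orbit_mapE C g x :
  C g -> (forall h, C h -> rho h *m base = x) -> orbit_map C = x.
Proof. by move=> Cg; apply; apply: (@xgetPex _ (cl_one R 9) C); exists g. Qed.

Lemma orbit_lcoset g :
  orbit_map (lcoset (@cl_mul R 9) g isotropy) = rho g *m base.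
Proof.
apply: (orbit_mapE (g := cl_mul g (cl_one R 9))).
  by exists (cl_one R 9) => //; case: isotropy_subgroup.
by move=> _ [h [_ hb] <-]; rewrite rho_mul -mulmxA hb.
Qed.

(** The inverse of the orbit map sends a point to the fibre over it. *)
Lemma fiber_lcoset g : Spin g ->
  [set h | Spin h /\ rho h *m base = rho g *m base] =
  lcoset (@cl_mul R 9) g isotropy.
Proof.
move=> Sg; have [k Sk kE] := Spin_inv Sg; apply/seteqP;
  split=> [h [Sh hb]|_ [h [Sh hb] <-]].
  exists (cl_mul k h).
    split; first exact: Spin_mul.
    by rewrite rho_mul -mulmxA hb mulmxA (rho_inv Sg kE) mul1mx.
  apply: sigma_inj;
    [by do !apply: cl_even_mul; exact: Spin_even|exact: Spin_even|].
  rewrite !sigma_mul mulmxA kE.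
  by have /mulmx1C -> := Spin_orth Sg; rewrite mul1mx.
split; first exact: Spin_mul.
by rewrite rho_mul -mulmxA hb.
Qed.

Lemma orbit_diffeomorphism :
  equivariant_diffeomorphism (@cl_mul R 9) (@Spin R 9) isotropy (focal_plus P)
    act
    orbit_map.
Proof.
split.
- by move=> _ [g Sg <-]; rewrite orbit_lcoset; apply: rho_focal focal_base.
- apply: smooth_map_on.
  have -> : (fun g => orbit_map (lcoset (@cl_mul R 9) g isotropy)) = act^~ base.
    by apply: funext => g; exact: orbit_lcoset.
  exact: (smooth_mx_linear openT (act_linearl base) (smooth_id openT)).
- exists (fun x => [set g | Spin g /\ rho g *m base = x]); split.
  + by move=> _ /focal_transitive[g Sg <-];
      exists g => //; rewrite fiber_lcoset.
  + by move=> _ [g Sg <-]; rewrite orbit_lcoset fiber_lcoset.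
  + by move=> x /focal_transitive[g Sg gx]; apply: (orbit_mapE (g := g)) => //
      h [].
  move=> x /local_section[s ss sx]; exists s => //.
  apply: filterS sx => y H fy; have [Ss sy] := H fy; split=> //.
  by rewrite -{1}sy fiber_lcoset.
move=> g _ Sg [k Sk <-]; rewrite orbit_lcoset.
apply: (orbit_mapE (g := cl_mul g (cl_mul k (cl_one R 9)))).
  exists (cl_mul k (cl_one R 9)) => //; exists (cl_one R 9) => //.
  by case: isotropy_subgroup.
by move=> _ [_ [h [_ hb] <-] <-]; rewrite !rho_mul -!mulmxA hb.
Qed.

(** * Invariant almost complex structures *)

(** The base point is the pair of spinors ((1, 0), (0, 1)). Exchanging them
    with a sign commutes with the group, because both copies of the module
    are isomorphic, and gives this vector. *)
Definition invariant_vec :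
  'cV[R]_32 := r2 *: join (pair16 0 oct1) (- pair16 oct1 0).

Lemma rho_invariant_vec g :
  isotropy g -> rho g *m invariant_vec = invariant_vec.
Proof.
by case=> _ /rho_base[g1 g2]; rewrite /invariant_vec -scalemxAr rho_join mulmxN
  g1 g2.
Qed.

Lemma invariant_vec_neq0 : invariant_vec != 0.
Proof.
apply/eqP => /(congr1 (fun w => dot w w)).
rewrite /invariant_vec dot0r dotZl dotZr dot_join dotNl dotNr opprK !dot_pair16
  dot_oct1 !dot0r.
by rewrite mulrA r2_sq; lra.
Qed.

(** The great circle through the base point in the direction of
    invariant_vec, in a parametrisation without trigonometric functions. *)
Definition base_curve (t : R) : 'cV[R]_32 :=
  (Num.sqrt (1 + t * t))^-1 *: base + ((Num.sqrt (1 + t * t))^-1 * t)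
    *: invariant_vec.

Lemma one_plus_sqr_gt0 t : 0 < 1 + t * t :> R.
Proof. by rewrite -expr2 ltr_wpDr ?sqr_ge0. Qed.

Lemma base_curve_focal t : focal_plus P (base_curve t).
Proof.
have -> : base_curve t = ((Num.sqrt (1 + t * t))^-1 * r2) *:
    join (pair16 oct1 (t *: oct1)) (pair16 (- t *: oct1) oct1).
  have u1 : pair16 oct1 0 + t *: pair16 0 oct1 = pair16 oct1 (t *: oct1) :>
    'cV[R]_16.
    by rewrite addrC pair16D scaler0 add0r addr0.
  have u2 : pair16 0 oct1 + t *: - pair16 oct1 0 = pair16 (- t *: oct1) oct1 :>
    'cV[R]_16.
    by rewrite addrC pair16N pair16D oppr0 scaler0 add0r addr0 scalerN scaleNr.
  rewrite -u1 -u2 /base_curve -scalerA -scalerDr -[in RHS]scalerA;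
    congr (_ *: _).
  rewrite /base /invariant_vec scalerA mulrC -scalerA -scalerDr; congr (_ *: _).
  by rewrite joinZ /join addrACA -!mulmxDr.
have s2 : (Num.sqrt (1 + t * t))^-1 * (Num.sqrt (1 + t * t))^-1 * (1 + t * t) =
  1.
  by rewrite -expr2 exprVn sqr_sqrtr ?mulVf ?gt_eqF ?ltW ?one_plus_sqr_gt0.
rewrite joinZ; apply/focal_join; split.
  rewrite !dotZl !dotZr !dot_pair16 !dotZl !dotZr dot_oct1 !mulr1.
  set s := _^-1 in s2 *; have := r2_sq; set r := r2 => rr.
  have -> : s * r * (s * r * (1 + t * t)) + s * r * (s * r * (- t * - t + 1)) =
    2 * (r * r) * (s * s * (1 + t * t)) by ring.
  by rewrite s2 rr mulr1 mulfV // pnatr_eq0.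
rewrite !hopfZ -scalerN; congr (_ *: _); rewrite !hopf_pair.
rewrite !dotZl !dotZr dot_oct1 oct_mulZl (linear_scale oct_conj_linear)
  oct_mulZr.
rewrite oct_conj1 oct_mul1x !scalerA.
apply: dot_inj => z; rewrite dotNr !dot9E !re9_vec !oct9_vec !dotZr; ring.
Qed.

Lemma tangent_invariant_vec : tangent (focal_plus P) base invariant_vec.
Proof.
have sid : smooth_on setT (fun t : R => t) by exact: (smooth_id openT).
have stt : smooth_on setT (fun t : R => 1 + t * t).
  by apply: smoothD;
    [exact: openT|exact: smooth_cst|apply: smoothM => //; exact: openT].
have ss : smooth_on setT (fun t : R => (Num.sqrt (1 + t * t))^-1).
  by apply: smooth_invsqrt =>
    //; [exact: openT|move=> t _; exact: one_plus_sqr_gt0].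
have sst : smooth_on setT (fun t : R => (Num.sqrt (1 + t * t))^-1 * t).
  by apply: smoothM => //; exact: openT.
have s0 : (Num.sqrt (1 + 0 * 0 : R))^-1 = 1 by rewrite mulr0 addr0 sqrtr1 invr1.
exists base_curve; split.
- apply: (smooth_on_at openT) => //; apply: smoothD; first exact: openT.
    by apply: smooth_scale => //; exact: openT.
  by apply: smooth_scale => //; exact: openT.
- by rewrite /base_curve s0 mulr0 scale0r addr0 scale1r.
- by near=> t; exact: base_curve_focal.
have ds := smooth_on_differentiable ss (I : setT 0).
have dst := smooth_on_differentiable sst (I : setT 0).
have dtt := smooth_on_differentiable stt (I : setT 0).
have D2 : 'D_1 (fun t : R => 1 + t * t) 0 = 0.
  rewrite -[fun t : R => _]/(cst 1 + (id : R -> R) * id) deriveD; last 2 first.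
  - exact: derivable_cst.
  - by apply: derivableM; exact: derivable_id.
  rewrite derive_cst deriveM; [|exact: derivable_id|exact: derivable_id].
  by rewrite derive_id scale0r !addr0.
have [_ D1] := derive_invsqrt (f := fun t : R => 1 + t * t) (1 : R)
  (one_plus_sqr_gt0 0) dtt.
rewrite D2 !mulr0 in D1.
have D3 : 'D_1 (fun t : R => (Num.sqrt (1 + t * t))^-1 * t) 0 = 1.
  rewrite -[fun t : R => _]/((fun t : R => (Num.sqrt (1 + t * t))^-1) * id)
    deriveM.
  - by rewrite derive_id s0 scale1r scale0r addr0.
  - exact: diff_derivable.
  - exact: derivable_id.
have [d1 E1] := derive_scale base (1 : R) ds.
have [d2 E2] := derive_scale invariant_vec (1 : R) dst.
rewrite -[base_curve]/((fun t : R => (Num.sqrt (1 + t * t))^-1 *: base) +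
  (fun t : R => ((Num.sqrt (1 + t * t))^-1 * t) *: invariant_vec)) deriveD;
    last 2 first.
- exact: diff_derivable.
- exact: diff_derivable.
by rewrite E1 E2 D1 D3 scale0r add0r scale1r.
Unshelve. all: by end_near. Qed.

(** Any local extension F of the action of g agrees with it along a curve in
    the submanifold with velocity v, hence has the same derivative along v. *)
Lemma tangent_map_act g x (v : 'cV[R]_32) : tangent (focal_plus P) x v ->
  tangent_map (focal_plus P) (act g) x v = rho g *m v.
Proof.
move=> [c [sc c0 cM cv]]; have dc := smooth_at_differentiable sc.
rewrite /tangent_map; set W := [set w | _].
have Dg : forall w (f : R -> 'cV[R]_32), differentiable f w ->
    'D_1 (fun t => act g (f t)) w = act g ('D_1 f w).
  by move=> w f df; exact: (derive_mx_linear (1 : R) (act_linearr g) df).2.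
have sg : smooth_on setT (act g).
  exact: (smooth_mx_linear openT (act_linearr g) (smooth_id openT)).
have [F [[sF Fg] ->]] : W (xget 0 W).
  apply: xgetPex; exists ('D_v (act g) x), (act g); split=> //.
  by split; [exact: (smooth_on_at openT)|near=> y].
have dF : differentiable F (c 0) by rewrite c0; exact: smooth_at_differentiable.
have -> : 'D_v F x = 'D_1 (F \o c) 0.
  rewrite [RHS]deriveE; last exact: differentiable_comp.
  by rewrite diff_comp //= -(deriveE _ dc) cv c0 deriveE // -c0.
rewrite -cv -[RHS]Dg //; apply: near_eq_derive.
have cc : {for 0, continuous c} := differentiable_continuous dc.
have nF : \forall t \near 0, focal_plus P (c t) -> F (c t) = act g (c t).
  by apply: (cc (fun y => focal_plus P y -> F y = act g y)); rewrite c0.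
by apply: filterS2 cM nF => t Mt; apply.
Unshelve. all: by end_near. Qed.

Lemma isotropy_flip N : N \in fano_flips -> exists2 g, isotropy g &
  sigma g = diag_pair (mx_of (@oct_flip R N)).
Proof.
move=> FN; have flipE := mx_ofE _ (@oct_flip_linear R N).
have GA : G2 (mx_of (@oct_flip R N)).
  split; last by move=> x y; rewrite !flipE oct_flipM.
  suff AA : mx_of (@oct_flip R N) *m mx_of (@oct_flip R N) = 1%:M.
    by have [] := mulmx1_unit AA.
  by apply: mulmx_colP => x; rewrite -mulmxA !flipE oct_flipK mul1mx.
have [g Sg gA] := G2_Spin GA; exists g => //.
by apply/isotropyP; split; [exact: Spin_even|exists (mx_of (@oct_flip R N))].
Qed.

(** The octonions fixed by G_2 are the reals, so w is given by the four real
    numbers a1, a2, b1, b2. Orthogonality to the base point and to its images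
    under the vectors e0 and (0, 1) gives three independent linear equations. *)
Lemma isotropy_fixed w : tangent (focal_plus P) base w ->
  (forall g, isotropy g -> rho g *m w = w) -> exists k, w = k *: invariant_vec.
Proof.
move=> tw fw.
have wfix N : N \in fano_flips ->
    [/\ oct_flip N (fst16 (spinor 0 w)) = fst16 (spinor 0 w),
        oct_flip N (snd16 (spinor 0 w)) = snd16 (spinor 0 w),
        oct_flip N (fst16 (spinor 1 w)) = fst16 (spinor 1 w)
      & oct_flip N (snd16 (spinor 1 w)) = snd16 (spinor 1 w)].
  have flipE := mx_ofE _ (@oct_flip_linear R N).
  move=> /isotropy_flip[g ig gA]; have := fw g ig.
  rewrite -{1 2}[w]spinorK rho_join => /join_inj[].
  rewrite gA -{1 2}[spinor 0 w]pair16K -{1 2}[spinor 1 w]pair16K !diag_pairE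
    !flipE.
  by move=> /pair16_inj[-> ->] /pair16_inj[-> ->].
have [a1 [a2 [b1 [b2 [E1 E2]]]]] : exists a1 a2 b1 b2,
    spinor 0 w = pair16 (a1 *: oct1) (a2 *: oct1) /\
    spinor 1 w = pair16 (b1 *: oct1) (b2 *: oct1).
  rewrite -[spinor 0 w]pair16K -[spinor 1 w]pair16K; do 4 eexists.
  by split; congr pair16; apply: oct_flip_fixed => N /wfix[].
have q1 : dot base w = 0.
  have := tangent_quadratic (A := 1%:M) (q := 1) (trmx1 _ _) _ tw.
  by rewrite mul1mx; apply=> y /focal_plusP[]; rewrite mul1mx.
have q2 z : dot (spin_mx z *m pair16 oct1 0) (spinor 0 w) +
    dot (spin_mx z *m pair16 0 oct1) (spinor 1 w) = 0.
  rewrite spin_mxS !mulmx_suml !(dotC _ (spinor _ w)) !dot_sumr -big_split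
    big1 // => i _.
  rewrite /= -!scalemxAl !dotZr -mulrDr -!(dotC _ (spinor _ w))
    -dot_join spinorK -P_join.
  have := tangent_quadratic (A := P i) (q := 0) (Psym i) _ tw.
  rewrite /base -scalemxAr dotZl => H.
  have /eqP := H (fun y fy => ((focal_plusP y).1 fy).2 i).
  by rewrite mulf_eq0 (negbTE r2_neq0) /= => /eqP ->; rewrite mulr0.
have H1 : a1 + b2 = 0.
  move: q1; rewrite -[w]spinorK E1 E2 /base dotZl dot_join !dot_pair16 !dot0l.
  rewrite !dotZr dot_oct1 !mulr1 addr0 add0r => /eqP.
  by rewrite mulf_eq0 (negbTE r2_neq0) => /eqP.
have H2 : a1 - b2 = 0.
  have := q2 e0; rewrite E1 E2 !spin_e0E !dot_pair16 oppr0 !dot0l dotNl !dotZr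
    dot_oct1.
  by rewrite !mulr1 addr0 add0r.
have H3 : a2 + b1 = 0.
  have := q2 (vec9 0 oct1); rewrite E1 E2 !spin_octE !dot_pair16 !oct_mul0r
    oct_conj1.
  by rewrite oct_mulx1 !dot0l !dotZr dot_oct1 !mulr1 addr0 add0r.
have a10 : a1 = 0 by lra.
have b20 : b2 = 0 by lra.
have b1E : b1 = - a2 by lra.
exists (a2 / r2); rewrite -[w]spinorK E1 E2 /invariant_vec scalerA mulfVK
  ?r2_neq0 // joinZ.
by rewrite a10 b20 b1E pair16N !pair16Z !scale0r oppr0 !scaler0 scalerN scaleNr.
Qed.

(** Invariance makes J invariant_vec a fixed vector of the isotropy group,
    hence a multiple k of invariant_vec, and k^2 = -1 is impossible. *)
Lemma no_invariant_structure : ~ exists J : 'cV[R]_32 -> 'cV[R]_32 -> 'cV[R]_32,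
  almost_complex_structure (focal_plus P) J /\
  invariant_structure (@Spin R 9) (focal_plus P) act J.
Proof.
move=> [J [[JT Jlin JJ _] Jinv]].
have fb := focal_base; have t0 := tangent_invariant_vec.
have tJ := JT base invariant_vec fb t0.
have [k Jk] : exists k, J base invariant_vec = k *: invariant_vec.
  apply: isotropy_fixed => // g ig; have [Sg gb] := ig.
  have := Jinv g base invariant_vec Sg fb t0.
  rewrite !tangent_map_act // /act gb rho_invariant_vec //.
have := JJ base invariant_vec fb t0.
have -> : J base (J base invariant_vec) = (k * k) *: invariant_vec.
  have {1}-> : J base invariant_vec = (k - 1) *: invariant_vec +
    invariant_vec by rewrite Jk -{3}[invariant_vec]scale1r -scalerDl subrK.
  by rewrite Jlin // Jk scalerA -scalerDl mulrBl mul1r subrK.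
move=> /eqP; rewrite -subr_eq0 opprK -{2}[invariant_vec]scale1r -scalerDl
  scaler_eq0 (negbTE invariant_vec_neq0) orbF.
by rewrite -expr2 addrC gt_eqF // one_plus_sqr_gt0.
Qed.

End Focal.

(** * The theorem *)

(** The polynomial depends on the squares of the quadratic forms only. *)
Lemma focal_plus_sign (R : realType) m N (P : 'I_m.+1 -> 'M[R]_N) (s : R) :
  s * s = 1 -> focal_plus (fun i => s *: P i) = focal_plus P.
Proof.
move=> s2; apply/seteqP; rewrite /focal_plus /FKM_polynomial.
have E x : \sum_(i < m.+1) dot ((s *: P i) *m x) x ^+ 2 =
    \sum_(i < m.+1) dot (P i *m x) x ^+ 2.
  by apply: eq_bigr => i _; rewrite -scalemxAl dotZl exprMn expr2 s2 mul1r.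
by split=> x; rewrite /= E.
Qed.

Theorem proposition2 (R : realType) (P : 'I_9 -> 'M[R]_32)
    (P_clifford : symmetric_clifford_system P) (P_definite : definite P) :
  exists a : Cl R 9 -> 'cV[R]_32 -> 'cV[R]_32,
    [/\ smooth_action (@cl_mul R 9) (@cl_one R 9) (@Spin R 9) (focal_plus P) a,
        transitive_action (@Spin R 9) (focal_plus P) a,
        exists H : set (Cl R 9),
          [/\ closed_subgroup (@cl_mul R 9) (@cl_one R 9) (@Spin R 9) H,
              lie_isomorphic (@cl_mul R 9) H mulmx (@G2 R)
            & exists f : set (Cl R 9) -> 'cV[R]_32,
                equivariant_diffeomorphism (@cl_mul R 9) (@Spin R 9) H
                  (focal_plus P) a f]
      & ~ exists J : 'cV[R]_32 -> 'cV[R]_32 -> 'cV[R]_32,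
            almost_complex_structure (focal_plus P) J /\
            invariant_structure (@Spin R 9) (focal_plus P) a J].
Proof.
have [Psym Pcliff] := P_clifford; have [e e2 mvol] := @model_vol R.
have [d d2 Pvol] : exists2 d : R, d * d = 1 & blade P [set: 'I_9]%SET = d%:A.
  have -> : blade P [set: 'I_9]%SET = \big[mulmx/1%:M]_(i < 9) P i.
    by rewrite /blade; apply: eq_bigl => i; rewrite inE.
  case: P_definite => ->; [exists 1|exists (-1)];
    rewrite ?mulr1 ?mulrNN ?mulr1 //.
    by rewrite scale1r.
  by rewrite scaleN1r.
(* The volume elements of P and of the model are the signs d and e. The
   number of generators is odd, so a common sign s of the P_i multiplies the
   volume element by s^9 = s. *)
pose s := d * e; have s2 : s * s = 1 by rewrite /s mulrACA d2 e2 mulr1.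
pose P' i := s *: P i; rewrite -(focal_plus_sign P s2) -/P'.
have sym i : (P' i)^T = P' i.
  by rewrite /P' -[in RHS]Psym; apply/matrixP => a b; rewrite !mxE.
have cliff i j : P' i * P' j + P' j * P' i = 2 *+ (i == j).
  rewrite -!scalerAl -!scalerAr !scalerA s2 !scale1r -!mulmxE Pcliff.
  by case: (i == j); rewrite ?raddf0 // -[2]/(1 *+ 2) !mulr1n raddfMn.
have vol : blade P' [set: 'I_9]%SET = e%:A.
  rewrite bladeZ cardsT card_ord Pvol scalerA; congr (_ *: _).
  by rewrite exprSr (exprM s 2 4) expr2 s2 expr1n mul1r /s mulrAC d2 mul1r.
have [X [XX sumXX PX]] := intertwiners (m := 2) (@model_sym R) (@model_cliff R)
  sym cliff model_dim isT erefl e2 mvol vol.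
exists (act P'); split.
- exact: (act_smooth cliff XX sumXX PX).
- exact: (act_transitive cliff XX sumXX PX).
- exists (isotropy P' X); split.
  + exact: (isotropy_subgroup cliff XX sumXX PX).
  + by rewrite (isotropyE XX PX); exact: spinG2_lie.
  + by exists (orbit_map P' X); exact: (orbit_diffeomorphism cliff XX sumXX PX).
exact: (no_invariant_structure sym XX sumXX PX).
Qed.
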